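(* Let $\mathcal K$ be a simplicial complex on $[m]$ and let $\mathfrak h\subset\mathfrak t_{\mathbb C}\cong\mathbb C^m$ be a complex subspace satisfying conditions (a) and (b) of the context. Let $M=U(\mathcal K)/H$, $H=\exp\mathfrak h\subset T_{\mathbb C}=(\mathbb C^* )^m$, be the corresponding compact complex manifold with maximal torus action. Assume that (i) $U(\mathcal K)$ is simply connected; (ii) the only linear function $u\in N^*\subset\mathfrak t^*$ vanishing identically on $p(\mathfrak h)$ is zero, where $N^*\cong\mathbb Z^m$ is the character lattice of $T=(S^1)^m$. Then there are no non-constant meromorphic functions on $M$.
   Context: A simplicial complex on $[m]=\{1,\dots,m\}$ is a family $\mathcal K$ of subsets of $[m]$ closed under taking subsets and containing $\varnothing$ (it is not required that every singleton belongs to $\mathcal K$). A fan in a finite-dimensional real vector space is a finite set of strictly convex polyhedral cones, closed under taking faces, in which the intersection of any two cones is a face of each. It is complete if the union of its cones is the whole space. Let $T=(S^1)^m\subset T_{\mathbb C}=(\mathbb C^* )^m$, let $\mathfrak t\cong\mathbb R^m$ be the Lie algebra of $T$ with standard basis $e_1,\dots,e_m$, and let $\mathfrak t_{\mathbb C}=\mathfrak t\oplus i\mathfrak t\cong\mathbb C^m$ be the Lie algebra of $T_{\mathbb C}$, with exponential map $\exp:\mathfrak t_{\mathbb C}\to T_{\mathbb C}$. Let $p:\mathfrak t_{\mathbb C}\to\mathfrak t$ be the projection onto the real part. Let $\Sigma_{\mathcal K}$ be the fan in $\mathfrak t$ consisting of the cones $\{\sum_{i\in I}\mu_ie_i:\mu_i\ge0\}$,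 $I\in\mathcal K$, and let $$U(\mathcal K)=\mathbb C^m\setminus\bigcup_{J\notin\mathcal K}\{z\in\mathbb C^m: z_j=0\text{ for all }j\in J\},$$ on which $(\mathbb C^* )^m$ acts coordinatewise. The conditions on $\mathfrak h$ are: (a) the group $H=\exp\mathfrak h$ intersects trivially every coordinate subtorus $(\mathbb C^* )^I=\{t\in(\mathbb C^* )^m: t_j=1\text{ for }j\notin I\}$ with $I\in\mathcal K$; (b) the projection $q:\mathfrak t\to\mathfrak t/p(\mathfrak h)$ maps the fan $\Sigma_{\mathcal K}$ bijectively onto a complete fan, i.e. $q(\Sigma_{\mathcal K})=\{q(\sigma):\sigma\in\Sigma_{\mathcal K}\}$ is a complete fan in $\mathfrak t/p(\mathfrak h)$ and $q$ restricts to a bijection from the union of the cones of $\Sigma_{\mathcal K}$ onto $\mathfrak t/p(\mathfrak h)$. Under (a) and (b) the group $H$ acts freely and properly on $U(\mathcal K)$, and $U(\mathcal K)/H$ is a compact complex manifold with a maximal torus action. *)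

(* Defs.v *)
From HB Require Import structures.
From mathcomp Require Import all_boot all_order all_algebra.
From mathcomp Require Import ring complex.
From mathcomp Require Import all_classical all_reals all_analysis.
Set Implicit Arguments.
Unset Strict Implicit.
Unset Printing Implicit Defensive.
Import Order.TTheory GRing.Theory Num.Theory.
Import numFieldNormedType.Exports.

Local Open Scope classical_set_scope.
Local Open Scope ring_scope.
Local Open Scope complex_scope.
Local Open Scope quotient_scope.

(* The metric topology of the complex numbers, as a normed module over itself. *)
HB.instance Definition _ (R : realType) := NormedModule.copy R[i] R[i]^o.

(* Ghost vertices (singletons outside [K]) are allowed. *)
Definition simplicial_complex (m : nat) (K : {set {set 'I_m}}) : Prop :=
  finset.set0 \in K /\ forall I J : {set 'I_m}, I \in K -> J \subset I -> J \in K.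

Section Fans.
Variables (R : realType) (W : vectType R).

Definition cone (J : finType) (A : {set J}) (v : J -> W) : set W :=
  [set \sum_(j in A) mu j *: v j | mu in [set mu : J -> R | forall j, 0 <= mu j]].

Definition polyhedral_cone (s : set W) : Prop :=
  exists (n : nat) (v : 'I_n -> W), s = cone [set: 'I_n]%SET v.

Definition strictly_convex (s : set W) : Prop :=
  forall x, s x -> s (- x) -> x = 0.

(* The choice [l = 0] makes every cone a face of itself. *)
Definition face (t s : set W) : Prop :=
  exists l : 'Hom(W, R^o),
    (forall x, s x -> 0 <= l x) /\ t = s `&` [set x | l x = 0].

Definition fan (S : set (set W)) : Prop :=
  [/\ finite_set S,
      forall s, S s -> polyhedral_cone s /\ strictly_convex s,
      forall s t, S s -> face t s -> S t &
      forall s t, S s -> S t -> face (s `&` t) s /\ face (s `&` t) t].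

Definition support (S : set (set W)) : set W := \bigcup_(s in S) s.

Definition complete_fan (S : set (set W)) : Prop :=
  fan S /\ support S = setT.

End Fans.

(* [q : V -> W] is a model of the quotient projection of [V] by the subspace
   with underlying set [L]; such a [q] is unique up to unique isomorphism. *)
Definition quotient_projection (R : realType) (V W : vectType R)
    (L : set V) (q : 'Hom(V, W)) : Prop :=
  limg q = fullv /\ forall x, q x = 0 <-> L x.

Definition coord_fan (R : realType) (m : nat) (K : {set {set 'I_m}}) :
    set (set 'rV[R]_m) :=
  [set cone I (fun i : 'I_m => 'e_i) | I in [set I | I \in K]].
Arguments coord_fan R {m} K.

Section Torus.
Variables (R : realType) (m : nat).

Definition cexp (z : R[i]) : R[i] :=
  (expR (complex.Re z))%:C * (cos (complex.Im z) +i* sin (complex.Im z)).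

(* The real part of the Lie algebra is that of the compact torus, so the
   exponential map is [v |-> exp (2 i pi v)] coordinatewise; with this
   normalisation the lattice [N] is [Z^m]. As the subspaces to which it is
   applied are complex, dropping the factor [2 i pi] would not change their
   images. *)
Definition texp (v : 'rV[R[i]]_m) : 'rV[R[i]]_m :=
  \row_j cexp ((0 +i* (pi *+ 2)) * v 0 j).

(* Multiplication in the torus, and its coordinatewise action on [C^m]. *)
Definition tact (t z : 'rV[R[i]]_m) : 'rV[R[i]]_m := \row_j (t 0 j * z 0 j).

Definition subtorus (I : {set 'I_m}) : set 'rV[R[i]]_m :=
  [set t | (forall j, t 0 j != 0) /\ forall j, j \notin I -> t 0 j = 1].

Variable h : {vspace 'rV[R[i]]_m}.

Definition expH : set 'rV[R[i]]_m := [set texp v | v in [set v | v \in h]].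

Definition re_proj : set 'rV[R]_m :=
  [set map_mx (@complex.Re R) v | v in [set v | v \in h]].

Definition condition_a (K : {set {set 'I_m}}) : Prop :=
  forall I, I \in K -> expH `&` subtorus I = [set const_mx 1].

Definition condition_b (K : {set {set 'I_m}}) : Prop :=
  exists (W : vectType R) (q : 'Hom('rV[R]_m, W)),
    [/\ quotient_projection re_proj q,
        complete_fan [set q @` s | s in coord_fan R K] &
        set_bij (support (coord_fan R K)) [set: W] q].

(* Elements of the character lattice are integer covectors. *)
Definition no_rational_annihilator : Prop :=
  forall u : 'rV[int]_m,
    (forall x, re_proj x -> \sum_j (u 0 j)%:~R * x 0 j = 0) -> u = 0.

End Torus.

Section SimplyConnected.
Variables (R : realType) (X : topologicalType).

Definition path_connected : Prop :=
  forall x y : X, exists2 g : R -> X,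
    {within `[0, 1]%classic, continuous g} & g 0 = x /\ g 1 = y.

Definition null_homotopic (g : R -> X) : Prop :=
  exists2 F : R * R -> X,
    {within `[0, 1]%classic `*` `[0, 1]%classic, continuous F} &
    [/\ forall t, `[0, 1]%classic t -> F (0, t) = g t,
        forall t, `[0, 1]%classic t -> F (1, t) = g 0 &
        forall s, `[0, 1]%classic s -> F (s, 0) = g 0 /\ F (s, 1) = g 0].

Definition simply_connected : Prop :=
  [/\ inhabited X, path_connected &
      forall g : R -> X, {within `[0, 1]%classic, continuous g} ->
        g 0 = g 1 -> null_homotopic g].

End SimplyConnected.

(* A complex space is given by its holomorphic functions: [hol V f] means that
   [f] restricted to the open set [V] is holomorphic. A meromorphic function is
   a section of the sheaf of fractions: near each point [x] it is [mero_num x / mero_den x]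
   on [mero_dom x], where the germ of [mero_den x] is nowhere zero, and the fractions
   agree on overlaps. *)
Section Meromorphic.
Variables (R : realType) (X : topologicalType) (hol : set X -> set (X -> R[i])).

Record meromorphic := Meromorphic {
  mero_dom : X -> set X;
  mero_num : X -> X -> R[i];
  mero_den : X -> X -> R[i];
  mero_dom_open : forall x, open (mero_dom x);
  mero_dom_mem : forall x, mero_dom x x;
  mero_num_hol : forall x, hol (mero_dom x) (mero_num x);
  mero_den_hol : forall x, hol (mero_dom x) (mero_den x);
  mero_den_regular : forall x V, open V -> V !=set0 -> V `<=` mero_dom x ->
    exists2 z, V z & mero_den x z != 0;
  mero_compat : forall x y z, mero_dom x z -> mero_dom y z ->
    mero_num x z * mero_den y z = mero_num y z * mero_den x z
}.

Definition constant_meromorphic (f : meromorphic) : Prop :=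
  exists c : R[i], forall x z, mero_dom f x z -> mero_num f x z = c * mero_den f x z.

End Meromorphic.

Section TorusExp.
Variables (R : realType) (m : nat).
Implicit Types v w z : 'rV[R[i]]_m.

Lemma cexpD (x y : R[i]) : cexp (x + y) = cexp x * cexp y.
Proof.
case: x => a b; case: y => c d; rewrite /cexp /= expRD cosD sinD.
by apply/eqP; rewrite eq_complex /=; apply/andP; split; apply/eqP;
  rewrite ?mul0r ?subr0 ?addr0; ring.
Qed.

Lemma cexp0 : cexp (0 : R[i]) = 1.
Proof.
by rewrite /cexp /= expR0 cos0 sin0; apply/eqP; rewrite eq_complex /=;
  rewrite !(mulr0, mulr1, mul0r, subr0, addr0) !eqxx.
Qed.

Lemma texpD v w z : tact (texp (v + w)) z = tact (texp v) (tact (texp w) z).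
Proof. by apply/rowP => j; rewrite !mxE mulrDr cexpD mulrA. Qed.

Lemma texp0 z : tact (texp 0) z = z.
Proof. by apply/rowP => j; rewrite !mxE mulr0 cexp0 mul1r. Qed.

End TorusExp.

Section Quotient.
Variables (R : realType) (m : nat) (K : {set {set 'I_m}}).
Variable h : {vspace 'rV[R[i]]_m}.

Definition UK : set 'rV[R[i]]_m :=
  ~` \bigcup_(J in [set J : {set 'I_m} | J \notin K])
       [set z | forall j, j \in J -> z 0 j = 0].

Definition same_orbit : rel (set_type UK) :=
  fun x y => `[< exists2 t, expH h t & \val y = tact t (\val x) >].

Lemma same_orbit_equiv : equiv_class_of same_orbit.
Proof.
split.
- move=> x; apply/asboolP; exists (texp 0); last by rewrite texp0.
  by exists 0 => //=; exact: mem0v.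
- have sym x y : same_orbit x y -> same_orbit y x.
    move=> /asboolP[_ [v /= vh <-] yE]; apply/asboolP; exists (texp (- v)).
      by exists (- v) => //=; rewrite memvN.
    by rewrite [\val y]yE -texpD addNr texp0.
  by move=> x y; apply/idP/idP; exact: sym.
- move=> y x z /asboolP[_ [v /= vh <-] yE] /asboolP[_ [w /= wh <-] zE].
  apply/asboolP; exists (texp (w + v)); last by rewrite [\val z]zE [\val y]yE -texpD.
  by exists (w + v) => //=; exact: memvD.
Qed.

Canonical same_orbit_rel := EquivRelPack same_orbit_equiv.

Definition UKmodH : Type := quotient_topology {eq_quot same_orbit_rel}.
HB.instance Definition _ := Topological.on UKmodH.
HB.instance Definition _ := Quotient.on UKmodH.

(* [f] is holomorphic on [V] when its pullback to [U(K)] is; [valL_ 0] extends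
   the pullback from the open set [U(K)] to [C^m] by zero, which does not affect
   complex differentiability at points of [U(K)]. *)
Definition quotient_hol (V : set UKmodH) (f : UKmodH -> R[i]) : Prop :=
  forall x : set_type UK, V (\pi_UKmodH x) ->
    differentiable
      (valL_ 0 (fun y : set_type UK => f (\pi_UKmodH y)) : 'rV[R[i]]_m -> R[i])
      (\val x).

End Quotient.

Arguments UK R {m} K.
Arguments UKmodH {R m} K h.
Arguments quotient_hol {R m} K h V f.

(* Main.v *)
(* A meromorphic function on M pulls back to an H-invariant meromorphic function
   on U(K). Simple connectivity forbids ghost vertices, since a loop around a
   missing hyperplane z_i = 0 has winding number one; hence U(K) contains all
   points with at most one zero coordinate, and the pull-back extends
   meromorphically across the origin (Levi). The extension is obtained from the
   moments mu_k(w) of the function on a circle in the line w + C d, which are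
   holomorphic in w near 0: for w in some ball the whole disc of the line lies in
   the domain, so that the mu_k(w) satisfy a linear recurrence (Kronecker); by
   Baire's theorem all Hankel minors of some fixed size vanish identically, and a
   nonzero minor of maximal size yields recurrence coefficients that are
   holomorphic in w, hence a quotient P / Q.

   Invariance under H reads P(tz) Q(z) = P(z) Q(tz) for small t in H. The lowest
   homogeneous parts of P and Q then have a constant ratio: they are combinations
   of monomials, on which h acts through characters that are pairwise distinct by
   (ii), hence linearly independent. Replacing P by P - cQ, whose lowest part
   would again be proportional to that of Q, gives P = cQ. The identity theorem
   propagates this equality along paths in U(K). *)
From HB Require Import structures.
From mathcomp Require Import all_boot all_order all_algebra.
From mathcomp Require Import ring lra complex.
From mathcomp Require Import all_classical all_reals all_analysis.
Require Import Defs.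
Set Implicit Arguments.
Unset Strict Implicit.
Unset Printing Implicit Defensive.
Import Order.TTheory GRing.Theory Num.Theory.
Import numFieldNormedType.Exports.

Local Open Scope classical_set_scope.
Local Open Scope ring_scope.
Local Open Scope complex_scope.

(** * Norms and derivatives over the complex numbers *)

(** The function is given only by local fractions, so a denominator valid on a whole disc must be
    produced before any moment relation can be written. It exists on lines that avoid all points
    with two zero coordinates and on which the chosen local denominators do not vanish identically;
    both are arranged by perturbing an explicit line. The degree of that denominator depends on the
    line, which is what calls for Baire's theorem. The function theory starts from rectangles: the
    exponential maps a rectangle onto an annulus, so Goursat's theorem makes circle means
    independent of the radius, and Cauchy's formula and Taylor bounds with explicit remainder follow
    without infinite series. In several variables holomorphy is differentiability along complex
    lines, so results are reduced to one variable. For the lowest parts, invariance is an identity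
    between finite combinations of characters, known only for elements of H near 1. Independence
    kills every coefficient, so the identity holds for every multiplier in C^m, and the constant is
    read off at a point without zero coordinates. *)

(* The library's norm on a normed module over [R[i]] takes its values in [R[i]]. *)
Definition rnorm {R : realType} {V : normedZmodType R[i]} (x : V) : R :=
  complex.Re `|x|.

Section RealNorm.
Variable R : realType.
Local Notation C := R[i].

Section Normed.
Variable V : normedZmodType C.
Implicit Types x y : V.

Lemma normE x : `|x| = (rnorm x)%:C.
Proof. by rewrite /rnorm RRe_real // ger0_real. Qed.

Lemma rnorm_ge0 x : 0 <= rnorm x.
Proof. by rewrite -ler0c -normE. Qed.

Lemma rnormD x y : rnorm (x + y) <= rnorm x + rnorm y.
Proof. by rewrite -lecR rmorphD /= -!normE ler_normD. Qed.

Lemma rnormN x : rnorm (- x) = rnorm x.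
Proof. by rewrite /rnorm normrN. Qed.

Lemma rnormC x y : rnorm (x - y) = rnorm (y - x).
Proof. by rewrite -rnormN opprB. Qed.

Lemma rnormB x y : rnorm (x - y) <= rnorm x + rnorm y.
Proof. by rewrite (le_trans (rnormD _ _)) // rnormN. Qed.

Lemma rnorm0 : rnorm (0 : V) = 0.
Proof. by rewrite /rnorm normr0. Qed.

Lemma rnorm0_eq0 x : (rnorm x == 0) = (x == 0).
Proof. by rewrite -(inj_eq (@complexI R)) -normE normr_eq0. Qed.

Lemma rnorm_gt0 x : (0 < rnorm x) = (x != 0).
Proof. by rewrite lt_neqAle rnorm_ge0 andbT eq_sym rnorm0_eq0. Qed.

Lemma rnorm_lt x (e : R) : (`|x| < e%:C) = (rnorm x < e).
Proof. by rewrite normE ltcR. Qed.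

Lemma rnorm_sum (I : Type) (s : seq I) (P : pred I) (F : I -> V) :
  rnorm (\sum_(i <- s | P i) F i) <= \sum_(i <- s | P i) rnorm (F i).
Proof.
elim/big_ind2 : _ => [|a b c d ab cd|//]; first by rewrite rnorm0.
by rewrite (le_trans (rnormD _ _)) // lerD.
Qed.

Lemma rnorm_triangle x y z : rnorm (x - z) <= rnorm (x - y) + rnorm (y - z).
Proof. by rewrite (le_trans _ (rnormD _ _)) // addrA subrK. Qed.

End Normed.

Lemma rnormZ (V : normedModType C) (k : C) (x : V) :
  rnorm (k *: x) = rnorm k * rnorm x.
Proof. by apply: (@complexI R); rewrite rmorphM /= -!normE normrZ. Qed.

Lemma rnormM (x y : C) : rnorm (x * y) = rnorm x * rnorm y.
Proof. by apply: (@complexI R); rewrite rmorphM /= -!normE normrM. Qed.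

Lemma rnormV (x : C) : rnorm x^-1 = (rnorm x)^-1.
Proof. by apply: (@complexI R); rewrite fmorphV /= -!normE normfV. Qed.

Lemma rnormX (x : C) n : rnorm (x ^+ n) = rnorm x ^+ n.
Proof. by apply: (@complexI R); rewrite rmorphXn /= -!normE normrX. Qed.

Lemma rnorm1 : rnorm (1 : C) = 1.
Proof. by rewrite /rnorm normr1. Qed.

Lemma rnorm_prod (I : Type) (s : seq I) (P : pred I) (F : I -> C) :
  rnorm (\prod_(i <- s | P i) F i) = \prod_(i <- s | P i) rnorm (F i).
Proof.
by elim/big_rec2 : _ => [|i a b _ <-]; rewrite ?rnorm1 // rnormM.
Qed.

Lemma rnorm_real (x : R) : rnorm (x%:C : C) = `|x|.
Proof. by rewrite /rnorm normc_def /= expr0n addr0 sqrtr_sqr. Qed.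

Lemma rnormE (x : C) : rnorm x = Num.sqrt (complex.Re x ^+ 2 + complex.Im x ^+ 2).
Proof. by rewrite /rnorm normc_def. Qed.

Lemma Re_le_rnorm (x : C) : `|complex.Re x| <= rnorm x.
Proof. by rewrite rnormE -sqrtr_sqr ler_wsqrtr // lerDl sqr_ge0. Qed.

Lemma Im_le_rnorm (x : C) : `|complex.Im x| <= rnorm x.
Proof. by rewrite rnormE -sqrtr_sqr ler_wsqrtr // lerDr sqr_ge0. Qed.

Lemma rnorm_le_ReIm (x : C) : rnorm x <= `|complex.Re x| + `|complex.Im x|.
Proof.
rewrite rnormE -[leRHS]ger0_norm ?addr_ge0 // -sqrtr_sqr ler_wsqrtr //.
rewrite sqrrD !real_normK ?num_real // lerD2r lerDl.
by rewrite mulrn_wge0 // mulr_ge0.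
Qed.

End RealNorm.

Section EpsDelta.
Variable R : realType.
Local Notation C := R[i].

Lemma gt0_complex (e : C) : 0 < e -> e = (complex.Re e)%:C /\ 0 < complex.Re e.
Proof.
case: e => a b; rewrite ltcE /= => /andP[/eqP -> a0]; split=> //.
Qed.

Lemma nbhs_rnormP (V : normedModType C) (x : V) (A : set V) :
  nbhs x A <-> exists2 e : R, 0 < e & forall y, rnorm (y - x) < e -> A y.
Proof.
split.
- move=> /nbhs_ballP[e /= e0]; have [-> re0] := gt0_complex e0.
  move=> xA; exists (complex.Re e) => // y ye; apply: xA.
  by rewrite -ball_normE /= rnorm_lt rnormC.
- move=> [e e0 xA]; apply/nbhs_ballP; exists e%:C; first by rewrite /= ltcR.
  by move=> y; rewrite -ball_normE /= rnorm_lt rnormC; exact: xA.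
Qed.

Lemma openP (V : normedModType C) (A : set V) :
  open A <-> forall x, A x -> exists2 e : R, 0 < e & forall y, rnorm (y - x) < e -> A y.
Proof.
rewrite openE; split=> [oA x /oA|oA x /oA]; first by move/nbhs_rnormP.
by move/nbhs_rnormP.
Qed.

Lemma cvg_rnormP (T : Type) (F : set_system T) (FF : Filter F)
    (V : normedModType C) (f : T -> V) (l : V) :
  f @ F --> l <-> forall e : R, 0 < e -> \forall x \near F, rnorm (f x - l) < e.
Proof.
split=> [/cvgrPdist_lt fl e e0|fl].
- have e0' : 0 < e%:C :> C by rewrite ltcR.
  by near=> x; rewrite rnormC -rnorm_lt; near: x; exact: fl.
- apply/cvgrPdist_lt => e e0; have [-> re0] := gt0_complex e0.
  by near=> x; rewrite rnorm_lt rnormC; near: x; exact: fl.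
Unshelve. all: by end_near. Qed.

Lemma continuous_rnormP (V W : normedModType C) (f : V -> W) (x : V) :
  {for x, continuous f} <->
  forall e : R, 0 < e -> exists2 d : R, 0 < d &
    forall y, rnorm (y - x) < d -> rnorm (f y - f x) < e.
Proof.
split=> [/cvg_rnormP fx e e0|fx]; first by have /nbhs_rnormP := fx e e0.
by apply/cvg_rnormP => e e0; apply/nbhs_rnormP; exact: fx.
Qed.

(** Multiplying the difference quotient out makes the estimate meaningful at [h = 0], so the point
    needs no separate treatment later. *)
Lemma derivable_rnormP (V W : normedModType C) (f : V -> W) (x v : V) :
  derivable f x v <-> exists l : W, forall e : R, 0 < e -> exists2 d : R, 0 < d &
    forall h : C, rnorm h < d -> rnorm (f (h *: v + x) - f x - h *: l) <= e * rnorm h.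
Proof.
have key h (l : W) : h != 0 -> rnorm (h^-1 *: (f (h *: v + x) - f x) - l) =
    (rnorm h)^-1 * rnorm (f (h *: v + x) - f x - h *: l).
  by move=> h0; rewrite -rnormV -rnormZ [in RHS]scalerBr scalerA mulVf // scale1r.
split.
- move=> /cvg_ex[/= l /cvg_rnormP fl]; exists l => e e0.
  have /nbhs_rnormP[d d0 fd] := fl e e0; exists d => // h hd.
  have [->|h0] := eqVneq h 0; first by rewrite !scale0r add0r subrr subr0 !rnorm0 mulr0.
  have := fd h; rewrite subr0 => /(_ hd h0) /=.
  by rewrite key // ltr_pdivrMl ?rnorm_gt0 // mulrC => /ltW.
- move=> [l fl]; apply/cvg_ex; exists l; apply/cvg_rnormP => e e0.
  have e20 : 0 < e / 2 by rewrite divr_gt0.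
  have [d d0 fd] := fl _ e20; apply/nbhs_rnormP.
  exists d => // h; rewrite subr0 => hd h0 /=.
  rewrite key // (@le_lt_trans _ _ (e / 2)) //; last by lra.
  by rewrite ler_pdivrMl ?rnorm_gt0 // mulrC; exact: fd.
Qed.

Lemma derivable1_continuous (f : C -> C) (x : C) :
  derivable f x 1 -> {for x, continuous f}.
Proof. by move=> /derivable1_diffP/differentiable_continuous. Qed.

(** This is the bridge by which one-variable results are applied on the complex lines of [V]. *)
Lemma derivable_lineE (V W : normedModType C) (f : V -> W) (x v : V) (a : C) :
  derivable (fun z : C => f (x + z *: v)) a 1 <-> derivable f (x + a *: v) v.
Proof.
rewrite !derivable_rnormP.
by split=> -[l fl]; exists l => e /fl[d d0 fd]; exists d => // h /fd;
  rewrite [_%:A]mulr1 scalerDl addrCA.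
Qed.

Lemma near_eq_derivable1 (V W : normedModType C) (f g : V -> W) (x v : V) (e : R) :
  0 < e -> (forall y, rnorm (y - x) < e -> f y = g y) ->
  derivable f x v -> derivable g x v.
Proof.
move=> e0 fg; rewrite !derivable_rnormP => -[l fl]; exists l => t t0.
have [d d0 fd] := fl t t0; exists (Num.min d (e / (1 + rnorm v))) => [|h].
  by rewrite lt_min d0 divr_gt0 // ltr_pwDl // rnorm_ge0.
have v0 : 0 < 1 + rnorm v by rewrite ltr_pwDl // rnorm_ge0.
rewrite lt_min => /andP[hd he]; rewrite -!fg; first exact: fd.
  by rewrite subrr rnorm0.
rewrite addrK rnormZ; move: he; rewrite ltr_pdivlMr // mulrDr mulr1.
by apply: le_lt_trans; rewrite lerDr rnorm_ge0.
Qed.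

End EpsDelta.

(** * Integrals of complex-valued functions over segments *)

Section ComplexIntegral.
Variable R : realType.
Local Notation C := R[i].
Local Notation mu := (@lebesgue_measure R).
Implicit Types (f g : R -> C) (a b : R).

Lemma continuous_Re (x : C) : {for x, continuous (@complex.Re R : C -> R)}.
Proof.
apply/(@cvgrPdist_lt _ R^o _ _ (nbhs_filter x)) => e e0.
apply/nbhs_rnormP; exists e => // y.
by rewrite rnormC; apply: le_lt_trans; rewrite -raddfB Re_le_rnorm.
Qed.

Lemma continuous_Im (x : C) : {for x, continuous (@complex.Im R : C -> R)}.
Proof.
apply/(@cvgrPdist_lt _ R^o _ _ (nbhs_filter x)) => e e0.
apply/nbhs_rnormP; exists e => // y.
by rewrite rnormC; apply: le_lt_trans; rewrite -raddfB Im_le_rnorm.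
Qed.

Lemma continuous_Complex (T : topologicalType) (u v : T -> R) (x : T) :
  {for x, continuous u} -> {for x, continuous v} ->
  {for x, continuous (fun t => u t +i* v t : C)}.
Proof.
move=> cu cv; apply/cvg_rnormP => e e0; have e2 : 0 < e / 2 by rewrite divr_gt0.
move/cvgrPdist_lt : cu => /(_ _ e2) cu; move/cvgrPdist_lt : cv => /(_ _ e2) cv.
near=> t; rewrite (le_lt_trans (rnorm_le_ReIm _)) //= (splitr e) ltrD //.
  by rewrite distrC; near: t.
by rewrite distrC; near: t.
Unshelve. all: by end_near. Qed.

Lemma continuous_ofreal (x : R) : {for x, continuous (fun t : R => t%:C : C)}.
Proof. by apply: continuous_Complex; [exact: cvg_id|exact: cvg_cst]. Qed.

Definition cint f a b : C :=
  (\int[mu]_(x in `[a, b]) complex.Re (f x)) +i*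
  (\int[mu]_(x in `[a, b]) complex.Im (f x)).

Definition continuous_on_seg f a b :=
  forall x, a <= x <= b -> {for x, continuous f}.
Local Notation ccont := continuous_on_seg.

Lemma integrable_seg (u : R -> R) a b :
  (forall x, a <= x <= b -> {for x, continuous u}) ->
  mu.-integrable `[a, b] (EFin \o u).
Proof.
move=> cu; apply: continuous_compact_integrable; first exact: segment_compact.
by apply: continuous_in_subspaceT => x; rewrite inE /= in_itv /=; exact: cu.
Qed.

Lemma integrable_Re f a b : ccont f a b ->
  mu.-integrable `[a, b] (EFin \o (fun x => complex.Re (f x))).
Proof.
move=> cf; apply: integrable_seg => x /cf fx.
exact: (continuous_comp fx (@continuous_Re (f x))).
Qed.

Lemma integrable_Im f a b : ccont f a b ->
  mu.-integrable `[a, b] (EFin \o (fun x => complex.Im (f x))).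
Proof.
move=> cf; apply: integrable_seg => x /cf fx.
exact: (continuous_comp fx (@continuous_Im (f x))).
Qed.

Lemma eq_cint f g a b : (forall x, a <= x <= b -> f x = g x) ->
  cint f a b = cint g a b.
Proof.
move=> fg; congr (_ +i* _); apply: eq_Rintegral => x;
by rewrite inE /= in_itv /= => /fg ->.
Qed.

Lemma cintB f g a b : ccont f a b -> ccont g a b ->
  cint (fun x => f x - g x) a b = cint f a b - cint g a b.
Proof.
move=> cf cg; rewrite /cint.
under eq_Rintegral do rewrite raddfB.
under [X in _ +i* X]eq_Rintegral do rewrite raddfB.
by rewrite !RintegralB //; [exact: integrable_Im|exact: integrable_Im
  |exact: integrable_Re|exact: integrable_Re].
Qed.

Lemma cintD f g a b : ccont f a b -> ccont g a b ->
  cint (fun x => f x + g x) a b = cint f a b + cint g a b.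
Proof.
move=> cf cg; rewrite /cint.
under eq_Rintegral do rewrite raddfD.
under [X in _ +i* X]eq_Rintegral do rewrite raddfD.
by rewrite !RintegralD //; [exact: integrable_Im|exact: integrable_Im
  |exact: integrable_Re|exact: integrable_Re].
Qed.

Lemma cintZ (c : C) f a b : ccont f a b ->
  cint (fun x => c * f x) a b = c * cint f a b.
Proof.
case: c => c d cf; rewrite /cint.
have ReE x : complex.Re ((c +i* d) * f x) =
    c * complex.Re (f x) - d * complex.Im (f x) by case: (f x).
have ImE x : complex.Im ((c +i* d) * f x) =
    c * complex.Im (f x) + d * complex.Re (f x).
  by case: (f x) => u v /=; rewrite addrC.
under eq_Rintegral do rewrite ReE.
under [X in _ +i* X]eq_Rintegral do rewrite ImE.
have iR := integrable_Re cf; have iI := integrable_Im cf.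
have sc (k : R) u : mu.-integrable `[a, b] (EFin \o u) ->
    mu.-integrable `[a, b] (EFin \o (fun x => k * u x)).
  by move=> iu; have := @integrableZl _ _ _ mu _ (measurable_itv _) k _ iu.
rewrite RintegralB ?RintegralD ?RintegralZl //; try exact: sc.
Qed.

Lemma cint_cst (c : C) a b : a <= b -> cint (fun=> c) a b = (b - a)%:C * c.
Proof.
move=> ab; rewrite /cint !Rintegral_cst //= lebesgue_measure_itv /= lte_fin.
case: c => c d; move: ab; rewrite le_eqVlt => /predU1P[->|ab].
  by rewrite ltxx subrr /= !mulr0 mul0r.
rewrite ab /=; apply/eqP; rewrite eq_complex /=.
by rewrite !mul0r subr0 addr0 !(mulrC (b - a)) !eqxx.
Qed.

Lemma cint_cat f a b c : a <= b <= c -> ccont f a c ->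
  cint f a c = cint f a b + cint f b c.
Proof.
move=> /andP[ab bc] cf.
have iR := integrable_Re cf; have iI := integrable_Im cf.
suff H (u : R -> R) : mu.-integrable `[a, c] (EFin \o u) ->
   \int[mu]_(x in `[a, c]) u x =
   \int[mu]_(x in `[a, b]) u x + \int[mu]_(x in `[b, c]) u x.
  by rewrite /cint !H.
move=> iu; apply/eqP; rewrite addrC -subr_eq; apply/eqP.
rewrite Rintegral_itvB //; rewrite ?bnd_simp //.
rewrite Rintegral_itv_obnd_cbnd //.
apply: integrableS iu => //; apply: subset_itv; rewrite ?bnd_simp //.
Qed.

(** Real and imaginary parts are estimated separately, whence the factor 2; it propagates to the
    later Cauchy estimates. *)
Lemma cint_le f a b (M : R) : a <= b -> ccont f a b ->
  (forall x, a <= x <= b -> rnorm (f x) <= M) ->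
  rnorm (cint f a b) <= 2 * M * (b - a).
Proof.
move=> ab cf fM; rewrite (le_trans (rnorm_le_ReIm _)) //=.
have iR := integrable_Re cf; have iI := integrable_Im cf.
have H (u : R -> R) : mu.-integrable `[a, b] (EFin \o u) ->
   (forall x, a <= x <= b -> `|u x| <= M) ->
   `|\int[mu]_(x in `[a, b]) u x| <= M * (b - a).
  move=> iu uM; apply: le_trans (le_normr_Rintegral _ iu) _ => //.
  have -> : M * (b - a) = \int[mu]_(x in `[a, b]) (cst M x).
    rewrite Rintegral_cst //= lebesgue_measure_itv /= lte_fin.
    move: ab; rewrite le_eqVlt => /predU1P[->|->]; last by rewrite -EFinD.
    by rewrite ltxx subrr.
  apply: le_Rintegral => //.
  - by have := integrable_norm iu; rewrite /comp.
  - by apply: integrable_seg => x _; exact: cvg_cst.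
have -> : 2 * M * (b - a) = M * (b - a) + M * (b - a) by ring.
by apply: lerD; apply: H => // x /fM; apply: le_trans;
  [exact: Re_le_rnorm|exact: Im_le_rnorm].
Qed.

End ComplexIntegral.

(** * Goursat's theorem and circle means *)

Section Goursat.
Variable R : realType.
Local Notation C := R[i].
Implicit Types (G : C -> C) (x y : R).
Local Notation ccont := continuous_on_seg.

Lemma ccont_horizontal G a b y :
  (forall x, a <= x <= b -> {for x +i* y, continuous G}) ->
  ccont (fun x => G (x +i* y)) a b.
Proof.
move=> cG x /cG; apply: (@continuous_comp _ _ _ (fun x : R => x +i* y : C)).
by apply: continuous_Complex; [exact: cvg_id|exact: cvg_cst].
Qed.

Lemma ccont_vertical G a b x :
  (forall y, a <= y <= b -> {for x +i* y, continuous G}) ->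
  ccont (fun y => G (x +i* y)) a b.
Proof.
move=> cG y /cG; apply: (@continuous_comp _ _ _ (fun y : R => x +i* y : C)).
by apply: continuous_Complex; [exact: cvg_cst|exact: cvg_id].
Qed.

(** The integral of [G] over the boundary, counterclockwise: dz is dx on the horizontal sides and i
    dy on the vertical ones. *)
Definition rect_int G x0 x1 y0 y1 : C :=
  cint (fun x => G (x +i* y0)) x0 x1 - cint (fun x => G (x +i* y1)) x0 x1 +
  'i * (cint (fun y => G (x1 +i* y)) y0 y1 - cint (fun y => G (x0 +i* y)) y0 y1).

Definition continuous_on_rect G x0 x1 y0 y1 :=
  forall x y, x0 <= x <= x1 -> y0 <= y <= y1 -> {for x +i* y, continuous G}.

Lemma rect_int_quarter G x0 x1 x2 y0 y1 y2 :
  x0 <= x1 <= x2 -> y0 <= y1 <= y2 -> continuous_on_rect G x0 x2 y0 y2 ->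
  rect_int G x0 x2 y0 y2 =
  rect_int G x0 x1 y0 y1 + rect_int G x1 x2 y0 y1 +
  (rect_int G x0 x1 y1 y2 + rect_int G x1 x2 y1 y2).
Proof.
move=> x012 y012 cG; rewrite /rect_int.
have H y : y0 <= y <= y2 -> cint (fun x => G (x +i* y)) x0 x2 =
   cint (fun x => G (x +i* y)) x0 x1 + cint (fun x => G (x +i* y)) x1 x2.
  by move=> yy; apply: (cint_cat x012); apply: ccont_horizontal => x xx; exact: cG.
have V x : x0 <= x <= x2 -> cint (fun y => G (x +i* y)) y0 y2 =
   cint (fun y => G (x +i* y)) y0 y1 + cint (fun y => G (x +i* y)) y1 y2.
  by move=> xx; apply: (cint_cat y012); apply: ccont_vertical => y yy; exact: cG.
have [x01 x12] := andP x012; have [y01 y12] := andP y012.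
have x02 := le_trans x01 x12; have y02 := le_trans y01 y12.
by rewrite !H ?V ?lexx ?x02 ?y02 //; ring.
Qed.

Lemma rect_intB G A x0 x1 y0 y1 : x0 <= x1 -> y0 <= y1 ->
  continuous_on_rect G x0 x1 y0 y1 -> continuous_on_rect A x0 x1 y0 y1 ->
  rect_int (fun z => G z - A z) x0 x1 y0 y1 =
  rect_int G x0 x1 y0 y1 - rect_int A x0 x1 y0 y1.
Proof.
move=> x01 y01 cG cA.
have hor H y : continuous_on_rect H x0 x1 y0 y1 -> y0 <= y <= y1 ->
    ccont (fun x => H (x +i* y)) x0 x1.
  by move=> cH yy; apply: ccont_horizontal => x xx; exact: cH.
have ver H x : continuous_on_rect H x0 x1 y0 y1 -> x0 <= x <= x1 ->
    ccont (fun y => H (x +i* y)) y0 y1.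
  by move=> cH xx; apply: ccont_vertical => y yy; exact: cH.
have [x0i x1i] : x0 <= x0 <= x1 /\ x0 <= x1 <= x1 by rewrite !lexx x01.
have [y0i y1i] : y0 <= y0 <= y1 /\ y0 <= y1 <= y1 by rewrite !lexx y01.
rewrite /rect_int.
rewrite (cintB (hor G y0 cG y0i) (hor A y0 cA y0i)) (cintB (hor G y1 cG y1i) (hor A y1 cA y1i)).
rewrite (cintB (ver G x0 cG x0i) (ver A x0 cA x0i)) (cintB (ver G x1 cG x1i) (ver A x1 cA x1i)).
ring.
Qed.

Lemma continuous_affine (c l p z : C) : {for z, continuous (fun t : C => c + l * (t - p))}.
Proof.
apply: (@continuousD _ _ _ (fun=> c) (fun t => l * (t - p))); first exact: cst_continuous.
apply: (@continuousM _ _ (fun=> l) (fun t => t - p)); first exact: cst_continuous.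
apply: (@continuousB _ _ _ id (fun=> p)); [exact: cvg_id|exact: cst_continuous].
Qed.

(** The values on opposite sides differ by a constant, so both differences are integrals of
    constants, and they cancel. *)
Lemma rect_int_affine (c l p : C) x0 x1 y0 y1 : x0 <= x1 -> y0 <= y1 ->
  rect_int (fun z => c + l * (z - p)) x0 x1 y0 y1 = 0.
Proof.
move=> x01 y01; rewrite /rect_int.
have hor y : ccont (fun x => c + l * (x +i* y - p)) x0 x1.
  by apply: (@ccont_horizontal (fun z => c + l * (z - p)) x0 x1 y) => x _; exact: continuous_affine.
have ver x : ccont (fun y => c + l * (x +i* y - p)) y0 y1.
  by apply: (@ccont_vertical (fun z => c + l * (z - p)) y0 y1 x) => y _; exact: continuous_affine.
rewrite -(cintB (hor y0) (hor y1)) -(cintB (ver x1) (ver x0)).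
rewrite (@eq_cint _ _ (fun=> l * (0 +i* (y0 - y1)))); last first.
  move=> x _; have -> : (0 +i* (y0 - y1) : C) = (x +i* y0) - (x +i* y1).
    by apply/eqP; rewrite eq_complex /= subrr !eqxx.
  ring.
rewrite [X in _ + _ * X](@eq_cint _ _ (fun=> l * (x1 - x0)%:C)); last first.
  move=> y _; have -> : ((x1 - x0)%:C : C) = (x1 +i* y) - (x0 +i* y).
    by apply/eqP; rewrite eq_complex /= subrr !eqxx.
  ring.
rewrite !cint_cst //; case: l {hor ver} => u v.
by apply/eqP; rewrite eq_complex /=; apply/andP; split; apply/eqP; ring.
Qed.

Lemma rect_int_le G x0 x1 y0 y1 (M : R) : x0 <= x1 -> y0 <= y1 ->
  continuous_on_rect G x0 x1 y0 y1 ->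
  (forall x y, x0 <= x <= x1 -> y0 <= y <= y1 -> rnorm (G (x +i* y)) <= M) ->
  rnorm (rect_int G x0 x1 y0 y1) <= 4 * M * ((x1 - x0) + (y1 - y0)).
Proof.
move=> x01 y01 cG GM; rewrite /rect_int.
have H y : y0 <= y <= y1 ->
    rnorm (cint (fun x => G (x +i* y)) x0 x1) <= 2 * M * (x1 - x0).
  move=> yy; apply: cint_le => // [|x xx]; last exact: GM.
  by apply: ccont_horizontal => x xx; exact: cG.
have V x : x0 <= x <= x1 ->
    rnorm (cint (fun y => G (x +i* y)) y0 y1) <= 2 * M * (y1 - y0).
  move=> xx; apply: cint_le => // [|y yy]; last exact: GM.
  by apply: ccont_vertical => y yy; exact: cG.
have ni : rnorm ('i : C) = 1 by rewrite rnormE /= expr0n expr1n add0r sqrtr1.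
rewrite (le_trans (rnormD _ _)) // rnormM ni mul1r.
rewrite (le_trans (lerD (rnormB _ _) (rnormB _ _))) //.
have -> : 4 * M * (x1 - x0 + (y1 - y0)) =
  2 * M * (x1 - x0) + 2 * M * (x1 - x0) + (2 * M * (y1 - y0) + 2 * M * (y1 - y0)).
  by ring.
by apply: lerD; apply: lerD; [apply: H|apply: H|apply: V|apply: V];
  rewrite lexx ?x01 ?y01.
Qed.

(** Subtracting the affine approximation at [p] does not change the integral; only the remainder of
    the derivative contributes. *)
Lemma rect_int_near_affine G (p l : C) (M : R) x0 x1 y0 y1 : x0 <= x1 -> y0 <= y1 ->
  continuous_on_rect G x0 x1 y0 y1 ->
  (forall x y, x0 <= x <= x1 -> y0 <= y <= y1 ->
    rnorm (G (x +i* y) - G p - ((x +i* y) - p) * l) <= M) ->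
  rnorm (rect_int G x0 x1 y0 y1) <= 4 * M * ((x1 - x0) + (y1 - y0)).
Proof.
move=> x01 y01 cG GM; pose A z := G p + l * (z - p).
have cA : continuous_on_rect A x0 x1 y0 y1.
  by move=> x y _ _; exact: continuous_affine.
have E : rect_int (fun z => G z - A z) x0 x1 y0 y1 = rect_int G x0 x1 y0 y1.
  by rewrite (rect_intB x01 y01 cG cA) (rect_int_affine _ _ _ x01 y01) subr0.
rewrite -E; refine (rect_int_le x01 y01 _ _) => x y xx yy.
  by apply: (@continuousB _ _ _ G A); [exact: cG|exact: cA].
by rewrite opprD addrA (mulrC l); exact: GM.
Qed.

End Goursat.

Section GoursatTheorem.
Variables (R : realType) (G : R[i] -> R[i]) (x0 x1 y0 y1 : R).
Hypotheses (x01 : x0 <= x1) (y01 : y0 <= y1).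
Hypothesis dG : forall x y, x0 <= x <= x1 -> y0 <= y <= y1 ->
  derivable G (x +i* y) 1.
Local Notation C := R[i].

Let w n : R := (x1 - x0) / 2 ^+ n.
Let h n : R := (y1 - y0) / 2 ^+ n.
Let sub n (p : R * R) := [/\ x0 <= p.1, p.1 + w n <= x1, y0 <= p.2 & p.2 + h n <= y1].
Let I n (p : R * R) := rect_int G p.1 (p.1 + w n) p.2 (p.2 + h n).

Let w_ge0 n : 0 <= w n. Proof. by rewrite divr_ge0 ?exprn_ge0 ?subr_ge0. Qed.
Let h_ge0 n : 0 <= h n. Proof. by rewrite divr_ge0 ?exprn_ge0 ?subr_ge0. Qed.
Let wS n : w n = w n.+1 + w n.+1.
Proof. by rewrite /w exprS; field; rewrite expf_neq0 ?pnatr_eq0. Qed.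
Let hS n : h n = h n.+1 + h n.+1.
Proof. by rewrite /h exprS; field; rewrite expf_neq0 ?pnatr_eq0. Qed.

Let sub_cont n p : sub n p -> continuous_on_rect G p.1 (p.1 + w n) p.2 (p.2 + h n).
Proof.
move=> [a b c d] x y /andP[xa xb] /andP[ya yb]; apply: derivable1_continuous.
by apply: dG; rewrite ?(le_trans a) ?(le_trans c) ?(le_trans xb) ?(le_trans yb).
Qed.

(** Pigeonhole: one of the four quarters carries at least a quarter of the integral. *)
Let step n p (e : R) : sub n p -> 4 * e <= rnorm (I n p) ->
  exists p', [/\ sub n.+1 p', e <= rnorm (I n.+1 p'),
    p.1 <= p'.1 <= p.1 + w n.+1 & p.2 <= p'.2 <= p.2 + h n.+1].
Proof.
move=> sp; have [a b c d] := sp.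
have wp := w_ge0 n.+1; have hp := h_ge0 n.+1; have ww := wS n; have hh := hS n.
have S1 : sub n.+1 (p.1, p.2) by split => /=; lra.
have S2 : sub n.+1 (p.1 + w n.+1, p.2) by split => /=; lra.
have S3 : sub n.+1 (p.1, p.2 + h n.+1) by split => /=; lra.
have S4 : sub n.+1 (p.1 + w n.+1, p.2 + h n.+1) by split => /=; lra.
have X1 : p.1 <= p.1 <= p.1 + w n.+1 by lra.
have X2 : p.1 <= p.1 + w n.+1 <= p.1 + w n.+1 by lra.
have Y1 : p.2 <= p.2 <= p.2 + h n.+1 by lra.
have Y2 : p.2 <= p.2 + h n.+1 <= p.2 + h n.+1 by lra.
have X3 : p.1 <= p.1 + w n.+1 <= p.1 + (w n.+1 + w n.+1) by lra.
have Y3 : p.2 <= p.2 + h n.+1 <= p.2 + (h n.+1 + h n.+1) by lra.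
have IE : I n p = I n.+1 (p.1, p.2) + I n.+1 (p.1 + w n.+1, p.2) +
    (I n.+1 (p.1, p.2 + h n.+1) + I n.+1 (p.1 + w n.+1, p.2 + h n.+1)).
  have := sub_cont sp; rewrite {1}/I wS hS => /(rect_int_quarter X3 Y3) ->.
  by rewrite (addrA p.1) (addrA p.2).
have H4 : rnorm (I n p) <= rnorm (I n.+1 (p.1, p.2)) +
    rnorm (I n.+1 (p.1 + w n.+1, p.2)) + (rnorm (I n.+1 (p.1, p.2 + h n.+1)) +
    rnorm (I n.+1 (p.1 + w n.+1, p.2 + h n.+1))).
  rewrite IE; apply: (le_trans (rnormD _ _)).
  by apply: lerD; exact: rnormD.
move=> /le_trans /(_ H4) {H4 IE} H4.
have [e1|e1] := leP e (rnorm (I n.+1 (p.1, p.2))); first by exists (p.1, p.2).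
have [e2|e2] := leP e (rnorm (I n.+1 (p.1 + w n.+1, p.2))).
  by exists (p.1 + w n.+1, p.2).
have [e3|e3] := leP e (rnorm (I n.+1 (p.1, p.2 + h n.+1))).
  by exists (p.1, p.2 + h n.+1).
exists (p.1 + w n.+1, p.2 + h n.+1); split => //.
move: H4 e1 e2 e3; do 4 move: (rnorm _) => ?.
by move=> *; lra.
Qed.

(** Bisection: the integrals over the nested rectangles are at least [e / 4 ^+ n], while
    differentiability at their common point bounds them by a small multiple of [L ^+ 2 / 4 ^+ n]. *)
Theorem goursat : rect_int G x0 x1 y0 y1 = 0.
Proof.
apply/eqP; rewrite -rnorm0_eq0; apply/negP => /negP; rewrite rnorm0_eq0 -rnorm_gt0.
set e := rnorm _ => e0.
have : forall np : nat * (R * R), exists p' : R * R,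
   sub np.1 np.2 -> e / 4 ^+ np.1 <= rnorm (I np.1 np.2) ->
   [/\ sub np.1.+1 p', e / 4 ^+ np.1.+1 <= rnorm (I np.1.+1 p'),
    np.2.1 <= p'.1 <= np.2.1 + w np.1.+1 & np.2.2 <= p'.2 <= np.2.2 + h np.1.+1].
  move=> [n p] /=; case: (pselect (sub n p)) => [sp|?]; last by exists p.
  case: (pselect (e / 4 ^+ n <= rnorm (I n p))) => [ep|?]; last by exists p.
  have [|p' ?] := @step n p (e / 4 ^+ n.+1) sp; last by exists p'.
  by rewrite (le_trans _ ep) // exprS invfM mulrCA mulVKf.
move=> /choice[next nextP].
pose s := fix s n := if n is n'.+1 then next (n', s n') else (x0, y0).
have sP n : sub n (s n) /\ e / 4 ^+ n <= rnorm (I n (s n)).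
  elim: n => [|n [sn en]]; last by have [] := nextP (n, s n) sn en.
  by rewrite /I /sub /w /h /= expr0 !divr1 !(addrC x0) !(addrC y0) !subrK !lexx; split.
have sS n : (s n).1 <= (s n.+1).1 <= (s n).1 + w n.+1 /\
            (s n).2 <= (s n.+1).2 <= (s n).2 + h n.+1.
  by have [sn en] := sP n; have [] := nextP (n, s n) sn en.
(* Nested intervals: the supremum of the left ends lies in all of them. *)
have mono (u v : nat -> R) : (forall n, u n <= u n.+1 <= u n + v n.+1) ->
    (forall n, v n = v n.+1 + v n.+1) -> (forall n, 0 <= v n) ->
    exists X, forall n, u n <= X <= u n + v n.
  move=> uv vv v0.
  have up n k : u n <= u (n + k)%N.
    elim: k => [|k IH]; rewrite ?addn0 // addnS (le_trans IH) //.
    by have /andP[] := uv (n + k)%N.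
  have dn n k : u (n + k)%N + v (n + k)%N <= u n + v n.
    elim: k => [|k IH]; rewrite ?addn0 // addnS (le_trans _ IH) //.
    by have /andP[] := uv (n + k)%N; have := vv (n + k)%N; lra.
  have ub n k : u k <= u n + v n.
    have [nk|/ltnW kn] := leqP n k.
      by have := dn n (k - n)%N; rewrite subnKC //; have := v0 k; lra.
    by have := up k (n - k)%N; rewrite subnKC //; have := v0 n; lra.
  exists (sup (range u)) => n; apply/andP; split.
    apply: ub_le_sup; last by exists n.
    by exists (u 0%N + v 0%N) => _ [k _ <-].
  by apply: ge_sup; [exists (u 0%N), 0%N|move=> _ [k _ <-]].
have [X XP] := mono (fun n => (s n).1) w (fun n => (sS n).1) wS w_ge0.
have [Y YP] := mono (fun n => (s n).2) h (fun n => (sS n).2) hS h_ge0.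
have sub_in n x y : (s n).1 <= x <= (s n).1 + w n -> (s n).2 <= y <= (s n).2 + h n ->
    x0 <= x <= x1 /\ y0 <= y <= y1.
  by have [[a b c d] _] := sP n; move=> /andP[? ?] /andP[? ?]; split; lra.
have [Xin Yin] := sub_in 0%N _ _ (XP 0%N) (YP 0%N).
have /derivable_rnormP[l lP] := dG Xin Yin.
pose L := (x1 - x0) + (y1 - y0).
have L0 : 0 <= L by rewrite /L; lra.
(* With this value [4 * eta * L ^+ 2] is less than [e]; the [+ 1] covers the rectangle reduced to a
   point. *)
pose eta := e / (8 * (L + 1) ^+ 2).
have eta0 : 0 < eta by rewrite divr_gt0 // mulr_gt0 // exprn_gt0 // ltr_pwDr.
have [d d0 dP] := lP _ eta0.
have [n nP] : exists n, L / 2 ^+ n < d.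
  have Ld : 0 <= L / d by rewrite divr_ge0 // ltW.
  exists (Num.Def.truncn (L / d)).+1.
  rewrite ltr_pdivrMr ?exprn_gt0 // -ltr_pdivrMl // mulrC.
  have /andP[_ /lt_trans] := truncn_itv Ld; apply.
  by rewrite -natrX ltr_nat ltn_expl.
have [sn en] := sP n.
have [wn hn] := (w_ge0 n, h_ge0 n).
have whL : w n + h n = L / 2 ^+ n by rewrite /w /h -mulrDl.
have close x y : (s n).1 <= x <= (s n).1 + w n -> (s n).2 <= y <= (s n).2 + h n ->
    rnorm ((x +i* y) - (X +i* Y) : C) <= w n + h n.
  move=> /andP[xa xb] /andP[ya yb]; rewrite (le_trans (rnorm_le_ReIm _)) //=.
  have /andP[? ?] := XP n; have /andP[? ?] := YP n.
  by rewrite lerD // ler_norml; lra.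
have cG := sub_cont sn.
have sw : (s n).1 <= (s n).1 + w n by rewrite lerDl.
have sh : (s n).2 <= (s n).2 + h n by rewrite lerDl.
have loc x y : (s n).1 <= x <= (s n).1 + w n -> (s n).2 <= y <= (s n).2 + h n ->
    rnorm (G (x +i* y) - G (X +i* Y) - ((x +i* y) - (X +i* Y)) * l) <= eta * (w n + h n).
  move=> xx yy; have cl := close _ _ xx yy.
  have := dP ((x +i* y) - (X +i* Y)); rewrite [_%:A]mulr1 subrK => H.
  apply: (le_trans (H _)); first by rewrite (le_lt_trans cl) // whL.
  by rewrite ler_pM2l.
have := rect_int_near_affine sw sh cG loc.
rewrite !(addrAC _ _ (- _)) !subrr !add0r.
rewrite whL => /(le_trans en).
have -> : 4 * (eta * (L / 2 ^+ n)) * (L / 2 ^+ n) = 4 * eta * L ^+ 2 / 4 ^+ n.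
  have -> : (4 : R) ^+ n = 2 ^+ n * 2 ^+ n by rewrite -exprMn -natrM.
  by field; rewrite expf_neq0 ?pnatr_eq0.
rewrite ler_pM2r ?invr_gt0 ?exprn_gt0 //.
have -> : 4 * eta * L ^+ 2 = e * (L ^+ 2 / (L + 1) ^+ 2 / 2).
  rewrite /eta; field; rewrite gt_eqF // ltr_pwDr //.
apply/negP; rewrite -ltNge gtr_pMr // ltr_pdivrMr // mul1r.
rewrite ltr_pdivrMr ?exprn_gt0 ?ltr_pwDr //.
have L2 := sqr_ge0 L; have -> : 2 * (L + 1) ^+ 2 = L ^+ 2 + (L ^+ 2 + 4 * L + 2) by ring.
lra.
Qed.

End GoursatTheorem.

(** * The complex exponential and means over circles *)

Section CircleMean.
Variable R : realType.
Local Notation C := R[i].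
Implicit Types (k g : C -> C) (r x y : R) (z a : C).

Definition expi (t : R) : C := cos t +i* sin t.

Lemma expiD s t : expi (s + t) = expi s * expi t.
Proof. by rewrite /expi cosD sinD; apply/eqP; rewrite eq_complex /= addrC (addrC (sin s * _)) !eqxx. Qed.

Lemma rnorm_expi t : rnorm (expi t) = 1.
Proof. by rewrite rnormE /= cos2Dsin2 sqrtr1. Qed.

Lemma expi0 : expi 0 = 1.
Proof. by rewrite /expi cos0 sin0. Qed.

Lemma expi2pi : expi (2 * pi) = 1.
Proof. by rewrite /expi -[2 * pi]add0r mulr_natl cosD2pi sinD2pi cos0 sin0. Qed.

Lemma expi_neq0 t : expi t != 0.
Proof. by rewrite -rnorm_gt0 rnorm_expi. Qed.

Lemma continuous_expi t : {for t, continuous expi}.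
Proof. by apply: continuous_Complex; [exact: continuous_cos|exact: continuous_sin]. Qed.

Lemma cexpE x y : cexp (x +i* y) = (expR x)%:C * expi y.
Proof. by []. Qed.

Lemma cexp_polar z : cexp z = (expR (complex.Re z))%:C * expi (complex.Im z).
Proof. by []. Qed.

Lemma rnorm_cexp z : rnorm (cexp z) = expR (complex.Re z).
Proof. by rewrite cexp_polar rnormM rnorm_expi mulr1 rnorm_real ger0_norm // expR_ge0. Qed.

Lemma cexp_neq0 z : cexp z != 0.
Proof. by rewrite -rnorm_gt0 rnorm_cexp expR_gt0. Qed.

Lemma cexp0_derive (e : R) : 0 < e -> exists2 d : R, 0 < d &
  forall z, rnorm z < d -> rnorm (cexp z - 1 - z) <= e * rnorm z.
Proof.
move=> e0.
have approx (f : R -> R) (l : R) : is_derive (0 : R) 1 f l -> forall t : R, 0 < t ->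
    exists2 d : R, 0 < d & forall h : R, `|h| < d -> `|f h - f 0 - l * h| <= t * `|h|.
  move=> [df fl] t t0; move: df => /cvg_ex[/= l' Hl].
  have El : l' = l by rewrite -fl; apply/esym/cvg_lim.
  move: Hl; rewrite El => /cvgrPdist_lt /(_ _ t0) /nbhs_ballP[d /= d0 dP].
  exists d => // h hd.
  have [->|h0] := eqVneq h 0; first by rewrite subrr mulr0 subr0 normr0 mulr0.
  have := dP h; rewrite -ball_normE /= sub0r normrN => /(_ hd h0).
  rewrite /GRing.scale /= mulr1 addr0 => /ltW.
  rewrite -(ler_pM2r (x := `|h|)) ?normr_gt0 // -normrM mulrBl.
  by rewrite mulrAC mulVf // mul1r distrC.
(* The error terms below add up to at most [6 * (e4 * n)]. *)
have [e4 e40] : exists e4 : R, e4 = e / 8 by exists (e / 8).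
have e4p : 0 < e4 by rewrite e40 divr_gt0.
have [d1 d10 H1] := approx _ _ (is_derive_expR 0) _ e4p.
have [d2 d20 H2] := approx _ _ (is_derive_cos 0) _ e4p.
have [d3 d30 H3] := approx _ _ (is_derive_sin 0) _ e4p.
have /cvgrPdist_lt /(_ _ (ltr01 : 0 < 1 :> R)) /nbhs_ballP[d4 /= d40 H4] :=
  (@continuous_expR R 0).
have /cvgrPdist_lt /(_ _ e4p) /nbhs_ballP[d5 /= d50 H5] := (@continuous_expR R 0).
exists (Num.min (Num.min d1 d2) (Num.min d3 (Num.min d4 d5))) => [|z].
  by rewrite !lt_min d10 d20 d30 d40 d50.
case: z => a b; rewrite !lt_min => /andP[/andP[z1 z2] /andP[z3 /andP[z4 z5]]].
have na := Re_le_rnorm (a +i* b : C); have nb := Im_le_rnorm (a +i* b : C).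
rewrite /= in na nb; set n := rnorm (a +i* b) in na nb z1 z2 z3 z4 z5 *.
have {}H1 := H1 a (le_lt_trans na z1); have {}H2 := H2 b (le_lt_trans nb z2).
have {}H3 := H3 b (le_lt_trans nb z3).
have {}H4 : expR a < 2.
  have := H4 a; rewrite -ball_normE /= sub0r normrN => /(_ (le_lt_trans na z4)).
  by rewrite expR0 ltr_distl => /andP[]; lra.
have {}H5 : `|expR a - 1| < e4.
  have := H5 a; rewrite -ball_normE /= sub0r normrN => /(_ (le_lt_trans na z5)).
  by rewrite expR0 distrC.
have e2 := expR_gt0 a.
rewrite (le_trans (rnorm_le_ReIm _)) // /= !mul0r subr0 addr0.
rewrite expR0 cos0 sin0 in H1 H2 H3.
rewrite mul1r in H1; rewrite oppr0 mul0r !subr0 in H2; rewrite !subr0 mul1r in H3.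
have -> : expR a * cos b - 1 - a = (expR a - 1 - a) + expR a * (cos b - 1) by ring.
have -> : expR a * sin b - 0 - b = expR a * (sin b - b) + (expR a - 1) * b by ring.
have E1 : `|expR a * (cos b - 1)| <= 2 * (e4 * n).
  rewrite normrM gtr0_norm //; apply: ler_pM => //; [exact: ltW|by rewrite (le_trans H2) // ler_pM2l].
have E2 : `|expR a * (sin b - b)| <= 2 * (e4 * n).
  rewrite normrM gtr0_norm //; apply: ler_pM => //; [exact: ltW|by rewrite (le_trans H3) // ler_pM2l].
have E3 : `|(expR a - 1) * b| <= e4 * n by rewrite normrM ler_pM // ltW.
have E4 : `|expR a - 1 - a| <= e4 * n by rewrite (le_trans H1) // ler_pM2l.
rewrite (le_trans (lerD (ler_normD _ _) (ler_normD _ _))) //.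
have -> : e * n = 8 * (e4 * n) by rewrite e40; field.
have n0 : 0 <= n by exact: rnorm_ge0.
have : 0 <= e4 * n by rewrite mulr_ge0 // ltW.
by move: E1 E2 E3 E4; move: (e4 * n) => w; lra.
Qed.

Lemma derivable_cexp z : derivable (@cexp R) z 1.
Proof.
apply/derivable_rnormP; exists (cexp z) => e e0.
have e1 : 0 < e / expR (complex.Re z) by rewrite divr_gt0 // expR_gt0.
have [d d0 dP] := cexp0_derive e1; exists d => // h /dP H.
rewrite [_%:A]mulr1 cexpD.
have -> : cexp h * cexp z - cexp z - h *: cexp z = cexp z * (cexp h - 1 - h).
  by rewrite /GRing.scale /=; ring.
rewrite rnormM rnorm_cexp mulrC -ler_pdivlMr ?expR_gt0 // (le_trans H) //.
by rewrite mulrAC.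
Qed.

Lemma differentiable_cexp z : differentiable (@cexp R) z.
Proof. by apply/derivable1_diffP; exact: derivable_cexp. Qed.

Definition cmean k r : C :=
  ((2 * pi)^-1)%:C * cint (fun t => k (r%:C * expi t)) 0 (2 * pi).

Let pi2_gt0 : 0 < 2 * pi :> R. Proof. by rewrite mulr_gt0 // pi_gt0. Qed.

(** Composition with the exponential turns the annulus into the rectangle with sides
    [[ln r1, ln r2]] and [[0, 2 * pi]]. The horizontal sides cancel by periodicity and Goursat's
    theorem equates the vertical ones, which are the two circles. *)
Lemma cmean_annulus k r1 r2 : 0 < r1 -> r1 <= r2 ->
  (forall z, r1 <= rnorm z <= r2 -> derivable k z 1) -> cmean k r1 = cmean k r2.
Proof.
move=> r10 r12 dk; have r20 := lt_le_trans r10 r12.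
have l12 : ln r1 <= ln r2 by rewrite ler_ln ?posrE.
pose G z := k (cexp z).
have dG x y : ln r1 <= x <= ln r2 -> 0 <= y <= 2 * pi -> derivable G (x +i* y) 1.
  move=> /andP[xa xb] _; apply/derivable1_diffP.
  apply: (@differentiable_comp _ _ _ _ (@cexp R) k).
    exact: differentiable_cexp.
  apply/derivable1_diffP/dk; rewrite rnorm_cexp /=.
  by rewrite -[r1]lnK ?posrE // -[r2]lnK ?posrE // !ler_expR xa.
have := goursat l12 (ltW pi2_gt0) dG; rewrite /rect_int.
have -> : cint (fun x => G (x +i* 0)) (ln r1) (ln r2) =
    cint (fun x => G (x +i* (2 * pi))) (ln r1) (ln r2).
  by apply: eq_cint => x _; rewrite /G !cexpE expi0 expi2pi.
rewrite subrr add0r => /eqP; rewrite mulf_eq0 => /orP[|].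
  by rewrite eq_complex /= oner_eq0 andbF.
rewrite subr_eq0 => /eqP E; congr (_ * _).
have F r : 0 < r -> cint (fun y => G (ln r +i* y)) 0 (2 * pi) =
    cint (fun t => k (r%:C * expi t)) 0 (2 * pi).
  by move=> r0; apply: eq_cint => y _; rewrite /G cexpE lnK ?posrE.
exact: (etrans (esym (F r1 r10)) (etrans (esym E) (F r2 r20))).
Qed.

Definition continuous_on_disc k r := forall z, rnorm z <= r -> {for z, continuous k}.

Lemma rnorm_circle r t : 0 <= r -> rnorm (r%:C * expi t) = r.
Proof. by move=> r0; rewrite rnormM rnorm_expi mulr1 rnorm_real ger0_norm. Qed.

Lemma ccont_circle k r (t1 t2 : R) :
  0 <= r -> (forall z, rnorm z = r -> {for z, continuous k}) ->
  continuous_on_seg (fun t => k (r%:C * expi t)) t1 t2.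
Proof.
move=> r0 ck t _; apply: (@continuous_comp _ _ _ (fun t : R => r%:C * expi t : C) k).
  apply: (@continuousM _ _ (fun=> r%:C) expi); first exact: cst_continuous.
  exact: continuous_expi.
by apply: ck; rewrite rnorm_circle.
Qed.

Lemma cmean_le k r (M : R) : 0 <= r -> (forall z, rnorm z = r -> {for z, continuous k}) ->
  (forall t, 0 <= t <= 2 * pi -> rnorm (k (r%:C * expi t)) <= M) ->
  rnorm (cmean k r) <= 2 * M.
Proof.
move=> r0 ck kM; rewrite rnormM rnorm_real ger0_norm ?invr_ge0 ?(ltW pi2_gt0) //.
rewrite ler_pdivrMl // [leRHS]mulrC.
have := @cint_le _ (fun t => k (r%:C * expi t)) 0 (2 * pi) M (ltW pi2_gt0).
by rewrite subr0; apply => //; exact: ccont_circle r0 ck.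
Qed.

Lemma cmeanB k g r : 0 <= r -> (forall z, rnorm z = r -> {for z, continuous k}) ->
  (forall z, rnorm z = r -> {for z, continuous g}) ->
  cmean (fun z => k z - g z) r = cmean k r - cmean g r.
Proof.
by move=> r0 ck cg; rewrite /cmean -mulrBr -cintB //; exact: ccont_circle.
Qed.

Lemma cmeanD k g r : 0 <= r -> (forall z, rnorm z = r -> {for z, continuous k}) ->
  (forall z, rnorm z = r -> {for z, continuous g}) ->
  cmean (fun z => k z + g z) r = cmean k r + cmean g r.
Proof.
by move=> r0 ck cg; rewrite /cmean -mulrDr -cintD //; exact: ccont_circle.
Qed.

Lemma cmeanZ a k r : 0 <= r -> (forall z, rnorm z = r -> {for z, continuous k}) ->
  cmean (fun z => a * k z) r = a * cmean k r.
Proof.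
by move=> r0 ck; rewrite /cmean (cintZ _ (@ccont_circle k r 0 (2 * pi) r0 ck)) mulrCA.
Qed.

Lemma cmean_cst a r : cmean (fun=> a) r = a.
Proof.
rewrite /cmean cint_cst ?(ltW pi2_gt0) // subr0 mulrA -rmorphM /= mulVf ?mul1r //.
by rewrite gt_eqF.
Qed.

Lemma eq_cmean k g r : 0 <= r -> (forall z, rnorm z = r -> k z = g z) ->
  cmean k r = cmean g r.
Proof.
by move=> r0 kg; congr (_ * _); apply: eq_cint => t _; rewrite kg // rnorm_circle.
Qed.

End CircleMean.

(** * Cauchy's formula and Taylor estimates *)

Section Cauchy.
Variable R : realType.
Local Notation C := R[i].
Implicit Types (k g : C -> C) (r x y : R) (z a : C).

(** Compactness of the interval of angles makes continuity in the radius uniform along the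
    circle. *)
Lemma circle_uniform k r0 : 0 <= r0 -> (forall z, rnorm z = r0 -> {for z, continuous k}) ->
  forall e : R, 0 < e -> exists2 d : R, 0 < d &
    forall r t, `|r - r0| < d -> 0 <= t <= 2 * pi ->
    rnorm (k (r%:C * expi t) - k (r0%:C * expi t)) < e.
Proof.
move=> r00 ck e e0.
pose P (r t : R) : Prop := rnorm (k (r%:C * expi t) - k (r0%:C * expi t)) < e.
have cpt := (@segment_compact R 0 (2 * pi)).
have : \forall r \near r0, `[0, 2 * pi] `<=` P r.
  apply: ((iffLR (compact_near_coveringP _) cpt) R (nbhs r0) P _) => t _.
  pose h (p : R * R) : C := p.2%:C * expi p.1.
  have ch : {for (t, r0), continuous h}.
    apply: (@continuousM _ _ (fun p : R * R => p.2%:C : C) (fun p => expi p.1)).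
      apply: (@continuous_comp _ _ _ snd (fun r : R => r%:C : C)); first exact: cvg_snd.
      exact: continuous_ofreal.
    apply: (@continuous_comp _ _ _ fst (@expi R)); first exact: cvg_fst.
    exact: continuous_expi.
  have ckh : {for (t, r0), continuous (k \o h)}.
    by apply: continuous_comp ch _; apply: ck; rewrite rnorm_circle.
  have e2 : 0 < e / 2 by rewrite divr_gt0.
  move/cvg_rnormP : ckh => /(_ _ e2); rewrite /= => -[[A B] /= [nA nB] AB].
  exists (A, B) => //= -[t' r'] /= [At' Br'].
  rewrite /P (le_lt_trans (rnorm_triangle _ (k (h (t, r0))) _)) // (splitr e) ltrD //.
    exact: (AB (t', r')).
  rewrite rnormC; apply: (AB (t', r0)); split => //=; exact: nbhs_singleton.
move=> /nbhs_ballP[d /= d0 dP]; exists d => // r t rd t2.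
by apply: dP; [rewrite -ball_normE /= distrC|rewrite /= in_itv].
Qed.

Lemma rnorm_eps (x y : C) : (forall e : R, 0 < e -> rnorm (x - y) <= e) -> x = y.
Proof.
move=> xy; apply/eqP; rewrite -subr_eq0 -rnorm0_eq0 eq_le rnorm_ge0 andbT.
by apply/ler_addgt0Pl => e e0; rewrite addr0; exact: xy.
Qed.

Lemma cmean_uniform k r r0 : 0 <= r0 <= r -> continuous_on_disc k r ->
  forall e : R, 0 < e -> exists2 d : R, 0 < d &
    forall r', 0 <= r' <= r -> `|r' - r0| < d -> rnorm (cmean k r' - cmean k r0) <= e.
Proof.
move=> /andP[r00 r0r] ck e e0; have e4 : 0 < e / 2 by rewrite divr_gt0.
have ckr z : rnorm z = r0 -> {for z, continuous k} by move=> zr; apply: ck; rewrite zr.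
have [d d0 dP] := circle_uniform r00 ckr e4.
exists d => // r' /andP[r'0 r'r] r'd.
have pi2 : 0 < 2 * pi :> R by rewrite mulr_gt0 // pi_gt0.
have c1 : continuous_on_seg (fun t => k (r'%:C * expi t)) 0 (2 * pi).
  by apply: ccont_circle => // z zr; apply: ck; rewrite zr.
have c2 : continuous_on_seg (fun t => k (r0%:C * expi t)) 0 (2 * pi).
  by apply: ccont_circle => // z zr; apply: ck; rewrite zr.
rewrite /cmean -mulrBr -(cintB c1 c2) rnormM rnorm_real.
rewrite ger0_norm ?invr_ge0 ?(ltW pi2) // ler_pdivrMl //.
apply: le_trans (cint_le (M := e / 2) (ltW pi2) _ _) _.
- by move=> t tt; apply: (@continuousB _ _ _ (fun t => _) (fun t => _)); [exact: c1|exact: c2].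
- by move=> t tt; apply/ltW/dP.
- by rewrite subr0 le_eqVlt; apply/orP; left; apply/eqP; field.
Qed.

Lemma cmean0 k : cmean k 0 = k 0.
Proof.
rewrite -[k 0 in RHS](cmean_cst _ 0); apply: eq_cmean => // z /eqP.
by rewrite rnorm0_eq0 => /eqP ->.
Qed.

(* Differentiability may fail on one circle: by continuity, the circle means
   on both sides of it agree. *)
Lemma mean_value k r s : 0 < r -> continuous_on_disc k r ->
  (forall z, 0 < rnorm z <= r -> rnorm z != s -> derivable k z 1) ->
  cmean k r = k 0.
Proof.
move=> r0 ck dk.
have cont r1 : 0 <= r1 <= r -> forall e : R, 0 < e -> exists2 d : R, 0 < d &
    forall r', 0 <= r' <= r -> `|r' - r1| < d -> rnorm (cmean k r' - cmean k r1) <= e.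
  by move=> r1r; exact: cmean_uniform r1r ck.
have ann r1 r2 : 0 < r1 -> r1 <= r2 -> r2 <= r -> (s < r1) || (r2 < s) ->
    cmean k r1 = cmean k r2.
  move=> r10 r12 r2r s12; apply: cmean_annulus => // z /andP[z1 z2]; apply: dk.
    by rewrite (lt_le_trans r10 z1) (le_trans z2).
  by case/orP : s12 => ?; [rewrite gt_eqF // (lt_le_trans _ z1)|
    rewrite lt_eqF // (le_lt_trans z2)].
have left r1 : 0 < r1 -> r1 <= s -> s <= r -> cmean k r1 = cmean k s.
  move=> r10; rewrite le_eqVlt => /predU1P[->//|r1s] sr; apply: rnorm_eps => e e0.
  have [|d d0 dP] := cont s _ _ e0; first by rewrite sr ltW // (lt_trans r10).
  pose r' := Num.max r1 (s - d / 2).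
  have r1r' : r1 <= r' by rewrite le_max lexx.
  have r's : r' < s by rewrite gt_max r1s /=; lra.
  rewrite (ann r1 r') ?r's ?orbT //; last by rewrite (le_trans _ sr) // ltW.
  apply: dP; first by rewrite (ltW (lt_le_trans r10 r1r')) (le_trans _ sr) // ltW.
  have : s - d / 2 <= r' by rewrite le_max lexx orbT.
  by rewrite distrC ger0_norm ?subr_ge0 ?(ltW r's) //; lra.
have right r1 : 0 < s -> s <= r1 -> r1 <= r -> cmean k r1 = cmean k s.
  move=> s0; rewrite le_eqVlt => /predU1P[->//|sr1] r1r; apply: rnorm_eps => e e0.
  have [|d d0 dP] := cont s _ _ e0; first by rewrite (ltW s0) ltW // (lt_le_trans sr1).
  pose r' := Num.min r1 (s + d / 2).
  have r1r' : r' <= r1 by rewrite ge_min lexx.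
  have r's : s < r' by rewrite lt_min sr1 /=; lra.
  rewrite -(ann r' r1) ?r's ?(lt_trans s0) //.
  apply: dP; first by rewrite (ltW (lt_trans s0 r's)) (le_trans r1r').
  have : r' <= s + d / 2 by rewrite ge_min lexx orbT.
  by rewrite ger0_norm ?subr_ge0 ?(ltW r's) //; lra.
have all r1 : 0 < r1 -> r1 <= r -> cmean k r1 = cmean k r.
  move=> r10 r1r; have [sr1|r1s] := ltP s r1; first by rewrite (ann r1 r) ?sr1.
  have [rs|sr] := ltP r s; first by rewrite (ann r1 r) ?rs ?orbT.
  by rewrite (left r1) // (right r) // (lt_le_trans r10).
(* The mean is constant for positive radii, and it is continuous down to radius 0, where it is the
   value at the centre. *)
apply: rnorm_eps => e e0; rewrite -cmean0.
have [|d d0 dP] := cont 0 _ _ e0; first by rewrite lexx ltW.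
pose r1 := Num.min r (d / 2).
have r10 : 0 < r1 by rewrite lt_min r0 divr_gt0.
have r1d : r1 <= d / 2 by rewrite ge_min lexx orbT.
have r1r : r1 <= r by rewrite ge_min lexx.
rewrite -(all r1) //; apply: dP; rewrite ?(ltW r10) //.
by rewrite subr0 gtr0_norm //; lra.
Qed.

Lemma derivable_sub_cst a z : derivable (fun t : C => t - a) z 1.
Proof. by apply: derivableB; [exact: derivable_id|exact: derivable_cst]. Qed.

Lemma derivable_inv_sub a z : z != a -> derivable (fun t : C => (t - a)^-1) z 1.
Proof.
move=> za; apply: (@derivableV _ _ (fun t : C => t - a)).
  by rewrite subr_eq0.
exact: derivable_sub_cst.
Qed.

Lemma continuous_inv_sub a z : z != a -> {for z, continuous (fun t : C => (t - a)^-1)}.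
Proof. by move=> za; apply: derivable1_continuous; exact: derivable_inv_sub. Qed.

Lemma derivable_exprn n z : derivable (fun t : C => t ^+ n) z 1.
Proof.
elim: n => [|n IH]; first exact: derivable_cst.
have -> : (fun t : C => t ^+ n.+1) = (fun t => t * t ^+ n).
  by apply/funext => t; rewrite exprS.
by apply: (@derivableM _ _ id); [exact: derivable_id|exact: IH].
Qed.

Lemma derivable_cauchy_kernel a z : z != a ->
  derivable (fun t : C => 1 + a * (t - a)^-1) z 1.
Proof.
move=> za; apply: derivableD; first exact: derivable_cst.
apply: (@derivableM _ _ (fun=> a) (fun t => (t - a)^-1)); first exact: derivable_cst.
exact: derivable_inv_sub.
Qed.

Lemma continuous_cauchy_kernel a z : z != a ->
  {for z, continuous (fun t : C => 1 + a * (t - a)^-1)}.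
Proof. by move=> za; apply: derivable1_continuous; exact: derivable_cauchy_kernel. Qed.

(** The mean does not depend on the radius as long as the circle encloses [a], and it tends to 0 as
    the radius grows. *)
Lemma cmean_kernel_tail a r : rnorm a < r -> cmean (fun z => a * (z - a)^-1) r = 0.
Proof.
move=> ar; have r0 := le_lt_trans (rnorm_ge0 a) ar.
have ne s z : r <= s -> rnorm z = s -> z != a.
  by move=> rs zs; apply: contraTneq ar => <-; rewrite zs -leNgt.
apply: rnorm_eps => e e0; rewrite subr0.
(* Then [s - rnorm a] exceeds [2 * rnorm a / e], so the integrand is at most [e / 2] on the circle
   of radius [s]. *)
pose s := r + 2 * rnorm a / e + rnorm a.
have a0 := rnorm_ge0 a.
have q0 : 0 <= 2 * rnorm a / e by rewrite divr_ge0 ?mulr_ge0 // ltW.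
have rs : r <= s by rewrite /s -addrA lerDl addr_ge0.
have E : cmean (fun z => a * (z - a)^-1) r = cmean (fun z => a * (z - a)^-1) s.
  apply: cmean_annulus => // z /andP[rz _].
  apply: (@derivableM _ _ (fun=> a) (fun z => (z - a)^-1)); first exact: derivable_cst.
  exact: derivable_inv_sub (ne _ _ rz erefl).
rewrite E; have s0 : 0 <= s by rewrite (le_trans _ rs) // ltW.
have -> : e = 2 * (e / 2) by field.
have cs z : rnorm z = s -> {for z, continuous (fun z : C => a * (z - a)^-1)}.
  move=> zs.
  apply: (@continuousM _ _ (fun=> a) (fun z => (z - a)^-1)); first exact: cst_continuous.
  exact: continuous_inv_sub (ne _ _ rs zs).
refine (cmean_le s0 cs _) => t _.
rewrite rnormM rnormV.
have H : s - rnorm a <= rnorm (s%:C * expi t - a).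
  rewrite lerBlDr -{1}(rnorm_circle t s0) -{1}[s%:C * _](subrK a).
  exact: rnormD.
have p : 0 < s - rnorm a by rewrite /s addrK ltr_pwDl.
rewrite ler_pdivrMr; last exact: lt_le_trans p H.
apply: le_trans (_ : e / 2 * (s - rnorm a) <= _); last by rewrite ler_pM2l // divr_gt0.
rewrite /s addrK mulrDr.
have -> : e / 2 * (2 * rnorm a / e) = rnorm a by field; rewrite gt_eqF.
by rewrite lerDr mulr_ge0 ?divr_ge0 // ltW.
Qed.

Definition hol_on_disc g r := forall z, rnorm z <= r -> derivable g z 1.

Lemma hol_continuous_on_disc g r : hol_on_disc g r -> continuous_on_disc g r.
Proof. by move=> dg z /dg; exact: derivable1_continuous. Qed.

(** The factor [1 + a * (z - a)^-1] is z / (z - a), that is, Cauchy's kernel once dz has been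
    written as i z dt. The difference quotient [q], completed by the derivative at [a], is
    continuous and may fail to be differentiable only at [a], hence only on the circle through [a].
    The mean value property then applies to [z * q z], which vanishes at 0. *)
Lemma cauchy_formula g a r : rnorm a < r -> hol_on_disc g r ->
  cmean (fun z => g z * (1 + a * (z - a)^-1)) r = g a.
Proof.
move=> ar dg; have r0 := le_lt_trans (rnorm_ge0 a) ar.
have cg := hol_continuous_on_disc dg.
have /derivable_rnormP[l lP] : derivable g a 1 by apply: dg; exact: ltW.
pose q (z : C) : C := if z == a then l else (g z - g a) * (z - a)^-1.
have q_loc (z : C) : z != a -> exists2 e : R, 0 < e & forall y : C, rnorm (y - z) < e ->
    (g y - g a) * (y - a)^-1 = q y.
  move=> za; exists (rnorm (z - a)); first by rewrite rnorm_gt0 subr_eq0.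
  by move=> y yz; rewrite /q ifF //; apply/eqP => ya; move: yz; rewrite ya rnormC ltxx.
have dq z : rnorm z <= r -> z != a -> derivable q z 1.
  move=> zr za; have [e e0 eP] := q_loc z za.
  apply: (near_eq_derivable1 e0 eP).
  apply: (@derivableM _ _ (fun z => g z - g a) (fun z => (z - a)^-1)).
    by apply: derivableB; [exact: dg|exact: derivable_cst].
  exact: derivable_inv_sub.
have cq z : rnorm z <= r -> {for z, continuous q}.
  move=> zr; have [->|za] := eqVneq z a; last exact/derivable1_continuous/dq.
  apply/continuous_rnormP => e e0; have e2 : 0 < e / 2 by rewrite divr_gt0.
  have [d d0 dP] := lP _ e2; exists d => // y yd.
  rewrite {2}/q eqxx /q; case: ifPn => [_|ya]; first by rewrite subrr rnorm0.
  have y0 : 0 < rnorm (y - a) by rewrite rnorm_gt0 subr_eq0.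
  have := dP _ yd; rewrite [_%:A]mulr1 subrK => H.
  have -> : (g y - g a) * (y - a)^-1 - l = (g y - g a - (y - a) * l) * (y - a)^-1.
    by field; rewrite subr_eq0.
  rewrite rnormM rnormV ltr_pdivrMr // (le_lt_trans H) // ltr_pM2r //; lra.
have zero : cmean (fun z => z * q z) r = 0.
  have c1 : continuous_on_disc (fun z => z * q z) r.
    by move=> z zr; apply: (@continuousM _ _ id q); [exact: cvg_id|exact: cq].
  have d1 z : 0 < rnorm z <= r -> rnorm z != rnorm a -> derivable (fun z => z * q z) z 1.
    move=> /andP[_ zr] za; apply: (@derivableM _ _ id q); first exact: derivable_id.
    by apply: dq zr _; apply: contraNneq za => ->.
  by rewrite (mean_value r0 c1 d1) mul0r.
have ne z : rnorm z = r -> z != a.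
  by move=> zr; apply: contraTneq ar => <-; rewrite zr ltxx.
pose ker (z : C) : C := 1 + a * (z - a)^-1.
have cker z : rnorm z = r -> {for z, continuous ker}.
  by move=> /ne za; exact: continuous_cauchy_kernel.
have ker1 : cmean ker r = 1.
  have c1 z : rnorm z = r -> {for z, continuous (fun=> 1 : C)}.
    by move=> _; exact: cst_continuous.
  have c2 z : rnorm z = r -> {for z, continuous (fun z : C => a * (z - a)^-1)}.
    move=> /ne za.
    apply: (@continuousM _ _ (fun=> a) (fun z => (z - a)^-1)); first exact: cst_continuous.
    exact: continuous_inv_sub.
  by rewrite /ker (cmeanD (ltW r0) c1 c2) cmean_cst cmean_kernel_tail // addr0.
have : cmean (fun z => g z * ker z - g a * ker z) r = 0.
  rewrite -zero; apply: eq_cmean; first exact: ltW.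
  move=> z /ne za; rewrite /q (negPf za) /ker; field.
  by rewrite subr_eq0.
have c1 z : rnorm z = r -> {for z, continuous (fun z => g z * ker z)}.
  move=> zr; apply: (@continuousM _ _ g ker); last exact: cker.
  by apply: cg; rewrite zr.
have c2 z : rnorm z = r -> {for z, continuous (fun z => g a * ker z)}.
  move=> zr; apply: (@continuousM _ _ (fun=> g a) ker); last exact: cker.
  exact: cst_continuous.
rewrite (cmeanB (ltW r0) c1 c2) (cmeanZ _ (ltW r0) cker) ker1 mulr1 => /eqP.
by rewrite subr_eq0 => /eqP.
Qed.

Definition taylor_coef g r n : C := cmean (fun z => g z * z ^- n) r.

(** The kernel satisfies k = 1 + (a / z) k. Applying this [N] times splits off [N] coefficients and
    leaves the exact remainder [a ^+ N * cmean (rem N) r], which is then estimated. *)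
Lemma taylor_bound g a r N (A : R) : rnorm a < r -> hol_on_disc g r ->
  (forall t, 0 <= t <= 2 * pi -> rnorm (g (r%:C * expi t)) <= A) ->
  rnorm (g a - \sum_(n < N) taylor_coef g r n * a ^+ n) <=
  2 * A * (r / (r - rnorm a)) * (rnorm a / r) ^+ N.
Proof.
move=> ar dg gA; have r0 := le_lt_trans (rnorm_ge0 a) ar; have r0' := ltW r0.
have cg := hol_continuous_on_disc dg.
have ne z : rnorm z = r -> z != a.
  by move=> zr; apply: contraTneq ar => <-; rewrite zr ltxx.
have nz z : rnorm z = r -> z != 0.
  by move=> zr; rewrite -rnorm_gt0 zr.
have cX n z : rnorm z = r -> {for z, continuous (fun z : C => z ^- n)}.
  move=> zr; apply: (@continuousV _ _ (fun z : C => z ^+ n)).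
    by rewrite expf_neq0 // nz.
  by apply: derivable1_continuous; exact: derivable_exprn.
have cgX n z : rnorm z = r -> {for z, continuous (fun z : C => g z * z ^- n)}.
  move=> zr; apply: (@continuousM _ _ g (fun z : C => z ^- n)); last exact: cX.
  by apply: cg; rewrite zr.
pose rem n (z : C) : C := g z * z ^- n * (1 + a * (z - a)^-1).
have cker z : rnorm z = r -> {for z, continuous (fun z => 1 + a * (z - a)^-1)}.
  by move=> /ne za; exact: continuous_cauchy_kernel.
have crem n z : rnorm z = r -> {for z, continuous (rem n)}.
  move=> zr; apply: (@continuousM _ _ (fun z => g z * z ^- n) (fun z => 1 + a * (z - a)^-1)).
    exact: cgX.
  exact: cker.
have -> : g a - \sum_(n < N) taylor_coef g r n * a ^+ n = a ^+ N * cmean (rem N) r.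
  elim: N => [|N IH].
    rewrite big_ord0 subr0 expr0 mul1r -(cauchy_formula ar dg).
    by apply: eq_cmean => // z _; rewrite /rem expr0 invr1 mulr1.
  rewrite big_ord_recr /= opprD addrA IH.
  have -> : cmean (rem N) r = taylor_coef g r N + a * cmean (rem N.+1) r.
    have c2 z : rnorm z = r -> {for z, continuous (fun z => a * rem N.+1 z)}.
      move=> zr; apply: (@continuousM _ _ (fun=> a) (rem N.+1)); last exact: crem.
      exact: cst_continuous.
    rewrite -(cmeanZ _ r0' (crem N.+1)) /taylor_coef -(cmeanD r0' (cgX N) c2).
    apply: eq_cmean => // z zr; rewrite /rem exprS.
    have z0 := nz z zr; have za := ne z zr.
    by field; rewrite z0 subr_eq0 za expf_neq0.
  by rewrite exprSr; ring.
rewrite rnormM rnormX.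
have ra : 0 < r - rnorm a by rewrite subr_gt0.
have A0 : 0 <= A.
  apply: le_trans (rnorm_ge0 (g (r%:C * expi 0))) _; apply: gA.
  by rewrite lexx mulr_ge0 // pi_ge0.
have H : rnorm (cmean (rem N) r) <= 2 * (A * (r ^- N) * (r / (r - rnorm a))).
  refine (cmean_le r0' (crem N) _) => t tt.
  rewrite /rem rnormM rnormM rnormV rnormX rnorm_circle //.
  apply: ler_pM; rewrite ?rnorm_ge0 ?mulr_ge0 ?rnorm_ge0 ?invr_ge0 ?exprn_ge0 //.
    by apply: ler_pM; rewrite ?rnorm_ge0 ?invr_ge0 ?exprn_ge0 //; exact: gA.
  set z := r%:C * expi t; have zr : rnorm z = r by rewrite rnorm_circle.
  have -> : 1 + a * (z - a)^-1 = z * (z - a)^-1.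
    by have za := ne z zr; field; rewrite subr_eq0.
  rewrite rnormM rnormV zr ler_pM2l // lef_pV2 ?posrE //.
    by rewrite lerBlDr -{1}zr -{1}(subrK a z); exact: rnormD.
  by rewrite rnorm_gt0 subr_eq0 ne.
apply: le_trans (ler_wpM2l _ H) _; first by rewrite exprn_ge0 // rnorm_ge0.
by rewrite expr_div_n le_eqVlt; apply/orP; left; apply/eqP; ring.
Qed.

Lemma rnorm_dist (x y : C) : `|rnorm x - rnorm y| <= rnorm (x - y).
Proof. by rewrite -lecR -!normE -rnorm_real -normE rmorphB /= -!normE ler_dist_dist. Qed.

Lemma circle_bounded k r : 0 <= r -> (forall z, rnorm z = r -> {for z, continuous k}) ->
  exists A : R, forall t, 0 <= t <= 2 * pi -> rnorm (k (r%:C * expi t)) <= A.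
Proof.
move=> r0 ck; have cc := ccont_circle (t1 := 0) (t2 := 2 * pi) r0 ck.
have pi2 : 0 <= 2 * pi :> R by rewrite mulr_ge0 // pi_ge0.
have cn : {within `[0, 2 * pi], continuous (fun t => rnorm (k (r%:C * expi t)))}.
  apply: continuous_in_subspaceT => t; rewrite inE /= in_itv /= => tt.
  apply/cvgrPdist_lt => e e0; have /cvg_rnormP /(_ _ e0) := cc t tt.
  apply: filterS => s; apply: le_lt_trans.
  by rewrite distrC rnorm_dist.
have [c cin cP] := EVT_max pi2 cn.
exists (rnorm (k (r%:C * expi c))) => t tt; apply: cP.
by rewrite in_itv.
Qed.

End Cauchy.

(** * Zeros of holomorphic functions of one variable *)

Section OneVariable.
Variable R : realType.
Local Notation C := R[i].
Implicit Types (g : C -> C) (r s : R) (z a : C).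

Lemma taylor_expansion g r : 0 < r -> hol_on_disc g r ->
  exists c : nat -> C, exists2 A : R, 0 < A & forall N a, rnorm a < r ->
    rnorm (g a - \sum_(n < N) c n * a ^+ n) <= A * (r / (r - rnorm a)) * (rnorm a / r) ^+ N.
Proof.
move=> r0 dg; have cg := hol_continuous_on_disc dg.
have cr z : rnorm z = r -> {for z, continuous g} by move=> zr; apply: cg; rewrite zr.
have [A AP] := circle_bounded (ltW r0) cr.
have A0 : 0 <= A.
  apply: le_trans (rnorm_ge0 (g (r%:C * expi 0))) _; apply: AP.
  by rewrite lexx mulr_ge0 // pi_ge0.
exists (taylor_coef g r); exists (2 * A + 1) => [|N a ar].
  by rewrite ltr_wpDl // mulr_ge0.
apply: (le_trans (taylor_bound N ar dg AP)).
have ra : 0 < r - rnorm a by rewrite subr_gt0.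
rewrite ler_wpM2r ?exprn_ge0 ?divr_ge0 ?rnorm_ge0 ?ltW //.
by rewrite ltr_pM2r ?divr_gt0 // ltrDl.
Qed.

Lemma taylor_bound_half (A : R) r N a : 0 < A -> 0 < r -> rnorm a <= r / 2 ->
  A * (r / (r - rnorm a)) * (rnorm a / r) ^+ N <= 2 * A / r ^+ N * rnorm a ^+ N.
Proof.
move=> A0 r0 ar; have ra : 0 < r - rnorm a by lra.
have H : r / (r - rnorm a) <= 2 by rewrite ler_pdivrMr //; lra.
have p : 0 <= (rnorm a / r) ^+ N by rewrite exprn_ge0 // divr_ge0 ?rnorm_ge0 // ltW.
have -> : 2 * A / r ^+ N * rnorm a ^+ N = A * 2 * (rnorm a / r) ^+ N.
  by rewrite expr_div_n; ring.
by rewrite ler_wpM2r // ler_pM2l.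
Qed.

Lemma small_of_pos (q d : R) : 0 <= q -> 0 < d -> exists2 x : R, 0 < x & q * x < d.
Proof.
move=> q0 d0; exists (d / (q + 1)); first by rewrite divr_gt0 // ltr_wpDl.
have q1 : 0 < q + 1 by rewrite ltr_wpDl.
by rewrite mulrCA gtr_pMr // ltr_pdivrMr // mul1r ltrDl.
Qed.

(** If all coefficients vanished, the remainder bound would tend to 0 at [a], although the value
    there is nonzero. *)
Lemma hol_nonzero_coef g r (c : nat -> C) (A : R) a : 0 < r -> 0 < A ->
  (forall N a, rnorm a < r ->
    rnorm (g a - \sum_(n < N) c n * a ^+ n) <= A * (r / (r - rnorm a)) * (rnorm a / r) ^+ N) ->
  rnorm a < r -> g a != 0 -> exists k, c k != 0 /\ forall j, (j < k)%N -> c j = 0.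
Proof.
move=> r0 A0 cP ar ga.
have [k ck] : exists k, c k != 0.
  apply: contrapT => /forallNP c0.
  have {}c0 n : c n = 0 by apply/eqP/negPn/negP/c0.
  have ga0 : 0 < rnorm (g a) by rewrite rnorm_gt0.
  have ra : 0 < r - rnorm a by rewrite subr_gt0.
  have q1 : `|rnorm a / r| < 1.
    by rewrite ger0_norm ?divr_ge0 ?rnorm_ge0 ?(ltW r0) // ltr_pdivrMr // mul1r.
  have M0 : 0 < A * (r / (r - rnorm a)) by rewrite mulr_gt0 // divr_gt0.
  have e0 : 0 < rnorm (g a) / (A * (r / (r - rnorm a))) by rewrite divr_gt0.
  have /cvgrPdist_lt /(_ _ e0) [N _ NP] := @cvg_expr R _ q1.
  have := NP N (leqnn N); rewrite sub0r normrN ger0_norm; last first.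
    by rewrite exprn_ge0 // divr_ge0 ?rnorm_ge0 ?ltW.
  rewrite ltr_pdivlMr // mulrC => /(le_lt_trans (cP N a ar)).
  by rewrite big1 ?subr0 ?ltxx // => i _; rewrite c0 mul0r.
have exk : exists k, c k != 0 by exists k.
exists (ex_minn exk); case: ex_minnP => k' ck' mink'; split => // j jk.
by apply/eqP; apply: contraTT jk => cj; rewrite -leqNgt mink'.
Qed.

(** Here [k] is the order of the zero at 0, and [u] is [g z / z ^+ k] completed by the first nonzero
    coefficient. The Taylor bound of order [k + 1] keeps [u] away from 0 near the origin; the bound
    of order [k + 2] gives its derivative there. *)
Lemma hol_factor0 g r a : 0 < r -> hol_on_disc g r -> rnorm a < r -> g a != 0 ->
  exists k (u : C -> C) s, [/\ 0 < s, s < r,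
    forall z, rnorm z < s -> g z = z ^+ k * u z &
    forall z, rnorm z < s -> u z != 0 /\ derivable u z 1].
Proof.
move=> r0 dg ar ga; have [c [A A0 cP]] := taylor_expansion r0 dg.
have [k [ck cj]] := hol_nonzero_coef r0 A0 cP ar ga.
have sumk z n : \sum_(i < k + n) c i * z ^+ i = z ^+ k * \sum_(i < n) c (k + i)%N * z ^+ i.
  rewrite big_split_ord /= big1 ?add0r; last by move=> i _; rewrite cj // mul0r.
  by rewrite mulr_sumr; apply: eq_bigr => i _; rewrite exprD mulrCA.
pose u z := if z == 0 then c k else g z / z ^+ k.
pose M := 2 * A / r ^+ k.
have M0 : 0 <= M by rewrite /M divr_ge0 ?mulr_ge0 ?exprn_ge0 // ltW.
have uB n z : rnorm z <= r / 2 -> z != 0 ->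
    rnorm (u z - \sum_(i < n) c (k + i)%N * z ^+ i) <= M / r ^+ n * rnorm z ^+ n.
  move=> zr z0; have zk : 0 < rnorm z ^+ k by rewrite exprn_gt0 // rnorm_gt0.
  have -> : u z - \sum_(i < n) c (k + i)%N * z ^+ i =
      (g z - \sum_(i < k + n) c i * z ^+ i) / z ^+ k.
    by rewrite /u (negPf z0) sumk; field; rewrite expf_neq0.
  rewrite rnormM rnormV rnormX ler_pdivrMr //.
  have zr' : rnorm z < r by lra.
  apply: (le_trans (cP _ _ zr')); apply: (le_trans (taylor_bound_half _ A0 r0 zr)).
  rewrite /M !exprD le_eqVlt; apply/orP; left; apply/eqP.
  by field; rewrite !expf_neq0 // gt_eqF.
have ck0 : 0 < rnorm (c k) by rewrite rnorm_gt0.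
have q0 : 0 <= M / r by rewrite divr_ge0 // ltW.
have [s1 s10 s1P] := small_of_pos q0 ck0.
pose s := Num.min (r / 2) s1.
have s0 : 0 < s by rewrite lt_min s10 divr_gt0.
have sr : s <= r / 2 by rewrite ge_min lexx.
have ss1 : s <= s1 by rewrite ge_min lexx orbT.
exists k, u, s; split => //; first by lra.
  move=> z zs; rewrite /u; have [->|z0] := eqVneq z 0; last by field; rewrite expf_neq0.
  have := cP k.+1 0; rewrite rnorm0 => /(_ r0); rewrite mul0r expr0n /= mulr0.
  have := sumk 0 1%N; rewrite addn1 => ->; rewrite big_ord1 addn0 mulr1.
  move=> H; apply/eqP; rewrite -subr_eq0 -rnorm0_eq0 eq_le rnorm_ge0 andbT.
  exact: H.
move=> z zs; have zr : rnorm z <= r / 2 by rewrite (le_trans (ltW zs)).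
have [z0|z0] := eqVneq z 0.
  split; first by rewrite /u z0 eqxx.
  apply/derivable_rnormP; exists (c k.+1) => e e0.
  have q2 : 0 <= M / r ^+ 2 by rewrite divr_ge0 // exprn_ge0 // ltW.
  have [d d0 dP] := small_of_pos q2 e0.
  exists (Num.min d s) => [|h]; first by rewrite lt_min d0.
  rewrite lt_min => /andP[hd hs]; rewrite [_%:A]mulr1 z0 addr0.
  have [->|h0] := eqVneq h 0; first by rewrite subrr scale0r subr0 !rnorm0 mulr0.
  have hr : rnorm h <= r / 2 by rewrite (le_trans (ltW hs)).
  have := uB 2%N h hr h0; rewrite !big_ord_recr big_ord0 /= add0r addn0 addn1 mulr1 expr1.
  have -> : u 0 = c k by rewrite /u eqxx.
  have -> : h *: c k.+1 = c k.+1 * h by rewrite mulrC.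
  rewrite opprD addrA => /le_trans; apply.
  rewrite [rnorm h ^+ 2]expr2 mulrA ler_wpM2r ?rnorm_ge0 //.
  by rewrite (le_trans _ (ltW dP)) // ler_wpM2l // ltW.
split.
  apply: contraTneq (uB 1%N z zr z0) => uz; rewrite -ltNge.
  rewrite uz big_ord1 addn0 expr0 mulr1 sub0r rnormN !expr1.
  apply: le_lt_trans s1P; rewrite ler_wpM2l //; lra.
have dv : derivable (fun t : C => g t / t ^+ k) z 1.
  apply: (@derivableM _ _ g (fun t => (t ^+ k)^-1)); first by apply: dg; lra.
  apply: (@derivableV _ _ (fun t : C => t ^+ k)); first by rewrite expf_neq0.
  exact: derivable_exprn.
have zp : 0 < rnorm z by rewrite rnorm_gt0.
apply: (near_eq_derivable1 zp _ dv) => y yz; rewrite /u ifF //.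
by apply/eqP => y0; move: yz; rewrite y0 sub0r rnormN ltxx.
Qed.

Lemma derivable_shift (f : C -> C) z b : derivable f (z + b) 1 ->
  derivable (fun t => f (t + b)) z 1.
Proof.
move=> /derivable_rnormP[l lP]; apply/derivable_rnormP; exists l => e /lP[d d0 dP].
by exists d => // h /dP; rewrite addrA.
Qed.

Lemma hol_factor g b r a : 0 < r ->
  (forall z, rnorm (z - b) <= r -> derivable g z 1) ->
  rnorm (a - b) < r -> g a != 0 ->
  exists k (u : C -> C) s, [/\ 0 < s, s < r,
    forall z, rnorm (z - b) < s -> g z = (z - b) ^+ k * u z &
    forall z, rnorm (z - b) < s -> u z != 0 /\ derivable u z 1].
Proof.
move=> r0 dg ar ga; pose g' z := g (z + b).
have dg' : hol_on_disc g' r.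
  by move=> z zr; apply: derivable_shift; apply: dg; rewrite addrK.
have ga' : g' (a - b) != 0 by rewrite /g' subrK.
have [k [u [s [s0 sr gu uP]]]] := hol_factor0 r0 dg' ar ga'.
exists k, (fun z => u (z - b)), s; split => //.
  by move=> z /gu; rewrite /g' subrK.
by move=> z /uP[u0 du]; split; [exact: u0|exact: (derivable_shift (f := u) (b := - b))].
Qed.

Lemma hol_zero_disc g r s : 0 < s -> 0 < r -> hol_on_disc g r ->
  (forall z, rnorm z < s -> g z = 0) -> forall z, rnorm z < r -> g z = 0.
Proof.
move=> s0 r0 dg g0 a ar; apply/eqP/negPn/negP => ga.
have [k [u [s' [s'0 _ gu uP]]]] := hol_factor0 r0 dg ar ga.
pose t := Num.min s s' / 2.
have m0 : 0 < Num.min s s' by rewrite lt_min s0.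
have t0 : 0 < t by rewrite /t divr_gt0.
have ts : t < s by have : Num.min s s' <= s; [rewrite ge_min lexx|rewrite /t; lra].
have ts' : t < s' by have : Num.min s s' <= s'; [rewrite ge_min lexx orbT|rewrite /t; lra].
have tn : rnorm (t%:C : C) = t by rewrite rnorm_real gtr0_norm.
have ts'n : rnorm (t%:C : C) < s' by rewrite tn.
have := gu _ ts'n; rewrite g0 ?tn // => /esym/eqP; rewrite mulf_eq0 expf_eq0.
have [u0 _] := uP _ ts'n.
by rewrite (negPf u0) orbF -rnorm0_eq0 tn gt_eqF // andbF.
Qed.

End OneVariable.

(** * Holomorphic functions on balls of a normed space *)

Section SeveralVariables.
Variable R : realType.
Local Notation C := R[i].

Lemma taylor_coef0 (g : C -> C) r : 0 < r -> hol_on_disc g r -> taylor_coef g r 0 = g 0.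
Proof.
move=> r0 dg; rewrite -(@mean_value _ g r 0 r0 (hol_continuous_on_disc dg)).
  by apply: eq_cmean => [|z _]; [exact: ltW|rewrite expr0 invr1 mulr1].
by move=> z /andP[_ zr] _; exact: dg.
Qed.

Section Normed.
Variable V : normedModType C.
Implicit Types (g f : V -> C) (A : set V) (c z w e : V) (r : R).

Definition rball c r : set V := [set z | rnorm (z - c) < r].

(** Differentiability along complex lines only. Continuity is not built in; for bounded functions on
    balls it is recovered in [hol_bounded_continuous]. *)
Definition hol_on A g := forall z, A z -> forall e, derivable g z e.

Lemma rball_center c r : 0 < r -> rball c r c.
Proof. by rewrite /rball /= subrr rnorm0. Qed.

Lemma hol_onS A B g : A `<=` B -> hol_on B g -> hol_on A g.
Proof. by move=> AB gB z /AB; exact: gB. Qed.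

Lemma hol_on_cst A (k : C) : hol_on A (fun=> k).
Proof. by move=> z _ e; exact: derivable_cst. Qed.

Lemma hol_onD A f g : hol_on A f -> hol_on A g -> hol_on A (fun z => f z + g z).
Proof. by move=> hf hg z Az e; apply: derivableD; [exact: hf|exact: hg]. Qed.

Lemma hol_onB A f g : hol_on A f -> hol_on A g -> hol_on A (fun z => f z - g z).
Proof. by move=> hf hg z Az e; apply: derivableB; [exact: hf|exact: hg]. Qed.

Lemma hol_onM A f g : hol_on A f -> hol_on A g -> hol_on A (fun z => f z * g z).
Proof. by move=> hf hg z Az e; apply: derivableM; [exact: hf|exact: hg]. Qed.

Lemma hol_on_sum A (I : Type) (s : seq I) (P : pred I) (F : I -> V -> C) :
  (forall i, hol_on A (F i)) -> hol_on A (fun z => \sum_(i <- s | P i) F i z).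
Proof.
move=> hF; elim: s => [|i s IH].
  by under eq_fun do rewrite big_nil; exact: hol_on_cst.
have -> : (fun z => \sum_(j <- i :: s | P j) F j z) = (fun z => if P i then
    F i z + \sum_(j <- s | P j) F j z else \sum_(j <- s | P j) F j z).
  by apply/funext => z; rewrite big_cons.
case: (P i); last exact: IH.
by apply: hol_onD; [exact: hF|exact: IH].
Qed.

Lemma hol_on_prod A (I : Type) (s : seq I) (P : pred I) (F : I -> V -> C) :
  (forall i, hol_on A (F i)) -> hol_on A (fun z => \prod_(i <- s | P i) F i z).
Proof.
move=> hF; elim: s => [|i s IH].
  by under eq_fun do rewrite big_nil; exact: hol_on_cst.
have -> : (fun z => \prod_(j <- i :: s | P j) F j z) = (fun z => if P i then
    F i z * \prod_(j <- s | P j) F j z else \prod_(j <- s | P j) F j z).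
  by apply/funext => z; rewrite big_cons.
case: (P i); last exact: IH.
by apply: hol_onM; [exact: hF|exact: IH].
Qed.

Lemma hol_on_line A g z w : hol_on A g ->
  forall a : C, A (z + a *: w) -> derivable (fun a : C => g (z + a *: w)) a 1.
Proof. by move=> hg a Aa; apply/derivable_lineE; exact: hg. Qed.

Lemma rball_line c r z w (a : C) : rnorm a * rnorm w + rnorm (z - c) < r ->
  rball c r (z + a *: w).
Proof.
move=> H; rewrite /rball /= addrAC (le_lt_trans _ H) // -rnormZ addrC.
exact: rnormD.
Qed.

(** On the line from [p] through [z] the function vanishes near the parameter 0, hence at the
    parameter 1. *)
Let ball_step g p r s : 0 < s -> hol_on (rball p r) g ->
  (forall z, rball p s z -> g z = 0) -> forall z, rball p r z -> g z = 0.
Proof.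
move=> s0 hg g0 z; rewrite /rball /= => zr.
have [zp|zp] := eqVneq z p; first by apply: g0; rewrite zp; exact: rball_center.
have n0 : 0 < rnorm (z - p) by rewrite rnorm_gt0 subr_eq0.
(* Halfway between 1 and the radius at which the line leaves the ball. *)
pose t := (1 + r / rnorm (z - p)) / 2.
have rn : 1 < r / rnorm (z - p) by rewrite ltr_pdivlMr // mul1r.
have t1 : 1 < t by rewrite /t; lra.
have tr : t * rnorm (z - p) < r.
  by rewrite -ltr_pdivlMr // /t; lra.
have hz : hol_on_disc (fun a : C => g (p + a *: (z - p))) t.
  move=> a at_; apply: (hol_on_line hg); apply: rball_line.
  by rewrite subrr rnorm0 addr0 (le_lt_trans _ tr) // ler_wpM2r // ltW.
have t0 : 0 < t by rewrite (lt_trans _ t1).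
have sn : 0 < s / rnorm (z - p) by rewrite divr_gt0.
have := @hol_zero_disc _ _ _ _ sn t0 hz _ 1; rewrite rnorm1 scale1r (addrC p) subrK.
apply=> // a an; apply: g0; apply: rball_line.
by rewrite subrr rnorm0 addr0 -ltr_pdivlMr.
Qed.

(** A chain of balls of common radius [k] leads from [z1] to the centre [c]. Consecutive centres on
    the segment are closer than [k], so vanishing passes from each ball to the next; the last one,
    centred at [c], reaches the whole ball. *)
Lemma identity_theorem g c r z1 s : 0 < s -> hol_on (rball c r) g -> rball c r z1 ->
  (forall z, rball z1 s z -> g z = 0) -> forall z, rball c r z -> g z = 0.
Proof.
move=> s0 hg z1r g0; pose k := r - rnorm (z1 - c).
have k0 : 0 < k by rewrite subr_gt0.
pose p (t : R) := c + t%:C *: (z1 - c).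
have sub t : 0 <= t <= 1 -> rball (p t) k `<=` rball c r.
  move=> /andP[t0 t1] z; rewrite /rball /= => zk.
  rewrite (le_lt_trans (rnorm_triangle _ (p t) _)) //.
  have : rnorm (p t - c) <= rnorm (z1 - c).
    rewrite /p (addrC c) addrK rnormZ rnorm_real ger0_norm //.
    by rewrite ler_piMl // rnorm_ge0.
  by move: zk; rewrite /k; lra.
have [n nP] : exists n : nat, rnorm (z1 - c) < k * n.+1%:R.
  have q0 : 0 <= rnorm (z1 - c) / k by rewrite divr_ge0 ?rnorm_ge0 // ltW.
  exists (Num.Def.truncn (rnorm (z1 - c) / k)).
  by rewrite mulrC -ltr_pdivrMr //; have /andP[] := truncn_itv q0.
pose tt (i : nat) : R := (n.+1 - i)%:R / n.+1%:R.
have tt01 i : 0 <= tt i <= 1.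
  by rewrite /tt divr_ge0 //= ler_pdivrMr // mul1r ler_nat leq_subr.
have main i : (i <= n.+1)%N -> forall z, rball (p (tt i)) k z -> g z = 0.
  elim: i => [_|i IH iN].
    have E : p (tt 0%N) = z1.
      by rewrite /p /tt subn0 divff ?pnatr_eq0 // scale1r (addrC c) subrK.
    rewrite E; apply: (ball_step s0) => //; apply: hol_onS hg.
    by have := sub _ (tt01 0%N); rewrite E.
  have dist : rnorm (p (tt i.+1) - p (tt i)) < k.
    rewrite /p opprD addrACA subrr add0r -scalerBl -rmorphB /= rnormZ rnorm_real.
    have -> : tt i.+1 - tt i = - n.+1%:R^-1.
      rewrite /tt -mulrBl -[(n.+1 - i)%N](@prednK) ?subn_gt0 // -subnS.
      by rewrite -natr1 opprD addrA subrr add0r mulN1r.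
    by rewrite normrN ger0_norm ?invr_ge0 // mulrC ltr_pdivrMr // mulrC.
  pose s' := k - rnorm (p (tt i.+1) - p (tt i)).
  have s'0 : 0 < s' by rewrite subr_gt0.
  apply: (ball_step s'0); first exact: (hol_onS (sub _ (tt01 i.+1)) hg).
  move=> z zs; apply: (IH (ltnW iN)); rewrite /rball /=.
  rewrite (le_lt_trans (rnorm_triangle _ (p (tt i.+1)) _)) //.
  by move: zs; rewrite /rball /= /s'; lra.
have E : p (tt n.+1) = c by rewrite /p /tt subnn mul0r scale0r addr0.
apply: (ball_step k0 hg); rewrite -E; exact: main.
Qed.

Lemma hol_dense_nonzero g c r z0 : hol_on (rball c r) g -> rball c r z0 -> g z0 != 0 ->
  forall z1 s, rball c r z1 -> 0 < s -> exists z, [/\ rball z1 s z, rball c r z & g z != 0].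
Proof.
move=> hg z0r gz0 z1 s z1r s0; apply: contrapT => H.
move: gz0; rewrite (@identity_theorem g c r z1 (Num.min s (r - rnorm (z1 - c)))) ?eqxx //.
  by rewrite lt_min s0 subr_gt0.
move=> z; rewrite /rball /= lt_min => /andP[zs zr].
apply/eqP/negPn/negP => gz; apply: H; exists z; split => //.
rewrite /rball /= (le_lt_trans (rnorm_triangle _ z1 _)) //; move: zr; lra.
Qed.

(** Suppose [f y] is nonzero and take [x] near [y] with [g x] nonzero. On the line through both
    points neither function is identically zero, so each is a power times a unit near [y], and their
    product is nonzero at a small parameter. Working on a line avoids any appeal to continuity. *)
Lemma hol_mul_eq0 f g c r : hol_on (rball c r) f -> hol_on (rball c r) g ->
  (forall z, rball c r z -> f z * g z = 0) -> (exists2 z, rball c r z & g z != 0) ->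
  forall z, rball c r z -> f z = 0.
Proof.
move=> hf hg fg [z0 z0r gz0] y yr; apply/eqP/negPn/negP => fy.
pose k := r - rnorm (y - c).
have k0 : 0 < k by rewrite subr_gt0.
(* A third of the distance to the boundary leaves room for parameters up to 2 on the line from [y]
   to [x]. *)
have k3 : 0 < k / 3 by rewrite divr_gt0.
have [x [xy xr gx]] := hol_dense_nonzero hg z0r gz0 yr k3.
have inb a : rnorm a <= 2 -> rball c r (y + a *: (x - y)).
  move=> a2; apply: rball_line; move: xy; rewrite /rball /= => xy.
  have : rnorm a * rnorm (x - y) <= 2 * (k / 3) by rewrite ler_pM ?rnorm_ge0 // ltW.
  by rewrite /k; move: k0; rewrite /k; lra.
have hF : hol_on_disc (fun a : C => f (y + a *: (x - y))) 2.
  by move=> a a2; apply: (hol_on_line hf); exact: inb.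
have hG : hol_on_disc (fun a : C => g (y + a *: (x - y))) 2.
  by move=> a a2; apply: (hol_on_line hg); exact: inb.
have two : 0 < 2 :> R by [].
have F0 : f (y + 0 *: (x - y)) != 0 by rewrite scale0r addr0.
have G1 : g (y + 1 *: (x - y)) != 0 by rewrite scale1r addrC subrK.
have n0 : rnorm (0 : C) < 2 by rewrite rnorm0.
have n1 : rnorm (1 : C) < 2 by rewrite rnorm1 ltr1n.
have [k1 [u [s1 [s10 s12 fu uP]]]] := hol_factor0 two hF n0 F0.
have [k2 [v [s2 [s20 s22 gv vP]]]] := hol_factor0 two hG n1 G1.
pose m := Num.min s1 s2; have m0 : 0 < m by rewrite lt_min s10.
have m1 : m <= s1 by rewrite ge_min lexx.
have m2 : m <= s2 by rewrite ge_min lexx orbT.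
pose t : C := (m / 2)%:C.
have tn : rnorm t = m / 2 by rewrite rnorm_real gtr0_norm // divr_gt0.
have t1 : rnorm t < s1 by rewrite tn; lra.
have t2 : rnorm t < s2 by rewrite tn; lra.
have t0 : t != 0 by rewrite -rnorm_gt0 tn divr_gt0.
have tin : rball c r (y + t *: (x - y)) by apply: inb; rewrite tn; lra.
have := fg _ tin; rewrite (fu _ t1) (gv _ t2) => /eqP.
have [u0 _] := uP _ t1; have [v0 _] := vP _ t2.
by rewrite !mulf_eq0 (negPf u0) (negPf v0) !expf_eq0 (negPf t0) !andbF.
Qed.

(** The first Taylor remainder on the line through [z] and [y], on a disc of radius [q] whose image
    stays within half the distance to the boundary. *)
Lemma hol_bounded_lipschitz g c r (A : R) z y : hol_on (rball c r) g ->
  (forall x, rball c r x -> rnorm (g x) <= A) -> rball c r z ->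
  4 * rnorm (y - z) <= r - rnorm (z - c) ->
  rnorm (g y - g z) <= 8 * A / (r - rnorm (z - c)) * rnorm (y - z).
Proof.
move=> hg gA zr yz; set k := r - rnorm (z - c) in yz *.
have k0 : 0 < k by rewrite subr_gt0.
have [->|ny] := eqVneq y z; first by rewrite !subrr !rnorm0 mulr0.
have n0 : 0 < rnorm (y - z) by rewrite rnorm_gt0 subr_eq0.
pose q := k / (2 * rnorm (y - z)).
have q2 : 2 <= q by rewrite ler_pdivlMr ?mulr_gt0 //; lra.
have q0 : 0 < q by lra.
have qn : q * rnorm (y - z) = k / 2 by rewrite /q; field; rewrite gt_eqF.
have inb a : rnorm a <= q -> rball c r (z + a *: (y - z)).
  move=> aq; apply: rball_line.
  have : rnorm a * rnorm (y - z) <= q * rnorm (y - z) by rewrite ler_pM2r.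
  by rewrite qn; move: k0; rewrite /k; lra.
have hF : hol_on_disc (fun a : C => g (z + a *: (y - z))) q.
  by move=> a aq; apply: (hol_on_line hg); exact: inb.
have gA' t : 0 <= t <= 2 * pi -> rnorm (g (z + (q%:C * expi t) *: (y - z))) <= A.
  by move=> _; apply: gA; apply: inb; rewrite rnorm_circle // ltW.
have n1 : rnorm (1 : C) < q by rewrite rnorm1; lra.
have := taylor_bound 1 n1 hF gA'; rewrite big_ord1 taylor_coef0 // expr1 rnorm1.
rewrite expr0 mulr1 scale0r addr0 scale1r (addrC z) subrK => /le_trans; apply.
have A0 : 0 <= A by apply: le_trans (gA _ zr); exact: rnorm_ge0.
have -> : 8 * A / k * rnorm (y - z) = 2 * A * (2 / q).
  by rewrite /q; field; rewrite !gt_eqF.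
rewrite -mulrA ler_wpM2l ?mulr_ge0 //.
have q1 : 0 < q - 1 by lra.
have -> : q / (q - 1) * (1 / q) = (q - 1)^-1 by field; rewrite !gt_eqF.
by rewrite ler_pdivlMr // mulrC ler_pdivrMr //; lra.
Qed.

Lemma hol_bounded_continuous g c r (A : R) z : hol_on (rball c r) g ->
  (forall x, rball c r x -> rnorm (g x) <= A) -> rball c r z ->
  {for z, continuous g}.
Proof.
move=> hg gA zr; have k0 : 0 < r - rnorm (z - c) by rewrite subr_gt0.
have A0 : 0 <= A by apply: le_trans (gA _ zr); exact: rnorm_ge0.
apply/continuous_rnormP => e e0.
have q0 : 0 <= 8 * A / (r - rnorm (z - c)) by rewrite divr_ge0 ?mulr_ge0 // ltW.
have [d d0 dP] := small_of_pos q0 e0.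
exists (Num.min d ((r - rnorm (z - c)) / 4)) => [|y]; first by rewrite lt_min d0 divr_gt0.
rewrite lt_min => /andP[yd yk].
apply: le_lt_trans (hol_bounded_lipschitz hg gA zr _) _; first by lra.
by apply: le_lt_trans dP; rewrite ler_wpM2l // ltW.
Qed.

(* Taylor's formula makes the difference quotients converge uniformly in [t]. *)
Lemma cint_derivable (F : V -> R -> C) (w e : V) (a b s A : R) : a <= b -> 0 < s ->
  (forall (z : C) t, rnorm z <= s -> derivable (fun z : C => F (w + z *: e) t) z 1) ->
  (forall (z : C) t, rnorm z <= s -> rnorm (F (w + z *: e) t) <= A) ->
  (forall (z : C) t, rnorm z <= s -> {for t, continuous (F (w + z *: e))}) ->
  derivable (fun v => cint (F v) a b) w e.
Proof.
move=> ab s0 dF bF cF.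
have A0 : 0 <= A.
  apply: le_trans (bF 0 0 _); first exact: rnorm_ge0.
  by rewrite rnorm0 ltW.
pose M := 4 * A / s ^+ 2.
have M0 : 0 <= M by rewrite divr_ge0 ?mulr_ge0 ?exprn_ge0 // ltW.
have sn0 : rnorm (0 : C) <= s by rewrite rnorm0 ltW.
have F0 t : F (w + 0 *: e) t = F w t by rewrite scale0r addr0.
pose phi t (z : C) := F (w + z *: e) t.
pose c1 t := taylor_coef (phi t) s 1.
have c1P t (z : C) : rnorm z <= s / 2 ->
    rnorm (phi t z - F w t - z * c1 t) <= M * rnorm z ^+ 2.
  move=> zs; have zs' : rnorm z < s by lra.
  have hp : hol_on_disc (phi t) s by move=> y; exact: dF.
  have bp th : 0 <= th <= 2 * pi -> rnorm (phi t (s%:C * expi th)) <= A.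
    by move=> _; apply: bF; rewrite rnorm_circle // ltW.
  have := taylor_bound 2 zs' hp bp.
  rewrite !big_ord_recl big_ord0 /= taylor_coef0 // {2}/phi F0 expr0 mulr1 expr1 addr0.
  rewrite opprD addrA (mulrC _ z) => /le_trans; apply.
  have ss : 0 < s - rnorm z by lra.
  have H : s / (s - rnorm z) <= 2 by rewrite ler_pdivrMr //; lra.
  have p : 0 <= (rnorm z / s) ^+ 2 by rewrite exprn_ge0 // divr_ge0 ?rnorm_ge0 // ltW.
  have -> : M * rnorm z ^+ 2 = 2 * A * 2 * (rnorm z / s) ^+ 2.
    by rewrite expr_div_n /M; ring.
  by rewrite ler_wpM2r // ler_wpM2l // mulr_ge0.
(* The coefficient [c1] is approximated, uniformly in [t], by difference quotients [Q] that are
   continuous in [t]. *)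
have cc1 t0 : {for t0, continuous c1}.
  apply/cvg_rnormP => d d0; have d4 : 0 < d / 4 by rewrite divr_gt0.
  have [x x0 xP] := small_of_pos M0 d4.
  pose y := Num.min x (s / 2); have y0 : 0 < y by rewrite lt_min x0 divr_gt0.
  have yx : y <= x by rewrite ge_min lexx.
  have ys : y <= s / 2 by rewrite ge_min lexx orbT.
  have yn : rnorm (y%:C : C) = y by rewrite rnorm_real gtr0_norm.
  have yc : (y%:C : C) != 0 by rewrite -rnorm_gt0 yn.
  pose Q t := (phi t y%:C - F w t) / y%:C.
  have QP t : rnorm (Q t - c1 t) <= d / 4.
    have -> : Q t - c1 t = (phi t y%:C - F w t - y%:C * c1 t) / y%:C.
      by rewrite /Q; field.
    rewrite rnormM rnormV yn ler_pdivrMr //.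
    apply: le_trans (c1P t _ _) _; first by rewrite yn.
    rewrite yn expr2 mulrA ler_pM2r // (le_trans _ (ltW xP)) //.
    by rewrite ler_wpM2l.
  have cQ : {for t0, continuous Q}.
    apply: (@continuousM _ _ (fun t => phi t y%:C - F w t) (fun=> (y%:C)^-1)).
      apply: (@continuousB _ _ _ (fun t => phi t y%:C) (fun t => F w t)).
        by apply: cF; rewrite yn; lra.
      by have := cF 0 t0 sn0; rewrite scale0r addr0.
    exact: cst_continuous.
  move/cvg_rnormP : cQ => /(_ _ d4); apply: filterS => t Qt.
  have H1 := QP t; have H2 := QP t0; rewrite rnormC in H1.
  have := rnorm_triangle (c1 t) (Q t) (c1 t0).
  have := rnorm_triangle (Q t) (Q t0) (c1 t0); lra.
apply/derivable_rnormP; exists (cint c1 a b) => d d0.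
pose K := 2 * M * (b - a).
have K0 : 0 <= K by apply: mulr_ge0; [exact: mulr_ge0|rewrite subr_ge0].
have [x x0 xP] := small_of_pos K0 d0.
exists (Num.min x (s / 2)) => [|h]; first by rewrite lt_min x0 divr_gt0.
rewrite lt_min => /andP[hx hs].
have ch : continuous_on_seg (F (h *: e + w)) a b.
  by move=> t _; rewrite addrC; apply: cF; lra.
have c0 : continuous_on_seg (F w) a b.
  by move=> t _; have := cF 0 t sn0; rewrite scale0r addr0.
have cc : continuous_on_seg c1 a b by move=> t _; exact: cc1.
have chc : continuous_on_seg (fun t => h * c1 t) a b.
  move=> t tt; apply: (@continuousM _ _ (fun=> h) c1); last exact: cc.
  exact: cst_continuous.
have chb : continuous_on_seg (fun t => F (h *: e + w) t - F w t) a b.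
  by move=> t tt; apply: (@continuousB _ _ _ (F _) (F _)); [exact: ch|exact: c0].
have E : cint (F (h *: e + w)) a b - cint (F w) a b - h *: cint c1 a b =
    cint (fun t => F (h *: e + w) t - F w t - h * c1 t) a b.
  by rewrite (cintB chb chc) (cintB ch c0) (cintZ _ cc).
have cE : continuous_on_seg (fun t => F (h *: e + w) t - F w t - h * c1 t) a b.
  by move=> t tt; apply: (@continuousB _ _ _ (fun t => F (h *: e + w) t - F w t)
    (fun t => h * c1 t)); [exact: chb|exact: chc].
have bE t : a <= t <= b ->
    rnorm (F (h *: e + w) t - F w t - h * c1 t) <= M * rnorm h ^+ 2.
  by move=> _; rewrite (addrC _ w); apply: c1P; exact: ltW.
rewrite E; apply: le_trans (cint_le ab cE bE) _.
have -> : 2 * (M * rnorm h ^+ 2) * (b - a) = K * rnorm h * rnorm h by rewrite /K; ring.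
rewrite ler_wpM2r ?rnorm_ge0 // (le_trans _ (ltW xP)) // ler_wpM2l // ltW //.
Qed.

End Normed.
End SeveralVariables.

(** * Invariant quotients near the origin *)

Section LeadingTerm.
Variable R : realType.
Local Notation C := R[i].
Implicit Types (f g : C -> C) (a b z : C).

Definition bigO0 f d := exists K : R, exists2 s : R, 0 < s &
  0 <= K /\ forall z, rnorm z < s -> rnorm (f z) <= K * rnorm z ^+ d.

(** The coefficient [a] may be 0, so that one degree [d] can serve all lines through the origin at
    once. *)
Definition leading f d a := bigO0 (fun z => f z - z ^+ d * a) d.+1.

Lemma bigO0D f g d : bigO0 f d -> bigO0 g d -> bigO0 (fun z => f z + g z) d.
Proof.
move=> [K [s s0 [K0 fK]]] [L [t t0 [L0 gL]]]; exists (K + L), (Num.min s t).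
  by rewrite lt_min s0.
split=> [|z]; first exact: addr_ge0.
rewrite lt_min => /andP[zs zt]; rewrite (le_trans (rnormD _ _)) // mulrDl.
by rewrite lerD ?fK ?gL.
Qed.

Lemma bigO0Z a f d : bigO0 f d -> bigO0 (fun z => a * f z) d.
Proof.
move=> [K [s s0 [K0 fK]]]; exists (rnorm a * K), s => //; split=> [|z zs].
  by rewrite mulr_ge0 // rnorm_ge0.
by rewrite rnormM -mulrA ler_wpM2l ?rnorm_ge0 // fK.
Qed.

Lemma bigO0_sum (I : Type) (r : seq I) (F : I -> C -> C) d :
  (forall i, bigO0 (F i) d) -> bigO0 (fun z => \sum_(i <- r) F i z) d.
Proof.
move=> hF; elim: r => [|i r IH].
  exists 0, 1 => //; split => // z _; rewrite big_nil rnorm0 mul0r //.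
have -> : (fun z => \sum_(j <- i :: r) F j z) = (fun z => F i z + \sum_(j <- r) F j z).
  by apply/funext => z; rewrite big_cons.
exact: bigO0D.
Qed.

Lemma bigO0M f g d e : bigO0 f d -> bigO0 g e -> bigO0 (fun z => f z * g z) (d + e).
Proof.
move=> [K [s s0 [K0 fK]]] [L [t t0 [L0 gL]]]; exists (K * L), (Num.min s t).
  by rewrite lt_min s0.
split=> [|z]; first exact: mulr_ge0.
rewrite lt_min => /andP[zs zt]; rewrite rnormM exprD mulrACA.
by rewrite ler_pM ?rnorm_ge0 ?fK ?gL.
Qed.

Lemma bigO0_monomial d a : bigO0 (fun z => z ^+ d * a) d.
Proof.
exists (rnorm a), 1 => //; split=> [|z _]; first exact: rnorm_ge0.
by rewrite rnormM rnormX mulrC.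
Qed.

Lemma bigO0_eq f g d : (exists2 s : R, 0 < s & forall z, rnorm z < s -> f z = g z) ->
  bigO0 f d -> bigO0 g d.
Proof.
move=> [s s0 fg] [K [t t0 [K0 fK]]]; exists K, (Num.min s t); first by rewrite lt_min s0.
split => // z; rewrite lt_min => /andP[zs zt]; rewrite -fg //; exact: fK.
Qed.

Lemma bigO0_const d a : bigO0 (fun z => z ^+ d * a) d.+1 -> a = 0.
Proof.
move=> [K [s s0 [K0 aK]]]; apply: rnorm_eps => e e0; rewrite subr0.
have [x x0 xe] := small_of_pos K0 e0.
pose y := Num.min x (s / 2); have y0 : 0 < y by rewrite lt_min x0 divr_gt0.
have yx : y <= x by rewrite ge_min lexx.
have ys : y <= s / 2 by rewrite ge_min lexx orbT.
have yn : rnorm (y%:C : C) = y by rewrite rnorm_real gtr0_norm.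
have := aK y%:C; rewrite yn => /(_ _)/wrap[]; first by lra.
rewrite rnormM rnormX yn exprS mulrA [leRHS]mulrC ler_pM2l ?exprn_gt0 // => /le_trans; apply.
by rewrite (le_trans _ (ltW xe)) // ler_wpM2l.
Qed.

Lemma leading_unique f d a b : leading f d a -> leading f d b -> a = b.
Proof.
move=> fa fb; apply/eqP; rewrite -subr_eq0; apply/eqP/(@bigO0_const d).
apply: bigO0_eq (bigO0D fb (bigO0Z (-1) fa)); exists 1 => // z _; ring.
Qed.

Lemma leadingB f g d a b : leading f d a -> leading g d b ->
  leading (fun z => f z - g z) d (a - b).
Proof.
move=> fa gb; apply: bigO0_eq (bigO0D fa (bigO0Z (-1) gb)); exists 1 => // z _; ring.
Qed.

Lemma leadingZ c f d a : leading f d a -> leading (fun z => c * f z) d (c * a).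
Proof. by move=> fa; apply: bigO0_eq (bigO0Z c fa); exists 1 => // z _; ring. Qed.

(** The difference of the products splits into the product of the two errors and two mixed terms. *)
Lemma leadingM f g d e a b : leading f d a -> leading g e b ->
  leading (fun z => f z * g z) (d + e) (a * b).
Proof.
move=> fa gb.
have H1 := bigO0M fa gb; have H2 := bigO0M fa (bigO0_monomial e b).
have H3 := bigO0M (bigO0_monomial d a) gb.
have E : (d.+1 + e.+1 = (d + e).+2)%N by rewrite addSn addnS.
(* The product of the errors has order [(d + e).+2]; restricting to the unit disc lowers the
   exponent by one. *)
have H1' : bigO0 (fun z => (f z - z ^+ d * a) * (g z - z ^+ e * b)) (d + e).+1.
  move: H1; rewrite E => -[K [s s0 [K0 sK]]]; exists K, (Num.min s 1).
    by rewrite lt_min s0 ltr01.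
  split => // z; rewrite lt_min => /andP[zs z1].
  apply: le_trans (sK _ zs) _; rewrite ler_wpM2l // exprS ler_piMl ?exprn_ge0 ?rnorm_ge0 //.
  exact: ltW.
move: H2 H3; rewrite addSn addnS => H2 H3.
apply: bigO0_eq (bigO0D H1' (bigO0D H2 H3)); exists 1 => // z _.
by rewrite exprD; ring.
Qed.

Lemma lagrange_nodes d : exists L : 'I_d.+1 -> {poly C},
  forall p : {poly C}, (size p <= d.+1)%N ->
  forall x, p.[x] = \sum_(i < d.+1) p.[i%:R] * (L i).[x].
Proof.
have inj : injective (fun i : nat => i%:R : C).
  by move=> i j /eqP; rewrite eqr_nat => /eqP.
exists (fun i => tnth (qpoly.lagrange d.+1 (fun i : nat => i%:R : C)) i) => p sp x.
rewrite {1}(qpoly.lagrange_gen (ltn0Sn d) inj sp) horner_sum.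
by apply: eq_bigr => i _; rewrite hornerM hornerC.
Qed.

Lemma poly_nonroot (p : {poly C}) : p != 0 -> exists x : C, p.[x] != 0.
Proof.
move=> p0; apply: contrapT => /forallNP H.
move: p0; rewrite (@roots_geq_poly_eq0 _ p [seq i%:R | i <- iota 0 (size p)]) ?eqxx //.
- by apply/allP => x _; apply/negPn/negP/H.
- rewrite map_inj_uniq ?iota_uniq // => i j /eqP; rewrite eqr_nat => /eqP //.
- by rewrite size_map size_iota.
Qed.

End LeadingTerm.

(** * The lowest homogeneous part *)

Section HomogeneousPart.
Variables (R : realType) (V : normedModType R[i]).
Local Notation C := R[i].
Implicit Types (P G : V -> C) (x y z : V).

(** Along each line [G] is the polynomial interpolating its values at 0, ..., [d], with one family
    [L] for all lines. Being a linear relation between values, the condition can be checked by a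
    limit without controlling coefficients. *)
Definition polynomial_on_lines d G := exists L : 'I_d.+1 -> {poly C},
  forall x y (t : C),
    G (x + t *: y) = \sum_(i < d.+1) G (x + i%:R *: y) * (L i).[t].

(* On a line, [G] is a pointwise limit of polynomials of degree at most [d], so it
   is given by Lagrange interpolation at [d.+1] points. *)
Lemma lowest_part P (e A : R) : 0 < e -> hol_on (rball 0 e) P ->
  (forall z, rball 0 e z -> rnorm (P z) <= A) -> (exists2 z, rball 0 e z & P z != 0) ->
  exists d G, [/\ forall z, leading (fun t => P (t *: z)) d (G z),
    exists z, G z != 0 & polynomial_on_lines d G].
Proof.
move=> e0 hP bP [z0 z0e Pz0].
have A0 : 0 <= A by apply: le_trans (bP _ z0e); exact: rnorm_ge0.
have inb (t : C) z : rnorm t * rnorm z < e -> rball 0 e (t *: z).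
  by rewrite /rball /= subr0 rnormZ.
pose r z := e / (2 * (rnorm z + 1)).
have rz0 z : 0 < r z by rewrite divr_gt0 // mulr_gt0 // ltr_wpDl // rnorm_ge0.
have rz z : r z * rnorm z < e.
  have n0 := rnorm_ge0 z.
  rewrite /r mulrAC ltr_pdivrMr ?mulr_gt0 ?ltr_wpDl // ltr_pM2l //; lra.
have hr z : hol_on_disc (fun t : C => P (t *: z)) (r z).
  move=> t tr; have := @hol_on_line _ _ _ P 0 z hP t; rewrite !add0r.
  have -> : (fun a : C => P (0 + a *: z)) = (fun a : C => P (a *: z)).
    by apply/funext => a; rewrite add0r.
  apply; apply: inb; apply: le_lt_trans (rz z); rewrite ler_wpM2r ?rnorm_ge0 //.
pose T z (cA : (nat -> C) * R) := 0 < cA.2 /\ forall N t, rnorm t < r z ->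
    rnorm (P (t *: z) - \sum_(n < N) cA.1 n * t ^+ n) <=
    cA.2 * (r z / (r z - rnorm t)) * (rnorm t / r z) ^+ N.
have /choice[cc ccP] : forall z, exists cA, T z cA.
  by move=> z; have [c [B B0 BP]] := taylor_expansion (rz0 z) (hr z); exists (c, B).
pose c z n := (cc z).1 n.
(* If every coefficient on every line vanished, [P] would be zero along the line through [z0]. *)
have ex : exists n, `[< exists z, c z n != 0 >].
  apply: contrapT => /forallNP H.
  have c0 z n : c z n = 0.
    by apply/eqP/negPn/negP => cz; apply: (H n); apply/asboolP; exists z.
  have [B0 BP] := ccP z0.
  have loc (t : C) : rnorm t < r z0 -> P (t *: z0) = 0.
    move=> tr; apply/eqP/negPn/negP => Pt.
    have [k [ck _]] := hol_nonzero_coef (rz0 z0) B0 BP tr Pt.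
    by move: ck; rewrite -/(c z0 k) c0 eqxx.
  have [z00|z0n] := eqVneq z0 0.
    move: Pz0; have := loc 0; rewrite scale0r z00 rnorm0 => -> //; last first.
    by rewrite eqxx.
  have n0 : 0 < rnorm z0 by rewrite rnorm_gt0.
  have z0e' : rnorm z0 < e by move: z0e; rewrite /rball /= subr0.
  pose q := (1 + e / rnorm z0) / 2.
  have en : 1 < e / rnorm z0 by rewrite ltr_pdivlMr // mul1r.
  have q1 : 1 < q by rewrite /q; lra.
  have qe : q * rnorm z0 < e by rewrite -ltr_pdivlMr // /q; lra.
  have hq : hol_on_disc (fun t : C => P (t *: z0)) q.
    move=> t tq; have := @hol_on_line _ _ _ P 0 z0 hP t; rewrite !add0r.
    have -> : (fun a : C => P (0 + a *: z0)) = (fun a : C => P (a *: z0)).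
      by apply/funext => a; rewrite add0r.
    apply; apply: inb; apply: le_lt_trans qe; rewrite ler_wpM2r ?rnorm_ge0 //.
  have q0 : 0 < q by lra.
  have := hol_zero_disc (rz0 z0) q0 hq loc (z := 1).
  by rewrite rnorm1 scale1r => /(_ q1) Pz; move: Pz0; rewrite Pz eqxx.
pose d := ex_minn ex.
have [dz dmin] : (exists z, c z d != 0) /\ forall z n, (n < d)%N -> c z n = 0.
  rewrite /d; case: ex_minnP => k /asboolP kz kmin; split => // z n nk.
  apply/eqP/negPn/negP => cz; suff : (k <= n)%N by rewrite leqNgt nk.
  by apply: kmin; apply/asboolP; exists z.
have lead z : leading (fun t => P (t *: z)) d (c z d).
  have [B0 BP] := ccP z; have r0 := rz0 z.
  exists (2 * (cc z).2 / r z ^+ d.+1), (r z / 2); first by rewrite divr_gt0.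
  split=> [|t tr]; first by rewrite divr_ge0 ?mulr_ge0 ?exprn_ge0 // ltW.
  have tr' : rnorm t < r z by lra.
  have := BP d.+1 t tr'; rewrite big_ord_recr /= big1 ?add0r => [|i _]; last first.
    by rewrite -/(c z i) dmin // mul0r.
  rewrite (mulrC _ (t ^+ d)) => /le_trans; apply.
  by apply: taylor_bound_half => //; exact: ltW.
exists d, (fun z => c z d); split => //.
have [L LP] := lagrange_nodes R d; exists L => x y t.
pose rho := e / (4 * (rnorm y + 1)).
have y0 := rnorm_ge0 y; have x0 := rnorm_ge0 x.
have rho0 : 0 < rho by rewrite divr_gt0 // mulr_gt0 // ltr_wpDl.
have rhoy : rho * rnorm y <= e / 4.
  rewrite /rho; have -> : e / (4 * (rnorm y + 1)) * rnorm y =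
     e / 4 * (rnorm y / (rnorm y + 1)) by field; rewrite gt_eqF // ltr_wpDl.
  by rewrite ler_piMr ?divr_ge0 ?(ltW e0) // ler_pdivrMr ?ltr_wpDl // mul1r lerDl.
pose s := e / (4 * (rnorm x + 1)).
have s0 : 0 < s by rewrite divr_gt0 // mulr_gt0 // ltr_wpDl.
have sx (u : C) : rnorm u < s -> rnorm u * rnorm x <= e / 4.
  move=> us; apply: le_trans (_ : s * rnorm x <= _); first by rewrite ler_wpM2r // ltW.
  rewrite /s; have -> : e / (4 * (rnorm x + 1)) * rnorm x =
     e / 4 * (rnorm x / (rnorm x + 1)) by field; rewrite gt_eqF // ltr_wpDl.
  by rewrite ler_piMr ?divr_ge0 ?(ltW e0) // ler_pdivrMr ?ltr_wpDl // mul1r lerDl.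
pose psi (u : C) (v : C) := P (u *: x + v *: y).
have inb2 u v : rnorm u < s -> rnorm v <= rho -> rball 0 e (u *: x + v *: y).
  move=> us vr; apply: rball_line; rewrite subr0 rnormZ.
  have : rnorm v * rnorm y <= rho * rnorm y by rewrite ler_wpM2r.
  by have := sx u us; move: rhoy e0; lra.
have hpsi u : rnorm u < s -> hol_on_disc (psi u) rho.
  by move=> us v vr; apply: (hol_on_line hP); exact: inb2.
(* The value of [p u] at [w] is the Taylor polynomial of [psi u] at [u * w], so it differs from
   [P (u *: (x + w *: y))] by a term of order [d.+1] in [u]. *)
pose p u : {poly C} := \poly_(k < d.+1) (taylor_coef (psi u) rho k * u ^+ k).
have approx (w : C) : bigO0 (fun u => P (u *: (x + w *: y)) - (p u).[w]) d.+1.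
  exists (4 * A / rho ^+ d.+1 * rnorm w ^+ d.+1),
    (Num.min s (rho / (2 * (rnorm w + 1)))).
    by rewrite lt_min s0 divr_gt0 // mulr_gt0 // ltr_wpDl // rnorm_ge0.
  have w0 := rnorm_ge0 w.
  split=> [|u]; first by rewrite mulr_ge0 ?divr_ge0 ?mulr_ge0 ?exprn_ge0 // ltW.
  rewrite lt_min => /andP[us]; rewrite ltr_pdivlMr ?mulr_gt0 ?ltr_wpDl // => uw.
  have uw2 : rnorm (u * w) <= rho / 2.
    by rewrite rnormM; have := rnorm_ge0 u; move: uw; nra.
  have uwr : rnorm (u * w) < rho by lra.
  have bpsi th : 0 <= th <= 2 * pi -> rnorm (psi u (rho%:C * expi th)) <= A.
    by move=> _; apply: bP; apply: inb2 => //; rewrite rnorm_circle // ltW.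
  have := taylor_bound d.+1 uwr (hpsi u us) bpsi.
  have -> : psi u (u * w) = P (u *: (x + w *: y)) by rewrite /psi scalerDr scalerA.
  have -> : \sum_(n < d.+1) taylor_coef (psi u) rho n * (u * w) ^+ n = (p u).[w].
    by rewrite /p horner_poly; apply: eq_bigr => i _; rewrite exprMn mulrA.
  move=> /le_trans; apply; rewrite -[leRHS]mulrA -exprMn -rnormM.
  have H : rho / (rho - rnorm (u * w)) <= 2.
    by rewrite ler_pdivrMr; lra.
  have pp : 0 <= (rnorm (u * w) / rho) ^+ d.+1.
    by rewrite exprn_ge0 // divr_ge0 ?rnorm_ge0 // ltW.
  have -> : 4 * A / rho ^+ d.+1 * rnorm (w * u) ^+ d.+1 =
      2 * A * 2 * (rnorm (u * w) / rho) ^+ d.+1.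
    by rewrite (expr_div_n (rnorm (u * w))) (mulrC u w); ring.
  by rewrite ler_wpM2r // ler_wpM2l // mulr_ge0.
have size_p u : (size (p u) <= d.+1)%N by exact: size_poly.
apply/eqP; rewrite -subr_eq0; apply/eqP/(@bigO0_const _ d).
pose g w := bigO0D (approx w) (bigO0Z (-1) (lead (x + w *: y))).
have gs : bigO0 (fun u => \sum_(i < d.+1) (L i).[t] *
    ((P (u *: (x + i%:R *: y)) - (p u).[i%:R]) +
    -1 * (P (u *: (x + i%:R *: y)) - u ^+ d * c (x + i%:R *: y) d))) d.+1.
  by apply: bigO0_sum => i; apply: bigO0Z; exact: (g i%:R).
apply: bigO0_eq (bigO0D (g t) (bigO0Z (-1) gs)); exists 1 => // u _.
have -> : \sum_(i < d.+1) (L i).[t] *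
    ((P (u *: (x + i%:R *: y)) - (p u).[i%:R]) +
    -1 * (P (u *: (x + i%:R *: y)) - u ^+ d * c (x + i%:R *: y) d)) =
    u ^+ d * (\sum_(i < d.+1) c (x + i%:R *: y) d * (L i).[t]) - (p u).[t].
  rewrite (LP (p u) (size_p u) t) mulr_sumr -sumrB; apply: eq_bigr => i _; ring.
ring.
Qed.

End HomogeneousPart.

(** * Polynomial functions as sums of monomials *)

Section Monomials.
Variables (R : realType) (m : nat).
Local Notation C := R[i].
Local Notation V := 'rV[C]_m.
Local Notation expo := {ffun 'I_m -> nat}.
Implicit Types (G : V -> C) (z : V) (a b : expo).

Definition mono z a : C := \prod_j z 0 j ^+ a j.

Definition polyfun G := exists s : seq (C * expo),
  forall z, G z = \sum_(x <- s) x.1 * mono z x.2.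

Lemma polyfun_cst (c : C) : polyfun (fun=> c).
Proof.
exists [:: (c, [ffun=> 0%N])] => z; rewrite big_seq1 /mono /= big1 ?mulr1 // => j _.
by rewrite ffunE.
Qed.

Lemma polyfunZ (c : C) G : polyfun G -> polyfun (fun z => c * G z).
Proof.
move=> [s sG]; exists [seq (c * x.1, x.2) | x <- s] => z.
by rewrite big_map sG mulr_sumr; apply: eq_bigr => x _; rewrite mulrA.
Qed.

Lemma polyfun_coord (k : 'I_m) n G : polyfun G -> polyfun (fun z => z 0 k ^+ n * G z).
Proof.
move=> [s sG].
exists (map (fun x : C * expo => (x.1, [ffun j => (x.2 j + (j == k) * n)%N] : expo)) s) => z.
rewrite big_map sG mulr_sumr; apply: eq_bigr => x _ /=; rewrite mulrCA; congr (_ * _).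
rewrite /mono [in RHS](bigD1 k) //= [in LHS](bigD1 k) //= ffunE eqxx mul1n.
rewrite exprD mulrA (mulrC (z 0 k ^+ n)); congr (_ * _); apply: eq_bigr => j jk.
by rewrite ffunE (negPf jk) addn0.
Qed.

Lemma polyfun_sum (I : Type) (r : seq I) (F : I -> V -> C) :
  (forall i, polyfun (F i)) -> polyfun (fun z => \sum_(i <- r) F i z).
Proof.
move=> hF; elim: r => [|i r [s sP]].
  by exists [::] => z; rewrite !big_nil.
have [t tP] := hF i; exists (t ++ s) => z.
by rewrite big_cons big_cat /= -sP -tP.
Qed.

Lemma polyfun_horner (k : 'I_m) (p : {poly C}) G : polyfun G ->
  polyfun (fun z => G z * p.[z 0 k]).
Proof.
move=> hG; have -> : (fun z : V => G z * p.[z 0 k]) =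
    (fun z => \sum_(i < size p) p`_i * (z 0 k ^+ i * G z)).
  apply/funext => z; rewrite horner_coef mulr_sumr; apply: eq_bigr => i _; ring.
by apply: polyfun_sum => i; apply: polyfunZ; exact: polyfun_coord.
Qed.

Definition set_coord (k : 'I_m) (c : C) z : V := \row_j (if j == k then c else z 0 j).

(** Induction on the number of coordinates on which the function depends: interpolation in the last
    one expresses it by functions of the preceding coordinates, obtained by freezing the last at the
    nodes. *)
Lemma polynomial_on_lines_polyfun d G : polynomial_on_lines d G -> polyfun G.
Proof.
move=> [L LP].
suff H k : (k <= m)%N -> forall G,
    (forall x y (t : C), G (x + t *: y) = \sum_(i < d.+1) G (x + i%:R *: y) * (L i).[t]) ->
    (forall z z' : V, (forall j : 'I_m, (j < k)%N -> z 0 j = z' 0 j) -> G z = G z') ->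
    polyfun G.
  apply: (H m (leqnn m)) => // z z' zz'; congr G; apply/rowP => j; exact: zz'.
elim: k => [_ H _ Hz|k IH km H HL Hz].
  have -> : H = (fun=> H 0) by apply/funext => z; apply: Hz.
  exact: polyfun_cst.
pose k0 := Ordinal km.
have E z : H z = \sum_(i < d.+1) H (set_coord k0 i%:R z) * (L i).[z 0 k0].
  have Ez (c : C) : set_coord k0 0 z + c *: delta_mx 0 k0 = set_coord k0 c z.
    apply/rowP => j; rewrite !mxE eqxx /=; case: (j == k0) => /=.
      by rewrite mulr1 add0r.
    by rewrite mulr0 addr0.
  have zE : set_coord k0 (z 0 k0) z = z.
    by apply/rowP => j; rewrite !mxE; case: eqP => [->|].
  rewrite -{1}zE -Ez HL; apply: eq_bigr => i _; by rewrite Ez.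
have -> : H = (fun z => \sum_(i < d.+1) H (set_coord k0 i%:R z) * (L i).[z 0 k0]).
  exact/funext.
apply: (@polyfun_sum _ _ (fun i : 'I_d.+1 => fun z => H (set_coord k0 i%:R z) * (L i).[z 0 k0])) => i.
apply: (@polyfun_horner k0 (L i) (fun z => H (set_coord k0 i%:R z))).
apply: (IH (ltnW km)).
- move=> x y t.
  have SE (c : C) : set_coord k0 i%:R (x + c *: y) =
      set_coord k0 i%:R x + c *: set_coord k0 0 y.
    by apply/rowP => j; rewrite !mxE; case: eqP => // _; rewrite mulr0 addr0.
  by rewrite SE HL; apply: eq_bigr => l _; rewrite SE.
- move=> z z' zz'; apply: Hz => j jk; rewrite !mxE; case: eqP => // /eqP jk0.
  apply: zz'; move: jk; rewrite ltnS leq_eqVlt => /orP[/eqP jk|//].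
  by move: jk0; rewrite -val_eqE /= jk eqxx.
Qed.

(** Collects equal exponents, so that two polynomial functions can be written over one
    duplicate-free list. *)
Lemma polyfun_uniq (l : seq (C * expo)) (s : seq expo) z : uniq s ->
  {subset [seq x.2 | x <- l] <= s} ->
  \sum_(x <- l) x.1 * mono z x.2 = \sum_(a <- s) (\sum_(x <- l | x.2 == a) x.1) * mono z a.
Proof.
move=> us ls; under [RHS]eq_bigr do rewrite mulr_suml big_mkcond /=.
rewrite exchange_big /=; apply: eq_big_seq => x xl.
rewrite (bigD1_seq x.2) ?us ?ls ?map_f //= eqxx big1 ?addr0 // => a ax.
by rewrite eq_sym (negPf ax).
Qed.

End Monomials.

(** * Characters of [h] and proportionality of lowest parts *)

Section Rigidity.
Variables (R : realType) (m : nat) (h : {vspace 'rV[R[i]]_m}).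
Local Notation C := R[i].
Local Notation V := 'rV[C]_m.
Local Notation expo := {ffun 'I_m -> nat}.
Hypothesis hirr : no_rational_annihilator h.

Definition chr (v : V) (a : expo) : C := mono (texp v) a.

Lemma chrE v a : chr v a = cexp ((0 +i* (pi *+ 2)) * \sum_j (a j)%:R * v 0 j).
Proof.
rewrite /chr /mono.
have cexpX (x : C) n : cexp x ^+ n = cexp (n%:R * x).
  elim: n => [|n IH]; first by rewrite mul0r cexp0.
  by rewrite exprS IH -cexpD -natr1 mulrDl mul1r addrC.
have cexp_sum (I : Type) (r : seq I) (F : I -> C) :
    cexp (\sum_(i <- r) F i) = \prod_(i <- r) cexp (F i).
  by elim/big_rec2 : _ => [|i x y _ <-]; rewrite ?cexp0 ?cexpD.
rewrite mulr_sumr cexp_sum; apply: eq_bigr => j _.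
by rewrite mxE cexpX mulrCA.
Qed.

Lemma chrD v w a : chr (v + w) a = chr v a * chr w a.
Proof.
rewrite !chrE -cexpD -mulrDr -big_split /=; congr (cexp (_ * _)).
by apply: eq_bigr => j _; rewrite mxE mulrDr.
Qed.

Lemma mono_tact (t z : V) a : mono (tact t z) a = mono t a * mono z a.
Proof.
by rewrite /mono -big_split /=; apply: eq_bigr => j _; rewrite mxE exprMn.
Qed.

(** The quotient of the two characters is the exponential of a complex linear form, nonzero on [h]
    since its coefficients [u] are integral and nonzero. As [h] is a complex subspace, a vector can
    be rescaled to give this form a small positive real value, whose exponential exceeds 1. *)
Lemma chr_separate a b (d : R) : 0 < d -> a != b ->
  exists v, [/\ v \in h, rnorm v < d & chr v a != chr v b].
Proof.
move=> d0 ab.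
pose u : 'rV[int]_m := \row_j ((a j)%:Z - (b j)%:Z).
have u0 : u != 0.
  apply: contra ab => /eqP u0; apply/eqP/ffunP => j.
  have /rowP/(_ j) := u0; rewrite !mxE => /eqP; rewrite subr_eq0 => /eqP.
  by move=> [].
have [x xP] : exists x, re_proj h x /\ \sum_j (u 0 j)%:~R * x 0 j != 0.
  apply: contrapT => /forallNP H; case/eqP : u0; apply: hirr => x xh.
  apply/eqP/negPn/negP => xn; exact: (H x).
case: xP => -[v /= vh <-] vn.
pose S (w : V) : C := \sum_j (u 0 j)%:~R * w 0 j.
have Sv : S v != 0.
  apply: contra vn => /eqP Sv; apply/eqP.
  have -> : \sum_j (u 0 j)%:~R * map_mx (@complex.Re R) v 0 j = complex.Re (S v).
    rewrite /S raddf_sum /=; apply: eq_bigr => j _; rewrite mxE.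
    rewrite !mxE; move: ((a j)%:Z - (b j)%:Z) => n.
    rewrite -(rmorph_int (real_complex R)).
    by case: (v 0 j) => re im /=; rewrite mul0r subr0.
  by rewrite Sv.
have Sab w : chr w a = chr w b * cexp ((0 +i* (pi *+ 2)) * S w).
  rewrite !chrE -cexpD -mulrDr; congr (cexp (_ * _)).
  rewrite /S -big_split /=; apply: eq_bigr => j _; rewrite mxE -mulrDl; congr (_ * _).
  by rewrite rmorphB /= addrC subrK.
(* Scaling by [q] normalises the exponent to 1; the factor [y] then makes the vector short. *)
pose q : C := ((0 +i* (pi *+ 2)) * S v)^-1.
have p0 : (0 +i* (pi *+ 2) : C) != 0.
  by rewrite eq_complex /= eqxx /= mulrn_eq0 /= gt_eqF // pi_gt0.
have [y y0 yP] := small_of_pos (rnorm_ge0 (q *: v)) d0.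
pose w := (y%:C * q) *: v.
exists w; split.
- by rewrite memvZ.
- by rewrite /w -scalerA rnormZ rnorm_real gtr0_norm // mulrC.
- have Sw : S w = (y%:C * q) * S v.
    rewrite /S mulr_sumr; apply: eq_bigr => j _.
    have -> : w 0 j = (y%:C * q) * v 0 j by rewrite mxE.
    by rewrite mulrCA.
  rewrite Sab Sw; have -> : (0 +i* (pi *+ 2)) * (y%:C * q * S v) = y%:C :> C.
    by rewrite /q; field; rewrite p0 Sv.
  have cb : chr w b != 0 by rewrite chrE cexp_neq0.
  rewrite -{2}[chr w b]mulr1 (inj_eq (mulfI cb)).
  apply/eqP => /(congr1 rnorm); rewrite rnorm_cexp rnorm1 /=.
  by apply/eqP; rewrite gt_eqF // expR_gt1.
Qed.

(** Artin's argument on a neighbourhood of 0: subtract [chr w b] times the relation from its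
    translate by [w] to eliminate [b]. The translation uses up half of the radius. *)
Lemma chr_independent (s : seq expo) (c : expo -> C) (d : R) : 0 < d -> uniq s ->
  (forall v, v \in h -> rnorm v < d -> \sum_(a <- s) c a * chr v a = 0) ->
  forall a, a \in s -> c a = 0.
Proof.
elim: s c d => [|b s IH] c d d0 // /andP[bs us] H.
have d2 : 0 < d / 2 by rewrite divr_gt0.
have cs a : a \in s -> c a = 0.
  move=> sa; have ab : a != b by apply: contraNneq bs => <-.
  have [w [wh wd wab]] := chr_separate d2 ab.
  have := IH (fun a => c a * (chr w a - chr w b)) _ d2 us _ a sa.
  move=> /(_ _)/wrap[v vh vd|/eqP]; last first.
    by rewrite mulf_eq0 subr_eq0 (negPf wab) orbF => /eqP.
  have H1 := H (v + w) (memvD vh wh) (le_lt_trans (rnormD _ _) _).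
  have {}H1 := H1 _; have vwd : rnorm v + rnorm w < d by lra.
  have {H1} := H1 vwd; have H2 := H v vh; have {H2} := H2 (lt_trans vd _).
  have dd : d / 2 < d by lra.
  move=> /(_ dd); rewrite !big_cons => H2.
  have -> : \sum_(a <- s) c a * chr (v + w) a = \sum_(a <- s) c a * chr v a * chr w a.
    by apply: eq_bigr => i _; rewrite chrD mulrA.
  rewrite chrD => H1.
  have -> : \sum_(a <- s) c a * (chr w a - chr w b) * chr v a =
      \sum_(a <- s) c a * chr v a * chr w a - chr w b * \sum_(a <- s) c a * chr v a.
    by rewrite mulr_sumr -sumrB; apply: eq_bigr => i _; ring.
  move: H1 H2; set X := \sum_(a <- s) _; set Y := \sum_(a <- s) _ => H1 H2.
  have EX : X = - (c b * (chr v b * chr w b)) by apply/eqP; rewrite -addr_eq0 addrC H1.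
  have EY : Y = - (c b * chr v b) by apply/eqP; rewrite -addr_eq0 addrC H2.
  by rewrite EX EY; ring.
move=> a; rewrite inE => /orP[/eqP ->|]; last exact: cs.
have := H 0 (mem0v _); rewrite rnorm0 => /(_ d0); rewrite big_cons big_seq big1 ?addr0.
  move=> /eqP; rewrite mulf_eq0 => /orP[/eqP //|].
  by rewrite chrE (negPf (cexp_neq0 _)).
by move=> i si; rewrite cs // mul0r.
Qed.

Lemma tactZ (t z : V) (k : C) : tact t (k *: z) = k *: tact t z.
Proof. by apply/rowP => j; rewrite !mxE mulrCA. Qed.

Section Pair.
Variables (P Q : V -> C) (e d A : R).
Hypotheses (e0 : 0 < e) (d0 : 0 < d).
Hypotheses (hP : hol_on (rball 0 e) P) (hQ : hol_on (rball 0 e) Q).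
Hypotheses (bP : forall z, rball 0 e z -> rnorm (P z) <= A)
  (bQ : forall z, rball 0 e z -> rnorm (Q z) <= A).
Hypothesis PQ : forall v, v \in h -> rnorm v < d -> forall z, rball 0 e z ->
  P (tact (texp v) z) * Q z = P z * Q (tact (texp v) z).

Lemma lowest_parts_proportional p q F G :
  (forall z, leading (fun t => P (t *: z)) p (F z)) -> (exists z, F z != 0) ->
  polynomial_on_lines p F ->
  (forall z, leading (fun t => Q (t *: z)) q (G z)) -> (exists z, G z != 0) ->
  polynomial_on_lines q G -> p = q /\ exists c, forall z, F z = c * G z.
Proof.
move=> lF [zF Fz] pF lG [zG Gz] pG.
have inv v z : v \in h -> rnorm v < d ->
    F (tact (texp v) z) * G z = F z * G (tact (texp v) z).
  move=> vh vd; pose t := texp v.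
  have H1 := leadingM (lF (tact t z)) (lG z).
  have H2 := leadingM (lF z) (lG (tact t z)).
  apply: (leading_unique H1); apply: bigO0_eq H2.
  exists (e / (rnorm z + 1)) => [|k kz].
    by rewrite divr_gt0 // ltr_wpDl // rnorm_ge0.
  have kin : rball 0 e (k *: z).
    rewrite /rball /= subr0 rnormZ; have n0 := rnorm_ge0 z.
    move: kz; rewrite ltr_pdivlMr ?ltr_wpDl //.
    by have := rnorm_ge0 k; nra.
  by have := PQ vh vd kin; rewrite tactZ => ->.
have [lf lfP] := polynomial_on_lines_polyfun pF.
have [lg lgP] := polynomial_on_lines_polyfun pG.
pose s := undup ([seq x.2 | x <- lf] ++ [seq x.2 | x <- lg]).
have us : uniq s := undup_uniq _.
have sf : {subset [seq x.2 | x <- lf] <= s}.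
  by move=> x xf; rewrite mem_undup mem_cat xf.
have sg : {subset [seq x.2 | x <- lg] <= s}.
  by move=> x xg; rewrite mem_undup mem_cat xg orbT.
pose cf a := \sum_(x <- lf | x.2 == a) x.1.
pose cg a := \sum_(x <- lg | x.2 == a) x.1.
have FE z : F z = \sum_(a <- s) cf a * mono z a by rewrite lfP (polyfun_uniq z us sf).
have GE z : G z = \sum_(a <- s) cg a * mono z a by rewrite lgP (polyfun_uniq z us sg).
(* For fixed [z] the difference is a combination of monomials in [u]. It vanishes for [u] in H near
   1, so by independence each coefficient is 0 and [u] may be arbitrary. *)
have all_u u z : F (tact u z) * G z = F z * G (tact u z).
  have E w : F (tact w z) * G z - F z * G (tact w z) =
      \sum_(a <- s) ((cf a * G z - cg a * F z) * mono z a) * mono w a.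
    rewrite (FE (tact w z)) (GE (tact w z)) mulr_suml mulr_sumr -sumrB.
    by apply: eq_bigr => a _; rewrite mono_tact; ring.
  apply/eqP; rewrite -subr_eq0 E big_seq big1 // => a sa.
  rewrite (@chr_independent s (fun a => (cf a * G z - cg a * F z) * mono z a) d) ?mul0r //.
  by move=> v vh vd; rewrite -E inv // subrr.
(* Every [y] is a coordinatewise multiple of a point without zero coordinates. Such a point with
   [G z1] nonzero is found on the line through [zG] in the direction (1, ..., 1), where only
   finitely many parameters are excluded. *)
have [z1 z1n Gz1] : exists2 z1 : V, forall j, z1 0 j != 0 & G z1 != 0.
  have [L LP] := pG.
  pose pol : {poly C} := \sum_(i < q.+1) (G (zG + i%:R *: const_mx 1)) *: L i.
  have polE t : pol.[t] = G (zG + t *: const_mx 1).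
    by rewrite LP horner_sum; apply: eq_bigr => i _; rewrite hornerZ.
  pose pr : {poly C} := pol * \prod_j ('X + (zG 0 j)%:P).
  have pol0 : pol != 0.
    apply: contraNneq Gz => pol0; have := polE 0.
    by rewrite pol0 horner0 scale0r addr0 => <-.
  have [|t] := @poly_nonroot _ pr.
    rewrite mulf_neq0 //; apply/prodf_neq0 => j _.
    by rewrite -[zG 0 j]opprK polyCN polyXsubC_eq0.
  rewrite hornerM mulf_eq0 negb_or polE horner_prod => /andP[Gt /prodf_neq0 nt].
  exists (zG + t *: const_mx 1) => // j.
  by have := nt j isT; rewrite hornerD hornerX hornerC !mxE mulr1 addrC.
pose c := F z1 / G z1.
have FG y : F y = c * G y.
  have := all_u (\row_j (y 0 j / z1 0 j)) z1.
  have -> : tact (\row_j (y 0 j / z1 0 j)) z1 = y.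
    by apply/rowP => j; rewrite !mxE divfK.
  by rewrite /c => H; apply: (mulIf Gz1); rewrite H; field.
split; last by exists c.
(* Homogeneity, tested at the factor 2 alone, is enough to compare the degrees. *)
have homog (H : V -> C) k (K : V -> C) z : (forall z, leading (fun t => H (t *: z)) k (K z)) ->
    K (2 *: z) = 2 ^+ k * K z.
  move=> lH; apply: (leading_unique (lH (2 *: z))).
  have [B [r r0 [B0 BP]]] := lH z.
  exists (B * 2 ^+ k.+1), (r / 2); first by rewrite divr_gt0.
  split=> [|t tr]; first by rewrite mulr_ge0 ?exprn_ge0.
  have n2 : rnorm (2 : C) = 2 by rewrite -[2 : C](rmorph_nat (real_complex R)) rnorm_real ger0_norm.
  have t2 : rnorm (t * 2) < r by rewrite rnormM n2; lra.
  have := BP _ t2; rewrite -scalerA rnormM n2 => H1.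
  rewrite mulrA -exprMn; apply: le_trans H1 _.
  by rewrite exprMn le_eqVlt; apply/orP; left; apply/eqP; ring.
have := homog P p F zF lF; rewrite FG (homog Q q G zF lG) mulrCA -FG => /(mulIf Fz).
move=> /eqP; rewrite -!natrX eqr_nat eqn_exp2l // => /eqP //.
Qed.

End Pair.

Lemma invariant_quotient_constant (P Q : V -> C) (e d A B : R) : 0 < e -> 0 < d ->
  hol_on (rball 0 e) P -> hol_on (rball 0 e) Q ->
  (forall z, rball 0 e z -> rnorm (P z) <= A) ->
  (forall z, rball 0 e z -> rnorm (Q z) <= B) ->
  (exists2 z, rball 0 e z & Q z != 0) ->
  (forall v, v \in h -> rnorm v < d -> forall z, rball 0 e z ->
    P (tact (texp v) z) * Q z = P z * Q (tact (texp v) z)) ->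
  exists c, forall z, rball 0 e z -> P z = c * Q z.
Proof.
move=> e0 d0 hP hQ bP bQ Q0 PQ.
have [q [G [lG Gn0 pG]]] := lowest_part e0 hQ bQ Q0.
have [P0|/forallNP P0] := pselect (exists z, rball 0 e z /\ P z != 0); last first.
  exists 0 => z ze; rewrite mul0r; apply/eqP/negPn/negP => Pz.
  exact: (P0 z).
have [|p [F [lF Fn0 pF]]] := lowest_part e0 hP bP; first by case: P0 => z [? ?]; exists z.
have [pq [c FG]] := lowest_parts_proportional e0 d0 PQ lF Fn0 pF lG Gn0 pG.
exists c => z1 z1e; apply/eqP; rewrite -subr_eq0; apply/negPn/negP => D0.
pose D z := P z - c * Q z.
have hD : hol_on (rball 0 e) D.
  by apply: hol_onB hP _; apply: hol_onM hQ; exact: hol_on_cst.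
have bD z : rball 0 e z -> rnorm (D z) <= A + rnorm c * B.
  move=> ze; rewrite (le_trans (rnormB _ _)) // rnormM lerD ?bP //.
  by rewrite ler_wpM2l ?rnorm_ge0 ?bQ.
have Dn0 : exists2 z, rball 0 e z & D z != 0 by exists z1.
have [r [K [lK Kn0 pK]]] := lowest_part e0 hD bD Dn0.
have DQ v : v \in h -> rnorm v < d -> forall z, rball 0 e z ->
    D (tact (texp v) z) * Q z = D z * Q (tact (texp v) z).
  by move=> vh vd z ze; rewrite /D !mulrBl PQ //; ring.
(* The lowest part of [D] must have degree [q], whereas its part of degree [q] is F - cG = 0. *)
have [rq _] := lowest_parts_proportional e0 d0 DQ lK Kn0 pK lG Gn0 pG.
case: Kn0 => z; case/eqP; apply: (leading_unique (lK z)).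
have lFz := lF z; rewrite pq FG -rq in lFz; have lGz := lG z; rewrite -rq in lGz.
by have := leadingB lFz (leadingZ c lGz); rewrite subrr.
Qed.

End Rigidity.

(** * Clearing poles on slices *)

Section Compactness.
Variable R : realType.
Local Notation C := R[i].

Lemma compact_disc (r : R) : compact [set z : C | rnorm z <= r].
Proof.
pose f (p : R * R) : C := p.1 +i* p.2.
have cf : continuous f.
  by move=> p; apply: continuous_Complex; [exact: cvg_fst|exact: cvg_snd].
have cpt := compact_setX (@segment_compact R (- r) r) (@segment_compact R (- r) r).
have cim : compact (f @` (`[- r, r] `*` `[- r, r])).
  by apply: continuous_compact cpt; apply: continuous_subspaceT.
apply: (subclosed_compact _ cim).
  rewrite -[X in closed X]setCK; apply: open_closedC; apply/openP => z /= /negP.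
  rewrite -ltNge => zr; exists (rnorm z - r) => [|y yz]; first by rewrite subr_gt0.
  apply/negP; rewrite -ltNge; have := rnormD (z - y) y; rewrite subrK rnormC; lra.
move=> [x y] /= zr; exists (x, y) => //; split => /=; rewrite in_itv /=.
  by have := le_trans (Re_le_rnorm _) zr; rewrite ler_norml.
by have := le_trans (Im_le_rnorm _) zr; rewrite ler_norml.
Qed.

Lemma compact_cover_balls (V : normedModType C) (K : set V) (e : V -> R) :
  compact K -> (forall z, K z -> 0 < e z) ->
  exists l : seq V, (forall b, b \in l -> K b) /\
    forall z, K z -> exists2 b, b \in l & rnorm (z - b) < e b.
Proof.
move=> cK e0; rewrite compact_cover in cK.
have op (b : V) : K b -> open [set z | rnorm (z - b) < e b].
  move=> _; apply/openP => z /= zb; exists (e b - rnorm (z - b)) => [|y yz].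
    by rewrite subr_gt0.
  by have := rnorm_triangle y z b; lra.
have [|D DK KD] := cK _ K (fun b => [set z | rnorm (z - b) < e b]) op.
  by move=> z Kz; exists z => //=; rewrite subrr rnorm0 e0.
exists (finmap.enum_fset D); split=> [b bD|z Kz].
  by have := DK b bD; rewrite inE.
by have [b /= bD zb] := KD z Kz; exists b.
Qed.

Lemma continuous_punctured (f g : C -> C) (z : C) (e : R) :
  {for z, continuous f} -> {for z, continuous g} -> 0 < e ->
  (forall y, y != z -> rnorm (y - z) < e -> f y = g y) -> f z = g z.
Proof.
move=> /continuous_rnormP cf /continuous_rnormP cg e0 fg.
apply: rnorm_eps => d d0; have d2 : 0 < d / 2 by rewrite divr_gt0.
have [s s0 sP] := cf _ d2; have [t t0 tP] := cg _ d2.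
pose m := Num.min e (Num.min s t).
have m0 : 0 < m by rewrite !lt_min e0 s0 t0.
have me : m <= e by rewrite ge_min lexx.
have ms : m <= s by rewrite !ge_min lexx orbT.
have mt : m <= t by rewrite !ge_min lexx !orbT.
pose y : C := z + (m / 2)%:C.
have yz : rnorm (y - z) = m / 2.
  by rewrite /y addrC addKr rnorm_real ger0_norm // divr_ge0 // ltW.
have m2 : m / 2 < m by lra.
have H1 := sP y; have H2 := tP y; rewrite yz in H1 H2.
have E : f y = g y.
  apply: fg; last by rewrite yz (lt_le_trans m2).
  by apply: contraTneq m0 => yz'; move: yz; rewrite yz' subrr rnorm0 => ?; rewrite -leNgt; lra.
have := rnorm_triangle (f z) (f y) (g z); rewrite (rnormC (f z) (f y)).
have {}H1 := H1 (lt_le_trans m2 ms); have := H2 (lt_le_trans m2 mt).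
by rewrite -E; lra.
Qed.

Lemma hol_on_derivable1 (A : set C) (f : C -> C) :
  (forall z, A z -> derivable f z 1) -> hol_on A f.
Proof. by move=> df z Az e; apply: diff_derivable; apply/derivable1_diffP; exact: df. Qed.

Lemma derivable_horner (p : {poly C}) z : derivable (fun x : C => p.[x]) z 1.
Proof.
have -> : (fun x : C => p.[x]) = (fun x => \sum_(i < size p) p`_i * x ^+ i).
  by apply/funext => x; rewrite horner_coef.
suff : hol_on setT (fun x : C => \sum_(i < size p) p`_i * x ^+ i) by apply.
apply: (@hol_on_sum R _ setT _ _ _ (fun (i : 'I_(size p)) (x : C) => p`_i * x ^+ i)) => i.
apply: hol_on_derivable1 => x _.
apply: (@derivableM _ _ (fun=> p`_i : C) (fun x : C => x ^+ i)); first exact: derivable_cst.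
exact: derivable_exprn.
Qed.

End Compactness.

(** * Common denominators on compact sets of the complex line *)

Section ClearPoles.
Variables (R : realType) (I : Type).
Local Notation C := R[i].
Variables (K : set C) (dom : I -> set C) (N D : I -> C -> C).
Hypothesis compactK : compact K.
Hypothesis cover : forall z, K z -> exists i, dom i z.
Hypothesis dom_open : forall i z, dom i z ->
  exists2 e : R, 0 < e & forall y, rnorm (y - z) <= e -> dom i y.
Hypothesis holN : forall i z, dom i z -> derivable (N i) z 1.
Hypothesis holD : forall i z, dom i z -> derivable (D i) z 1.
Hypothesis regular : forall i z (e : R), dom i z -> 0 < e ->
  exists2 y, rnorm (y - z) < e & D i y != 0.
Hypothesis compat : forall i j z, dom i z -> dom j z -> N i z * D j z = N j z * D i z.

(** A chart with nonzero denominator at [z] is preferred whenever there is one. The exponent [k] is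
    then 0 at regular points, so no spurious zero enters the common denominator. *)
Let local_data z : K z -> exists x : I * nat * (C -> C) * R,
  let: (i, k, u, e) := x in
  [/\ 0 < e, forall y, rnorm (y - z) < e -> dom i y,
    forall y, rnorm (y - z) < e -> D i y = (y - z) ^+ k * u y,
    forall y, rnorm (y - z) < e -> u y != 0 /\ derivable u y 1 &
    forall j, dom j z -> D j z != 0 -> k = 0%N].
Proof.
move=> Kz.
have [i [iz iP]] : exists i, dom i z /\ forall j, dom j z -> D j z != 0 -> D i z != 0.
  have [[j [jz Dj]]|H] := pselect (exists j, dom j z /\ D j z != 0).
    by exists j; split.
  have [i iz] := cover Kz; exists i; split => // j jz Dj.
  by case: H; exists j.
have [e e0 eP] := dom_open iz.
have [y ye Dy] := regular iz e0.
have [k [u [s [s0 se Du uP]]]] := hol_factor e0 (fun x xe => holD (eP x xe)) ye Dy.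
exists (i, k, u, s); split => //.
  by move=> x xs; apply: eP; apply: ltW; exact: lt_trans se.
move=> j jz Dj; have := iP j jz Dj; rewrite Du ?subrr ?rnorm0 //.
by case: k {Du} => // k; rewrite expr0n mul0r eqxx.
Qed.

(** Finitely many discs cover [K], each carrying a denominator that is a power of [z - b] times a
    unit. The product [q] of these powers clears all poles and vanishes, within [K], only at points
    where every denominator vanishes. *)
Lemma clear_poles : exists (q : {poly C}) (F : C -> C),
  [/\ q \is monic, forall z, K z -> derivable F z 1,
    forall z i, K z -> dom i z -> F z * D i z = q.[z] * N i z,
    forall z i, K z -> dom i z -> D i z != 0 -> q.[z] != 0 &
    forall z, K z -> q.[z] != 0 -> exists2 i, dom i z & D i z != 0].
Proof.
have [[z0 Kz0]|K0] := pselect (exists z, K z); last first.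
  exists 1, (fun=> 0); split => [||z ? Kz|z ? Kz|z Kz]; try by case: K0; exists z.
    exact: monic1.
  by move=> z Kz; case: K0; exists z.
have [i0 _] := cover Kz0.
have : forall z, exists x : I * nat * (C -> C) * R, K z -> let: (i, k, u, e) := x in
  [/\ 0 < e, forall y, rnorm (y - z) < e -> dom i y,
    forall y, rnorm (y - z) < e -> D i y = (y - z) ^+ k * u y,
    forall y, rnorm (y - z) < e -> u y != 0 /\ derivable u y 1 &
    forall j, dom j z -> D j z != 0 -> k = 0%N].
  move=> z; have [Kz|nK] := pselect (K z); first by have [x xP] := local_data Kz; exists x.
  by exists (i0, 0%N, (fun=> 0), 0).
move=> /choice[d dP].
pose i_ z := (d z).1.1.1; pose k_ z := (d z).1.1.2; pose u_ z := (d z).1.2.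
pose e_ z := (d z).2.
have {}dP z : K z -> [/\ 0 < e_ z, forall y, rnorm (y - z) < e_ z -> dom (i_ z) y,
    forall y, rnorm (y - z) < e_ z -> D (i_ z) y = (y - z) ^+ k_ z * u_ z y,
    forall y, rnorm (y - z) < e_ z -> u_ z y != 0 /\ derivable (u_ z) y 1 &
    forall j, dom j z -> D j z != 0 -> k_ z = 0%N].
  by rewrite /i_ /k_ /u_ /e_ => /dP; case: (d z) => [[[i k] u] e].
have e_gt0 z : K z -> 0 < e_ z by move=> /dP[].
have [l0 [l0K l0cov]] := compact_cover_balls compactK e_gt0.
(* Distinct centres, so that exactly one factor of [q] belongs to each [b]. *)
pose l := undup l0.
have lK b : b \in l -> K b by rewrite mem_undup; exact: l0K.
have lcov z : K z -> exists2 b, b \in l & rnorm (z - b) < e_ b.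
  by move=> /l0cov[b bl zb]; exists b => //; rewrite mem_undup.
have ul : uniq l := undup_uniq _.
pose q : {poly C} := \prod_(b <- l) ('X - b%:P) ^+ k_ b.
have qE z : q.[z] = \prod_(b <- l) (z - b) ^+ k_ b.
  by rewrite horner_prod; apply: eq_bigr => b _; rewrite horner_exp hornerXsubC.
(* The product of [q] and the function near [b], with the power of [z - b] already cancelled; it is
   therefore defined at [b] too. *)
pose F_ b z : C := (\prod_(b' <- l | b' != b) (z - b') ^+ k_ b') * (N (i_ b) z / u_ b z).
have F_eq b z : b \in l -> rnorm (z - b) < e_ b -> F_ b z * D (i_ b) z = q.[z] * N (i_ b) z.
  move=> bl zb; have [_ _ DE uP _] := dP b (lK b bl).
  rewrite qE (bigD1_seq b) //= DE // /F_; have [u0 _] := uP z zb.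
  by field.
have F_der b z : b \in l -> rnorm (z - b) < e_ b -> derivable (F_ b) z 1.
  move=> bl zb; have [_ idom _ uP _] := dP b (lK b bl); have [u0 du] := uP z zb.
  apply: (@derivableM _ _ (fun z => \prod_(b' <- l | b' != b) (z - b') ^+ k_ b')
    (fun z => N (i_ b) z / u_ b z)).
    have -> : (fun z => \prod_(b' <- l | b' != b) (z - b') ^+ k_ b') =
        (fun z => (\prod_(b' <- l | b' != b) ('X - b'%:P) ^+ k_ b').[z]).
      apply/funext => y; rewrite horner_prod; apply: eq_bigr => c _.
      by rewrite horner_exp hornerXsubC.
    exact: derivable_horner.
  apply: (@derivableM _ _ (N (i_ b)) (fun z => (u_ b z)^-1)); first exact/holN/idom.
  exact: (@derivableV _ _ (u_ b)).
have D_neq0 b z : b \in l -> rnorm (z - b) < e_ b -> z != b -> D (i_ b) z != 0.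
  move=> bl zb nzb; have [_ _ DE uP _] := dP b (lK b bl); have [u0 _] := uP z zb.
  by rewrite DE // mulf_neq0 // expf_neq0 // subr_eq0.
have nearby (z : C) (S : seq C) : exists2 e : R, 0 < e &
    forall y, y != z -> rnorm (y - z) < e -> y \notin S.
  elim: S => [|b S [e e0 eP]]; first by exists 1.
  have [->|bz] := eqVneq b z.
    by exists e => // y yz ye; rewrite inE negb_or yz; exact: eP.
  exists (Num.min e (rnorm (b - z))) => [|y yz]; first by rewrite lt_min e0 rnorm_gt0 subr_eq0.
  rewrite lt_min => /andP[ye yb]; rewrite inE negb_or eP // andbT.
  by apply: contraTneq yb => ->; rewrite ltxx.
have inball b z : rnorm (z - b) < e_ b -> exists2 e : R, 0 < e &
    forall y, rnorm (y - z) < e -> rnorm (y - b) < e_ b.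
  move=> zb; exists (e_ b - rnorm (z - b)) => [|y yz]; first by rewrite subr_gt0.
  by have := rnorm_triangle y z b; lra.
have F_all b z i : b \in l -> rnorm (z - b) < e_ b -> dom i z ->
    F_ b z * D i z = q.[z] * N i z.
  move=> bl zb iz; have [e1 e10 e1P] := inball b z zb.
  have [e2 e20 e2P] := dom_open iz; have [e3 e30 e3P] := nearby z [:: b].
  apply: (@continuous_punctured _ (fun z => F_ b z * D i z) (fun z => q.[z] * N i z) z
    (Num.min e1 (Num.min e2 e3))).
  - apply: derivable1_continuous; apply: (@derivableM _ _ (F_ b) (D i)); first exact: F_der.
    exact: holD.
  - apply: derivable1_continuous; apply: (@derivableM _ _ (fun z => q.[z]) (N i)); last exact: holN.
    exact: derivable_horner.
  - by rewrite !lt_min e10 e20 e30.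
  move=> y yz; rewrite !lt_min => /andP[y1 /andP[y2 y3]].
  have yb := e1P y y1; have iy := e2P y (ltW y2).
  have ynb : y != b by have := e3P y yz y3; rewrite inE.
  have [_ idom _ _ _] := dP b (lK b bl).
  apply: (mulIf (D_neq0 b y bl yb ynb)).
  by rewrite mulrAC F_eq // -mulrA (compat (idom y yb) iy) mulrA.
(* The local quotients agree on overlaps by [FE], so any selection of a disc containing [z] glues
   them. *)
pose sel z := nth 0 l (find (fun b => rnorm (z - b) < e_ b) l).
have selP z b : b \in l -> rnorm (z - b) < e_ b ->
    sel z \in l /\ rnorm (z - sel z) < e_ (sel z).
  move=> bl zb; have hz : has (fun b => rnorm (z - b) < e_ b) l by apply/hasP; exists b.
  split; first by rewrite mem_nth // -has_find.
  exact: (nth_find 0 hz).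
pose F z := F_ (sel z) z.
have FE b z : b \in l -> rnorm (z - b) < e_ b -> F z = F_ b z.
  move=> bl zb; have [sl zs] := selP z b bl zb; rewrite /F; move: (sel z) sl zs => c cl zc.
  have [e1 e10 e1P] := inball b z zb; have [e2 e20 e2P] := inball c z zc.
  have [e3 e30 e3P] := nearby z [:: c].
  apply: (@continuous_punctured _ (F_ c) (F_ b) z (Num.min e1 (Num.min e2 e3))).
  - exact/derivable1_continuous/F_der.
  - exact/derivable1_continuous/F_der.
  - by rewrite !lt_min e10 e20 e30.
  move=> y yz; rewrite !lt_min => /andP[y1 /andP[y2 y3]].
  have ync : y != c by have := e3P y yz y3; rewrite inE.
  apply: (mulIf (D_neq0 c y cl (e2P y y2) ync)).
  have [_ idom _ _ _] := dP c (lK c cl).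
  by rewrite F_eq ?e2P // F_all ?e1P //; apply: idom; exact: e2P.
exists q, F; split.
- by apply: monic_prod => b _; rewrite monic_exp // monicXsubC.
- move=> z Kz; have [b bl zb] := lcov z Kz; have [e e0 eP] := inball b z zb.
  apply: (@near_eq_derivable1 _ _ _ (F_ b) F z 1 e e0); last exact: F_der.
  by move=> y ye; rewrite (FE b) // eP.
- by move=> z i Kz iz; have [b bl zb] := lcov z Kz; rewrite (FE b) // F_all.
- move=> z i Kz iz Di; rewrite qE prodf_seq_neq0; apply/allP => b bl /=.
  rewrite expf_eq0 negb_and subr_eq0; have [zb|] := eqVneq z b; last by rewrite orbT.
  have [_ _ _ _ k0] := dP b (lK b bl).
  by rewrite (k0 i) // -zb.
- move=> z Kz; have [b bl zb] := lcov z Kz; have [_ idom DE uP _] := dP b (lK b bl).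
  have [zb'|zb'] := eqVneq z b; last by move=> _; exists (i_ b); [exact: idom|exact: D_neq0].
  rewrite qE (bigD1_seq b) //= mulf_eq0 negb_or => /andP[qb _].
  exists (i_ b); first exact: idom.
  by rewrite DE // mulf_neq0 //; have [] := uP z zb.
Qed.

End ClearPoles.

(** * Hankel determinants and linear recurrences *)

Section Hankel.
Variable K : fieldType.

(** The recurrence says that the functional with moments [mu] kills all multiples of [q]. Reducing
    column monomials modulo [q] factors the matrix through dimension [(size q).-1], which is less
    than [r]. Arbitrary row and column indices are allowed because minors are needed. *)
Lemma hankel_det_eq0 (q : {poly K}) (mu : nat -> K) r (kk jj : 'I_r -> nat) :
  q \is monic -> (forall k, \sum_(i < size q) q`_i * mu (k + i)%N = 0) ->
  (size q <= r)%N -> \det (\matrix_(a, b) mu (kk a + jj b)%N) = 0.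
Proof.
move=> mq qmu qr.
pose L k (p : {poly K}) := \sum_(i < size p) p`_i * mu (k + i)%N.
have LE k n (p : {poly K}) : (size p <= n)%N -> L k p = \sum_(i < n) p`_i * mu (k + i)%N.
  move=> pn; rewrite /L (big_ord_widen n (fun i => p`_i * mu (k + i)%N) pn) big_mkcond /=.
  apply: eq_bigr => i _; case: ltnP => // pi.
  by rewrite nth_default // mul0r.
have LD k p1 p2 : L k (p1 + p2) = L k p1 + L k p2.
  have m1 : (size p1 <= maxn (size p1) (size p2))%N by rewrite leq_maxl.
  have m2 : (size p2 <= maxn (size p1) (size p2))%N by rewrite leq_maxr.
  rewrite (LE k _ _ m1) (LE k _ _ m2) (LE k _ _ (size_polyD p1 p2)) -big_split /=.
  by apply: eq_bigr => i _; rewrite coefD mulrDl.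
have LX k p : L k (p * 'X) = L k.+1 p.
  rewrite (LE k (size p).+1) ?size_polyMleq //; last first.
    by have := size_polyMleq p 'X; rewrite size_polyX addn2.
  rewrite big_ord_recl coefMX eqxx mul0r add0r; apply: eq_bigr => i _.
  by rewrite coefMX /= addnS addSn.
have LZ k c p : L k (c *: p) = c * L k p.
  rewrite (LE k (size p)) ?size_scale_leq // mulr_sumr.
  by apply: eq_bigr => i _; rewrite coefZ mulrA.
have Lq p k : L k (q * p) = 0.
  elim/poly_ind: p k => [|p c IH] k; first by rewrite mulr0 /L size_poly0 big_ord0.
  by rewrite mulrDr mulrA LD LX IH add0r mulrC mul_polyC LZ /L qmu mulr0.
have L1 k j : L k 'X^j = mu (k + j)%N.
  elim: j k => [|j IH] k; last by rewrite exprSr LX IH addSnnS.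
  by rewrite expr0 /L size_poly1 big_ord1 coefC eqxx mul1r.
have rem k j : mu (k + j)%N = \sum_(l < (size q).-1) mu (k + l)%N * ('X^j %% q)`_l.
  rewrite -L1 {1}(divp_eq 'X^j q) LD mulrC Lq add0r (LE k (size q).-1).
    by apply: eq_bigr => i _; rewrite mulrC.
  have q0 := monic_neq0 mq.
  by rewrite -ltnS prednK ?size_poly_gt0 // ltn_modp.
have -> : \matrix_(a, b) mu (kk a + jj b)%N =
   (\matrix_(a < r, l < (size q).-1) mu (kk a + l)%N) *m
   (\matrix_(l < (size q).-1, b < r) ('X^(jj b) %% q)`_l).
  apply/matrixP => a b; rewrite !mxE rem; apply: eq_bigr => l _.
  by rewrite !mxE.
set M := _ *m _; apply/eqP/negPn/negP => dM.
have uM : M \in unitmx by rewrite unitmxE unitfE.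
have := mulmx_max_rank (\matrix_(a < r, l < (size q).-1) mu (kk a + l)%N)
   (\matrix_(l < (size q).-1, b < r) ('X^(jj b) %% q)`_l).
rewrite -/M mxrank_unit // leqNgt => /negP; apply.
by rewrite prednK // size_poly_gt0 monic_neq0.
Qed.

End Hankel.

Section BoundedHolomorphic.
Variables (R : realType) (V : normedModType R[i]).
Local Notation C := R[i].
Implicit Types (A : set V) (f g : V -> C).

Definition bhol A g := hol_on A g /\ exists B : R, forall z, A z -> rnorm (g z) <= B.

Lemma bhol_cst A (c : C) : bhol A (fun=> c).
Proof. by split; [exact: hol_on_cst|exists (rnorm c)]. Qed.

Lemma bholM A f g : bhol A f -> bhol A g -> bhol A (fun z => f z * g z).
Proof.
move=> [hf [B fB]] [hg [D gD]]; split; first exact: hol_onM.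
by exists (B * D) => z Az; rewrite rnormM ler_pM ?rnorm_ge0 ?fB ?gD.
Qed.

Lemma bhol_sum A (I : Type) (s : seq I) (P : pred I) (F : I -> V -> C) :
  (forall i, bhol A (F i)) -> bhol A (fun z => \sum_(i <- s | P i) F i z).
Proof.
move=> hF; split; first by apply: hol_on_sum => i; have [] := hF i.
have /choice[B BP] : forall i, exists B : R, forall z, A z -> rnorm (F i z) <= B.
  by move=> i; have [] := hF i.
exists (\sum_(i <- s | P i) B i) => z Az; apply: (le_trans (rnorm_sum _ _ _)).
by apply: ler_sum => i _; exact: BP.
Qed.

Lemma bhol_prod A (I : Type) (s : seq I) (P : pred I) (F : I -> V -> C) :
  (forall i, bhol A (F i)) -> bhol A (fun z => \prod_(i <- s | P i) F i z).
Proof.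
move=> hF; split; first by apply: hol_on_prod => i; have [] := hF i.
have /choice[B BP] : forall i, exists B : R, forall z, A z -> rnorm (F i z) <= B.
  by move=> i; have [] := hF i.
exists (\prod_(i <- s | P i) B i) => z Az; rewrite rnorm_prod.
by apply: ler_prod => i _; rewrite rnorm_ge0 BP.
Qed.

Lemma bhol_det A n (M : V -> 'M[C]_n) :
  (forall i j, bhol A (fun z => M z i j)) -> bhol A (fun z => \det (M z)).
Proof.
move=> hM; rewrite /determinant; apply: bhol_sum => s.
by apply: bholM; [exact: bhol_cst|apply: bhol_prod => i; exact: hM].
Qed.

(* The coefficients are the cofactors along the last row of a matrix
   extending a nonzero minor of maximal size. *)
Lemma hankel_relation A (mu : nat -> V -> C) n :
  (exists z, A z) -> (forall k, bhol A (mu k)) ->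
  (forall kk jj : 'I_n -> nat, forall z, A z ->
    \det (\matrix_(a, b) mu (kk a + jj b)%N z) = 0) ->
  exists N (q : nat -> V -> C), [/\ forall j, bhol A (q j),
    exists j, (j < N)%N /\ exists2 z, A z & q j z != 0 &
    forall k z, A z -> \sum_(j < N) q j z * mu (k + j)%N z = 0].
Proof.
move=> [z0 Az0] hmu hn.
pose van r := `[< forall kk jj : 'I_r -> nat, forall z, A z ->
    \det (\matrix_(a, b) mu (kk a + jj b)%N z) = 0 >].
have ex : exists r, van r by exists n; apply/asboolP.
pose r := ex_minn ex.
have [vr minr] : van r /\ forall s, van s -> (r <= s)%N by rewrite /r; case: ex_minnP.
(* The determinant of the empty matrix is 1, so the least vanishing size is positive. *)
case: r vr minr => [|r] /asboolP vr minr.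
  have := vr (fun=> 0%N) (fun=> 0%N) z0 Az0; rewrite det_mx00 => /eqP.
  by rewrite oner_eq0.
have [kk [jj [z1 Az1 dz1]]] : exists kk jj : 'I_r -> nat, exists2 z, A z &
    \det (\matrix_(a, b) mu (kk a + jj b)%N z) != 0.
  apply: contrapT => H; have : van r.
    apply/asboolP => kk jj z Az; apply/eqP/negPn/negP => dz.
    by apply: H; exists kk, jj, z.
  by move=> /minr; rewrite ltnn.
(* An index beyond all the [jj b]: only the added column contributes to the coefficient of index
   [J], which is thus the nonzero minor up to sign. *)
pose J := (\sum_b jj b).+1.
have jjJ b : (jj b < J)%N by rewrite /J ltnS (bigD1 b) //= leq_addr.
pose row k (a : 'I_r.+1) := if unlift ord_max a is Some a' then kk a' else k.
pose col (b : 'I_r.+1) := if unlift ord_max b is Some b' then jj b' else J.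
pose M k z : 'M[C]_r.+1 := \matrix_(a, b) mu (row k a + col b)%N z.
pose cof b z := cofactor (M 0%N z) ord_max b.
have cofE k b z : cofactor (M k z) ord_max b = cof b z.
  rewrite /cof /cofactor; congr (_ * \det _); apply/matrixP => i j.
  by rewrite !mxE /row liftK.
have det0 k z : A z -> \sum_b cof b z * mu (k + col b)%N z = 0.
  move=> Az; have := vr (row k) col z Az; rewrite -/(M k z) (expand_det_row _ ord_max).
  move=> E; rewrite -[RHS]E; apply: eq_bigr => b _; rewrite cofE mulrC mxE; congr (mu (_ + _)%N z * _).
  by rewrite /row unlift_none.
have hcof b : bhol A (cof b).
  apply: bholM; first exact: bhol_cst.
  apply: bhol_det => i j; rewrite (_ : (fun z => _) = mu (row 0 (lift ord_max i) + col (lift b j))%N) //.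
  by apply/funext => z; rewrite !mxE.
exists J.+1, (fun j z => \sum_b (col b == j)%:R * cof b z); split.
- by move=> j; apply: bhol_sum => b; apply: bholM; [exact: bhol_cst|exact: hcof].
- exists J; split => //; exists z1 => //.
  rewrite (bigD1 ord_max) //= big1 => [|b]; last first.
    rewrite /col; case: unliftP => [b' ->|->]; last by rewrite eqxx.
    by move=> _; rewrite ltn_eqF // mul0r.
  rewrite /col unlift_none eqxx mul1r addr0 /cof /cofactor mulf_neq0 ?signr_eq0 //.
  apply: contraNneq dz1 => d0; rewrite -d0; apply/eqP; congr (\det _).
  by apply/matrixP => i j; rewrite !mxE /row /col !liftK.
- move=> k z Az; rewrite -[RHS](det0 k z Az).
  under eq_bigr do rewrite mulr_suml; rewrite exchange_big /=; apply: eq_bigr => b _.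
  have cJ : (col b < J.+1)%N.
    by rewrite /col; case: (unlift _ _) => [b'|] //; rewrite ltnS ltnW.
  rewrite (bigD1 (Ordinal cJ)) //= eqxx mul1r big1 ?addr0 // => j jb.
  rewrite [_ == _]negbTE ?mul0r //; apply: contraNneq jb => E.
  by apply/eqP/val_inj.
Qed.

End BoundedHolomorphic.

(** * Functions given by local fractions *)

Section Fractions.
Variables (R : realType) (V : normedModType R[i]) (I : Type).
Local Notation C := R[i].
Variables (U : set V) (dom : I -> set V) (N D : I -> V -> C).
Hypothesis cover : forall z, U z -> exists i, dom i z.
Hypothesis dom_open : forall i z, dom i z ->
  exists2 e : R, 0 < e & forall y, rnorm (y - z) < e -> dom i y.
Hypothesis holN : forall i, hol_on (dom i) (N i).
Hypothesis holD : forall i, hol_on (dom i) (D i).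
Hypothesis contN : forall i z, dom i z -> {for z, continuous (N i)}.
Hypothesis contD : forall i z, dom i z -> {for z, continuous (D i)}.
Hypothesis regular : forall i z (e : R), dom i z -> 0 < e ->
  exists y, [/\ rnorm (y - z) < e, dom i y & D i y != 0].
Hypothesis compat : forall i j z, dom i z -> dom j z -> N i z * D j z = N j z * D i z.

Definition reg : set V := [set z | exists i, dom i z /\ D i z != 0].

(** The value 0 outside [reg] is a default; inside, compatibility makes the value independent of the
    chosen chart. *)
Definition frac (z : V) : C :=
  if pselect (exists i, dom i z /\ D i z != 0) is left H
  then N (projT1 (cid H)) z / D (projT1 (cid H)) z else 0.

Lemma fracE z i : reg z -> dom i z -> frac z * D i z = N i z.
Proof.
move=> rz iz; rewrite /frac; case: pselect => [H|//].
case: (cid H) => j /= [jz Dj]; apply: (mulIf Dj).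
by rewrite -(compat jz iz); field.
Qed.

Lemma nonzero_nbhs i z : dom i z -> D i z != 0 ->
  exists2 e : R, 0 < e & forall y, rnorm (y - z) < e -> dom i y /\ D i y != 0.
Proof.
move=> iz Dz; have [e e0 eP] := dom_open iz.
have Dp : 0 < rnorm (D i z) by rewrite rnorm_gt0.
have /continuous_rnormP/(_ _ Dp)[d d0 dP] := contD iz.
exists (Num.min e d) => [|y]; first by rewrite lt_min e0.
rewrite lt_min => /andP[ye yd]; split; first exact: eP.
by apply: contraTneq (dP y yd) => ->; rewrite sub0r rnormN ltxx.
Qed.

Lemma frac_local z : reg z -> exists i, exists2 e : R, 0 < e &
  forall y, rnorm (y - z) < e -> [/\ dom i y, D i y != 0 & N i y / D i y = frac y].
Proof.
move=> [i [iz Dz]]; have [e e0 eP] := nonzero_nbhs iz Dz; exists i, e => // y /eP[iy Dy].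
split => //; apply: (mulIf Dy); rewrite fracE //; first by field.
by exists i.
Qed.

Lemma reg_open z : reg z -> exists2 e : R, 0 < e & forall y, rnorm (y - z) < e -> reg y.
Proof.
move=> /frac_local[i [e e0 eP]]; exists e => // y /eP[iy Dy _]; by exists i.
Qed.

Lemma frac_derivable z w : reg z -> derivable frac z w.
Proof.
move=> /frac_local[i [e e0 eP]].
have [|iz Dz _] := eP z; first by rewrite subrr rnorm0.
apply: (@near_eq_derivable1 _ _ _ (fun y => N i y / D i y) frac z w e e0).
  by move=> y /eP[].
apply: (@derivableM _ _ (N i) (fun y => (D i y)^-1)); first exact: holN.
by apply: (@derivableV _ _ (D i)) => //; exact: holD.
Qed.

Lemma frac_continuous z : reg z -> {for z, continuous frac}.
Proof.
move=> /frac_local[i [e e0 eP]].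
have [|iz Dz _] := eP z; first by rewrite subrr rnorm0.
have : {for z, continuous (fun y => N i y / D i y)}.
  apply: (@continuousM _ _ (N i) (fun y => (D i y)^-1)); first exact: contN.
  by apply: (@continuousV _ _ (D i)) => //; exact: contD.
move=> /continuous_rnormP cq; apply/continuous_rnormP => d /cq[s s0 sP].
exists (Num.min s e) => [|y]; first by rewrite lt_min s0.
rewrite lt_min => /andP[ys ye].
have [_ _ <-] := eP y ye; have [|_ _ <-] := eP z; first by rewrite subrr rnorm0.
exact: sP.
Qed.

Lemma seq_pos_min (T : eqType) (l : seq T) (f : T -> R) :
  (forall x, x \in l -> 0 < f x) ->
  exists2 e : R, 0 < e & forall x, x \in l -> e <= f x.
Proof.
elim: l => [_|x l IH H]; first by exists 1.
have [|e e0 eP] := IH; first by move=> y yl; apply: H; rewrite inE yl orbT.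
exists (Num.min (f x) e) => [|y]; first by rewrite lt_min e0 H ?mem_head.
by rewrite inE => /orP[/eqP ->|/eP ey]; rewrite ge_min ?lexx // ey orbT.
Qed.

(** A denominator that is regular in [V] could vanish on the whole slice, hence the condition at the
    centres [c]. The slice gets two kinds of charts: [Some c] is the fraction on a disc about [c],
    and [None] is the set of regular points with denominator 1. The latter ties the zeros of [q]
    exactly to the points that are not regular. *)
Lemma slice_clear_poles (a w : V) (K : set C) (l : seq C) (ii : C -> I) (rr : C -> R) :
  compact K -> (forall z, K z -> exists2 c, c \in l & rnorm (z - c) < rr c) ->
  (forall c, c \in l -> forall z, rnorm (z - c) < rr c -> dom (ii c) (a + z *: w)) ->
  (forall c, c \in l -> D (ii c) (a + c *: w) != 0) ->
  exists (q : {poly C}) (F : C -> C), [/\ q \is monic,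
    forall z, K z -> derivable F z 1,
    forall z, K z -> reg (a + z *: w) -> F z = q.[z] * frac (a + z *: w) &
    forall z, K z -> (q.[z] != 0 <-> reg (a + z *: w))].
Proof.
move=> cK lK ldom lD.
pose dom' (x : option C) : set C := [set z | if x is Some c then
  (c \in l) && (rnorm (z - c) < rr c) else `[< reg (a + z *: w) >]].
pose N' (x : option C) (z : C) : C :=
  if x is Some c then N (ii c) (a + z *: w) else frac (a + z *: w).
pose D' (x : option C) (z : C) : C :=
  if x is Some c then D (ii c) (a + z *: w) else 1.
have cov' z : K z -> exists x, dom' x z.
  by move=> /lK[c cl zc]; exists (Some c); rewrite /dom' /= cl.
have line_close (z y : C) : rnorm ((a + y *: w) - (a + z *: w)) = rnorm (y - z) * rnorm w.
  by rewrite opprD addrACA subrr add0r -scalerBl rnormZ.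
have open' x z : dom' x z ->
    exists2 e : R, 0 < e & forall y, rnorm (y - z) <= e -> dom' x y.
  case: x => [c|] /=.
    move=> /andP[cl zc]; exists ((rr c - rnorm (z - c)) / 2).
      by rewrite divr_gt0 // subr_gt0.
    by move=> y yz; rewrite cl /=; have := rnorm_triangle y z c; lra.
  move=> /asboolP/reg_open[e e0 eP].
  have [x x0 xe] := small_of_pos (rnorm_ge0 w) e0.
  exists x => // y yx; apply/asboolP; apply: eP; rewrite line_close.
  by apply: le_lt_trans xe; rewrite mulrC ler_wpM2l ?rnorm_ge0.
have hN x z : dom' x z -> derivable (N' x) z 1.
  case: x => [c|] /= => [/andP[cl zc]|/asboolP rz]; apply/derivable_lineE.
    exact/holN/ldom.
  exact: frac_derivable.
have hD x z : dom' x z -> derivable (D' x) z 1.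
  case: x => [c|] /= => [/andP[cl zc]|/asboolP rz]; last exact: derivable_cst.
  by apply/derivable_lineE; exact/holD/ldom.
have reg' x z (e : R) : dom' x z -> 0 < e -> exists2 y, rnorm (y - z) < e & D' x y != 0.
  case: x => [c|] /= => [/andP[cl zc] e0|_ e0]; last first.
    by exists z; [rewrite subrr rnorm0|exact: oner_neq0].
  apply: contrapT => H; move: (lD c cl); rewrite (_ : D _ _ = D' (Some c) c) //.
  rewrite (@identity_theorem R C (D' (Some c)) c (rr c) z e e0) ?eqxx //.
  - by apply: hol_on_derivable1 => y yc; apply: hD; rewrite /dom' /= cl.
  - move=> y yz; apply/eqP/negPn/negP => Dy; apply: H; exists y => //.
  - by rewrite /rball /= subrr rnorm0 (le_lt_trans (rnorm_ge0 _) zc).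
have compat' x y z : dom' x z -> dom' y z -> N' x z * D' y z = N' y z * D' x z.
  case: x => [c|]; case: y => [c'|] //=.
  - by move=> /andP[cl zc] /andP[cl' zc']; apply: compat; exact: ldom.
  - by move=> /andP[cl zc] /asboolP rz; rewrite mulr1 fracE //; exact: ldom.
  - by move=> /asboolP rz /andP[cl zc]; rewrite mulr1 fracE //; exact: ldom.
have [q [F [mq dF FE q1 q2]]] := clear_poles cK cov' open' hN hD reg' compat'.
exists q, F; split => //.
  move=> z Kz rz; have := FE z None Kz; rewrite /= mulr1; apply.
  exact/asboolP.
move=> z Kz; split.
  move=> qz; have [[c|] /=] := q2 z Kz qz; last by move=> /asboolP.
  by move=> /andP[cl zc] Dz; exists (ii c); split => //; exact: ldom.
move=> rz; apply: (q1 z None Kz); first exact/asboolP.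
exact: oner_neq0.
Qed.

(* With [al = 0] and [be = 1], [p] is the direction of a line through the origin;
   with [al = 1] and [be = 0] it is the base point of a line of direction [b]. *)
Lemma perturb_line (K : set C) (al be : C) (b p0 : V) (eta : R) : compact K -> K !=set0 ->
  (forall z, K z -> al + be * z != 0) ->
  (forall z, K z -> U (al *: p0 + z *: (be *: p0 + b))) -> 0 < eta ->
  exists (p : V) (d : R) (l : seq C) (ii : C -> I) (rr : C -> R),
  [/\ 0 < d, forall p', rnorm (p' - p) < d -> rnorm (p' - p0) < eta,
    forall z, K z -> exists2 c, c \in l & rnorm (z - c) < rr c,
    forall p', rnorm (p' - p) < d -> forall c, c \in l -> forall z,
      rnorm (z - c) < rr c -> dom (ii c) (al *: p' + z *: (be *: p' + b)) &
    forall p', rnorm (p' - p) < d -> forall c, c \in l ->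
      D (ii c) (al *: p' + c *: (be *: p' + b)) != 0].
Proof.
move=> cK [z0 Kz0] K0 KU eta0; pose Phi z p := al *: p + z *: (be *: p + b).
have PhiE z p : Phi z p = (al + be * z) *: p + z *: b.
  by rewrite /Phi scalerDr scalerA addrA -scalerDl (mulrC z).
have Phi_sub z p p' : Phi z p' - Phi z p = (al + be * z) *: (p' - p).
  by rewrite !PhiE opprD addrACA subrr addr0 scalerBr.
have loc z : K z -> exists x : I * R * R, [/\ 0 < x.1.2, 0 < x.2 &
    forall y p', rnorm (y - z) < x.1.2 -> rnorm (p' - p0) < x.2 -> dom x.1.1 (Phi y p')].
  move=> Kz; have [i iz] := cover (KU z Kz); have [e e0 eP] := dom_open iz.
  have e2 : 0 < e / 2 by rewrite divr_gt0.
  have [r1 r10 r1P] := small_of_pos (rnorm_ge0 (be *: p0 + b)) e2.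
  have q0 : 0 <= rnorm al + rnorm be * (rnorm z + 1).
    by rewrite addr_ge0 ?mulr_ge0 ?addr_ge0 ?rnorm_ge0.
  have [s s0 sP] := small_of_pos q0 e2.
  exists (i, Num.min r1 1, s) => /=; split => //; first by rewrite lt_min r10 ltr01.
  move=> y p'; rewrite lt_min => /andP[yr y1] ps; apply: eP.
  have -> : Phi y p' - Phi z p0 = (al + be * y) *: (p' - p0) + (y - z) *: (be *: p0 + b).
    have E : Phi y p0 - Phi z p0 = (y - z) *: (be *: p0 + b).
      by rewrite /Phi opprD addrACA subrr add0r -scalerBl.
    by rewrite -Phi_sub -E addrA subrK.
  rewrite (le_lt_trans (rnormD _ _)) // (splitr e) ltrD //.
    rewrite rnormZ; apply: le_lt_trans sP; apply: ler_pM; rewrite ?rnorm_ge0 //; last exact: ltW.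
    rewrite (le_trans (rnormD _ _)) // lerD2l rnormM ler_wpM2l ?rnorm_ge0 //.
    by have := rnormD (y - z) z; rewrite subrK; lra.
  rewrite rnormZ mulrC; apply: le_lt_trans r1P; rewrite ler_wpM2l ?rnorm_ge0 //.
  exact: ltW.
have [x0 _] := loc z0 Kz0.
have : forall z, exists x : I * R * R, K z -> [/\ 0 < x.1.2, 0 < x.2 &
    forall y p', rnorm (y - z) < x.1.2 -> rnorm (p' - p0) < x.2 -> dom x.1.1 (Phi y p')].
  move=> z; have [Kz|nK] := pselect (K z); last by exists x0.
  by have [x xP] := loc z Kz; exists x.
move=> /choice[dat datP].
have dat0 z : K z -> 0 < (dat z).1.2 by move=> /datP[].
have [l [lK lcov]] := compact_cover_balls cK dat0.
have dat2 z : z \in l -> 0 < (dat z).2 by move=> /lK/datP[].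
have [m1 m10 m1P] := seq_pos_min dat2.
pose m := Num.min m1 eta.
have m0 : 0 < m by rewrite lt_min m10.
have domP p' c z : rnorm (p' - p0) < m -> c \in l -> rnorm (z - c) < (dat c).1.2 ->
    dom (dat c).1.1 (Phi z p').
  move=> pm cl zc; have [_ _] := datP c (lK c cl); apply => //.
  by move: pm; rewrite lt_min => /andP[pm1 _]; apply: lt_le_trans pm1 _; exact: m1P.
(* The denominators are made nonzero at the centres one after another; each condition is open, so it
   survives the later, smaller perturbations. *)
have : forall l' : seq C, {subset l' <= l} -> exists p, exists2 d : R, 0 < d &
    forall p', rnorm (p' - p) < d -> rnorm (p' - p0) < m /\
      forall c, c \in l' -> D (dat c).1.1 (Phi c p') != 0.
  elim=> [_|c l' IH sub]; first by exists p0, m.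
  have [|p [d d0 dP]] := IH; first by move=> y yl; apply: sub; rewrite inE yl orbT.
  have cl : c \in l by apply: sub; rewrite mem_head.
  have Kc := lK c cl; set k := al + be * c; have k0 : k != 0 by exact: K0.
  have kp : 0 < rnorm k by rewrite rnorm_gt0.
  have [pm _] : rnorm (p - p0) < m /\ (forall c, c \in l' -> D (dat c).1.1 (Phi c p) != 0).
    by apply: dP; rewrite subrr rnorm0.
  have cc : rnorm (c - c) < (dat c).1.2 by rewrite subrr rnorm0 dat0.
  have dp := domP p c c pm cl cc.
  have [y [yp iy Dy]] := regular dp (mulr_gt0 kp d0).
  (* The solution of [Phi c p1 = y], where [y] is a nearby point with nonzero denominator. *)
  pose p1 := p + k^-1 *: (y - Phi c p).
  have p1p : rnorm (p1 - p) < d.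
    by rewrite /p1 addrC addKr rnormZ rnormV ltr_pdivrMl.
  have Ep1 : Phi c p1 = y.
    apply/eqP; rewrite -subr_eq0 -(subrK (Phi c p) (Phi c p1)) Phi_sub -/k /p1.
    by rewrite (addrC p) addrK scalerA divff // scale1r subrK subrr.
  have [e e0 eP] := nonzero_nbhs iy Dy.
  have [x x1 xe] := small_of_pos (ltW kp) e0.
  exists p1, (Num.min (d - rnorm (p1 - p)) x); first by rewrite lt_min x1 subr_gt0 p1p.
  move=> p'; rewrite lt_min => /andP[p'd p'x].
  have p'p : rnorm (p' - p) < d by have := rnorm_triangle p' p1 p; lra.
  have [p'm Dl'] := dP p' p'p; split => // c'; rewrite inE => /orP[/eqP ->|/Dl' //].
  have [] // := eP (Phi c p'); rewrite -Ep1 Phi_sub rnormZ -/k.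
  by apply: le_lt_trans xe; rewrite ler_pM2l // ltW.
move=> /(_ l (fun x => id)) [p [d d0 dP]].
exists p, d, l, (fun c => (dat c).1.1), (fun c => (dat c).1.2); split => //.
- by move=> p' /dP[+ _]; rewrite lt_min => /andP[].
- by move=> p' /dP[p'm _] c cl z zc; exact: domP.
- by move=> p' /dP[_ +] c cl; apply.
Qed.

End Fractions.

(** * Extension across the origin *)

Section RowVectors.
Variables (R : realType) (m : nat).
Local Notation C := R[i].
Local Notation V := 'rV[C]_m.

Lemma rnorm_rV_lt (z : V) (e : R) : 0 < e ->
  rnorm z < e <-> forall j, rnorm (z 0 j) < e.
Proof.
move=> e0; have ec : 0 < e%:C :> C by rewrite ltcR.
have E : rnorm z < e <-> ball (0 : V) e%:C z.
  by rewrite mx_norm_ball /ball_ /= sub0r normrN rnorm_lt.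
rewrite E; split=> [H j|H].
  have [_ /(_ 0 j)] := H.
  by rewrite -ball_normE /= mxE sub0r normrN rnorm_lt.
split=> // i j; rewrite (ord1 i) -ball_normE /= mxE sub0r normrN rnorm_lt.
exact: H.
Qed.

Lemma rnorm_coord (z : V) j : rnorm (z 0 j) <= rnorm z.
Proof.
apply/ler_addgt0Pl => e e0; apply: ltW; rewrite addrC.
have p : 0 < rnorm z + e by rewrite ltr_wpDl // rnorm_ge0.
by have /(rnorm_rV_lt _ p) := (ltr_pwDr e0 (lexx (rnorm z))); apply.
Qed.

Lemma rnorm_rV_le (z : V) (e : R) : 0 <= e -> (forall j, rnorm (z 0 j) <= e) -> rnorm z <= e.
Proof.
move=> e0 ze; apply/ler_addgt0Pl => d d0; apply: ltW.
have p : 0 < d + e by rewrite ltr_wpDr.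
by apply/(rnorm_rV_lt _ p) => j; rewrite (le_lt_trans (ze j)) // ltrDr.
Qed.

End RowVectors.

Section Circles.
Variables (R : realType) (V : normedModType R[i]).
Local Notation C := R[i].

Lemma compact_circle (r : R) : compact [set z : C | rnorm z = r].
Proof.
apply: (subclosed_compact _ (@compact_disc R r)); last by move=> z /= ->.
rewrite -[X in closed X]setCK; apply: open_closedC; apply/openP => z /= zr.
exists `|rnorm z - r| => [|y yz]; first by rewrite normr_gt0 subr_eq0; apply/eqP.
by move=> yr; have := rnorm_dist y z; rewrite yr distrC leNgt yz.
Qed.

Lemma continuous_line (T : topologicalType) (g : T -> C) (w d : V) (t : T) :
  {for t, continuous g} -> {for t, continuous (fun t => w + g t *: d)}.
Proof.
move=> /cvg_rnormP cg; apply/cvg_rnormP => e e0.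
have [x x0 xe] := small_of_pos (rnorm_ge0 d) e0.
apply: filterS (cg x x0) => s gs.
rewrite opprD addrACA subrr add0r -scalerBl rnormZ mulrC.
by apply: le_lt_trans xe; rewrite ler_wpM2l ?rnorm_ge0 // ltW.
Qed.

(** Finitely many local estimates cover the circle by compactness; the sum of their bounds serves
    for all of them. *)
Lemma circle_tube (f : V -> C) (G : set V) (d : V) (r : R) :
  (forall z, rnorm z = r -> G (z *: d)) ->
  (forall z, G z -> exists2 e : R, 0 < e & forall y, rnorm (y - z) < e -> G y) ->
  (forall z, G z -> {for z, continuous f}) ->
  exists (e A : R), 0 < e /\ forall w z, rnorm w < e -> rnorm z = r ->
    G (w + z *: d) /\ rnorm (f (w + z *: d)) <= A.
Proof.
move=> Gd oG cf.
have loc z : rnorm z = r -> exists x : R * R, [/\ 0 < x.1, 0 < x.2 &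
    forall w y, rnorm w < x.2 -> rnorm (y - z) < x.1 ->
    G (w + y *: d) /\ rnorm (f (w + y *: d)) <= rnorm (f (z *: d)) + 1].
  move=> zr; have [e e0 eP] := oG _ (Gd z zr).
  have /continuous_rnormP/(_ _ (ltr01 : 0 < 1 :> R))[s s0 sP] := cf _ (Gd z zr).
  pose k := Num.min e s; have k2 : 0 < k / 2 by rewrite divr_gt0 // lt_min e0.
  have [x x0 xk] := small_of_pos (rnorm_ge0 d) k2.
  exists (x, k / 2); split => // w y wk yx.
  have H : rnorm (w + y *: d - z *: d) < k.
    rewrite -addrA -scalerBl (le_lt_trans (rnormD _ _)) // (splitr k) ltrD //.
    by rewrite rnormZ mulrC; apply: le_lt_trans xk; rewrite ler_wpM2l ?rnorm_ge0 // ltW.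
  move: H; rewrite lt_min => /andP[/eP Gy /sP fy]; split => //.
  by have := rnormD (f (w + y *: d) - f (z *: d)) (f (z *: d)); rewrite subrK; lra.
have : forall z, exists x : R * R, rnorm z = r -> [/\ 0 < x.1, 0 < x.2 &
    forall w y, rnorm w < x.2 -> rnorm (y - z) < x.1 ->
    G (w + y *: d) /\ rnorm (f (w + y *: d)) <= rnorm (f (z *: d)) + 1].
  move=> z; have [zr|nz] := pselect (rnorm z = r); last by exists (0, 0).
  by have [x xP] := loc z zr; exists x.
move=> /choice[x xP].
have x10 z : [set z : C | rnorm z = r] z -> 0 < (x z).1 by move=> /xP[].
have [l [lK lcov]] := compact_cover_balls (@compact_circle r) x10.
have x20 c : c \in l -> 0 < (x c).2 by move=> /lK/xP[].
have [e e0 eP] := seq_pos_min x20.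
exists e, (\sum_(c <- l) (rnorm (f (c *: d)) + 1)); split => // w z we zr.
have [c cl zc] := lcov z zr; have [_ _ H] := xP c (lK c cl).
have [Gz fz] := H w z (lt_le_trans we (eP c cl)) zc.
split => //; apply: (le_trans fz); rewrite (big_rem c cl) /= lerDl.
by apply: sumr_ge0 => i _; rewrite addr_ge0 ?rnorm_ge0.
Qed.

(** There are infinitely many candidate radii [rho k] and only finitely many roots. *)
Lemma avoid_roots (q : {poly C}) : q != 0 ->
  exists2 r : R, 1 / 2 <= r <= 1 & forall z, rnorm z = r -> q.[z] != 0.
Proof.
move=> q0; apply: contrapT => H.
pose rho (k : nat) : R := 1 / 2 + (2 * k.+1%:R)^-1.
have rho_in k : 1 / 2 <= rho k <= 1.
  rewrite /rho lerDl invr_ge0 mulr_ge0 //=.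
  have : (2 * k.+1%:R)^-1 <= 2^-1 :> R.
    by rewrite lef_pV2 ?posrE ?mulr_gt0 // ler_pMr // ler1n.
  by rewrite div1r => h; rewrite [leRHS](splitr 1) mul1r lerD2l.
have rho_inj : injective rho.
  move=> i j; rewrite /rho => /addrI /invr_inj /(mulfI _) /wrap[] //.
  by move=> /eqP; rewrite eqr_nat => /eqP [].
have : forall k, exists z, rnorm z = rho k /\ root q z.
  move=> k; apply: contrapT => /forallNP Hk; apply: H; exists (rho k) => // z zk.
  by apply/negP => qz; apply: (Hk z).
move=> /choice[z zP].
have := q0; rewrite (@roots_geq_poly_eq0 _ q [seq z k | k <- iota 0 (size q)]) ?eqxx //.
- by apply/allP => _ /mapP[k _ ->]; have [] := zP k.
- rewrite map_inj_uniq ?iota_uniq // => i j zij; apply: rho_inj.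
  by have [<- _] := zP i; have [<- _] := zP j; rewrite zij.
- by rewrite size_map size_iota.
Qed.

Lemma cmean_lin (n : nat) (a : 'I_n -> C) (f : 'I_n -> C -> C) (r : R) : 0 <= r ->
  (forall i z, rnorm z = r -> {for z, continuous (f i)}) ->
  cmean (fun z => \sum_i a i * f i z) r = \sum_i a i * cmean (f i) r.
Proof.
move=> r0; elim: n a f => [|n IH] a f cf.
  by rewrite big_ord0 -[RHS](cmean_cst _ r); apply: eq_cmean => // z _; rewrite big_ord0.
have c1 z : rnorm z = r -> {for z, continuous (fun z : C => a ord0 * f ord0 z)}.
  move=> zr; apply: (@continuousM _ _ (fun=> a ord0) (f ord0)); last exact: cf.
  exact: cst_continuous.
have c2 z : rnorm z = r ->
    {for z, continuous (fun z : C => \sum_i a (lift ord0 i) * f (lift ord0 i) z)}.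
  move=> zr; clear IH c1; elim: n a f cf => [|n IH] a f cf.
    rewrite (_ : (fun z : C => _) = fun=> 0); first exact: cst_continuous.
    by apply/funext => y; rewrite big_ord0.
  rewrite (_ : (fun z : C => _) = fun z => a (lift ord0 ord0) * f (lift ord0 ord0) z +
     \sum_i a (lift ord0 (lift ord0 i)) * f (lift ord0 (lift ord0 i)) z); last first.
    by apply/funext => y; rewrite big_ord_recl.
  apply: (@continuousD _ _ _ (fun z => a (lift ord0 ord0) * f (lift ord0 ord0) z)).
    apply: (@continuousM _ _ (fun=> a (lift ord0 ord0)) (f (lift ord0 ord0))).
      exact: cst_continuous.
    exact: cf.
  exact: (IH (fun i => a (lift ord0 i)) (fun i => f (lift ord0 i)) (fun i => cf (lift ord0 i))).
rewrite big_ord_recl -IH; last by move=> i; exact: cf.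
rewrite -(cmeanZ _ r0 (cf ord0)) -(cmeanD r0 c1 c2).
by apply: eq_cmean => // z _; rewrite big_ord_recl.
Qed.

End Circles.

HB.instance Definition _ (R : realType) m n := Complete.on 'M[R]_(m, n).

(** * Simultaneous nonvanishing by Baire's theorem *)

Section BaireNonzero.
Variables (R : realType) (m : nat).
Local Notation C := R[i].
Local Notation V := 'rV[C]_m.

(** Complex row vectors are identified with real matrices of two rows, a complete space. The
    functions are controlled only on a ball, so the region [e1 < rnorm z] is added to each
    nonvanishing set to make it dense everywhere; it does not meet the ball about [w]. *)
Lemma common_nonzero (g : nat -> V -> C) (e e1 d : R) (w : V) : 0 < e -> 0 < d -> e1 < e ->
  (forall n, bhol (rball 0 e) (g n)) ->
  (forall n, exists2 z, rball 0 e z & g n z != 0) ->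
  (forall z, rball w d z -> rnorm z < e1) ->
  exists2 z, rball w d z & forall n, g n z != 0.
Proof.
move=> e0 d0 e1e hg g0 we1.
pose U := 'M[R]_(2, m).
pose iota (A : U) : V := \row_j (A 0 j +i* A 1 j).
have iotaB A B : iota A - iota B = iota (A - B).
  by apply/rowP => j; rewrite !mxE; apply/eqP; rewrite eq_complex /= !eqxx.
have norm_lt (A : U) (r : R) : 0 < r -> `|A| < r <-> forall i j, `|A i j| < r.
  move=> r0; have -> : `|A| < r <-> ball (0 : U) r A.
    by rewrite mx_norm_ball /ball_ /= sub0r normrN.
  split=> [[_ H] i j|H].
    by have := H i j; rewrite -ball_normE /= mxE sub0r normrN.
  by split=> // i j; rewrite -ball_normE /= mxE sub0r normrN.
have iota_lt (A : U) (r : R) : 0 < r -> `|A| < r -> rnorm (iota A) < 2 * r.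
  move=> r0 /(norm_lt _ _ r0) Ar; apply/rnorm_rV_lt; first by rewrite mulr_gt0.
  move=> j; rewrite mxE (le_lt_trans (rnorm_le_ReIm _)) //=.
  by have := Ar 0 j; have := Ar 1 j; lra.
have lift_lt (z : V) (r : R) : 0 < r -> rnorm z < r -> exists2 A : U, iota A = z & `|A| < r.
  move=> r0 /(rnorm_rV_lt _ r0) zr.
  exists (\matrix_(i, j) if i == 0 then complex.Re (z 0 j) else complex.Im (z 0 j)).
    by apply/rowP => j; rewrite !mxE /=; case: (z 0 j).
  apply/norm_lt => // i j; rewrite mxE; case: ifP => _.
    exact: le_lt_trans (Re_le_rnorm _) (zr j).
  exact: le_lt_trans (Im_le_rnorm _) (zr j).
have open_iota (S : set V) : (forall z, S z -> exists2 r : R, 0 < r &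
    forall y, rnorm (y - z) < r -> S y) -> open (iota @^-1` S).
  move=> oS; rewrite openE => A /= /oS[r r0 rS]; apply/nbhs_ballP.
  exists (r / 2) => /=; first by rewrite divr_gt0.
  move=> B; rewrite -ball_normE /= distrC => AB; apply: rS.
  have -> : r = 2 * (r / 2) by field.
  by rewrite iotaB; apply: iota_lt; rewrite ?divr_gt0.
pose F n : set U := iota @^-1` [set z | e1 < rnorm z \/ rball 0 e z /\ g n z != 0].
suff dF : dense (\bigcap_i F i).
  have [||A [/= Aw AF]] := dF (iota @^-1` (rball w d)).
  - have [A Aw _] := lift_lt w (rnorm w + 1) (ltr_wpDl (rnorm_ge0 _) ltr01)
      (ltr_pwDr ltr01 (lexx _)).
    by exists A; rewrite /= Aw; exact: rball_center.
  - apply: open_iota => z zw; exists (d - rnorm (z - w)) => [|y yz].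
      by rewrite subr_gt0.
    by have := rnorm_triangle y z w; rewrite /rball /=; lra.
  exists (iota A) => // n; have [|[]//] := AF n I.
  by move=> H; have := we1 _ Aw; lra.
apply: Baire => n; split.
  apply: open_iota => z [ze1|[ze gz]].
    exists (rnorm z - e1) => [|y yz]; first by rewrite subr_gt0.
    left; have := rnormD y (z - y); rewrite subrKC -(rnormN (z - y)) opprB; lra.
  have [hgn [B gB]] := hg n.
  have /continuous_rnormP cg := hol_bounded_continuous hgn gB ze.
  have gp : 0 < rnorm (g n z) by rewrite rnorm_gt0.
  have [s s0 sP] := cg _ gp.
  exists (Num.min s (e - rnorm (z - 0))) => [|y]; first by rewrite lt_min s0 subr_gt0.
  rewrite lt_min => /andP[ys ye]; right; split.
    by have := rnorm_triangle y z 0; rewrite /rball /=; lra.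
  by apply: contraTneq (sP y ys) => ->; rewrite sub0r rnormN ltxx.
move=> O [A OA] oO.
have [H|H] := ltP e1 (rnorm (iota A)); first by exists A; split => //; left.
have Ae : rball 0 e (iota A) by rewrite /rball /= subr0 (le_lt_trans H).
have : nbhs A O by apply: open_nbhs_nbhs.
move=> /nbhs_ballP[r /= r0 rO]; have [z0 z0e gz0] := g0 n.
have [z [zA ze gz]] := hol_dense_nonzero (hg n).1 z0e gz0 Ae r0.
have [B Bz Br] := lift_lt _ _ r0 zA.
exists (A + B); split.
  by apply: rO; rewrite -ball_normE /= opprD addrA subrr sub0r normrN.
right; have -> : iota (A + B) = z.
  by apply/eqP; rewrite -(subrK (iota A) z) -Bz -subr_eq iotaB (addrC A) addrK.
by [].
Qed.

End BaireNonzero.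

(** * Levi extension by moments *)

Section Levi.
Variables (R : realType) (m : nat) (I : Type).
Local Notation C := R[i].
Local Notation V := 'rV[C]_m.
Variables (dom : I -> set V) (N D : I -> V -> C).
Let U : set V := [set z | forall j k, z 0 j = 0 -> z 0 k = 0 -> j = k].
Hypothesis cover : forall z, U z -> exists i, dom i z.
Hypothesis dom_open : forall i z, dom i z ->
  exists2 e : R, 0 < e & forall y, rnorm (y - z) < e -> dom i y.
Hypothesis holN : forall i, hol_on (dom i) (N i).
Hypothesis holD : forall i, hol_on (dom i) (D i).
Hypothesis contN : forall i z, dom i z -> {for z, continuous (N i)}.
Hypothesis contD : forall i z, dom i z -> {for z, continuous (D i)}.
Hypothesis regular : forall i z (e : R), dom i z -> 0 < e ->
  exists y, [/\ rnorm (y - z) < e, dom i y & D i y != 0].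
Hypothesis compat : forall i j z, dom i z -> dom j z -> N i z * D j z = N j z * D i z.

Local Notation reg := (reg dom D).
Local Notation frac := (frac dom N D).

(** Nonzero multiples of (1, ..., 1) have no zero coordinate, so an annulus on this line lies in
    [U]. A perturbation of size less than 1 makes denominators regular on it and keeps all
    coordinates of [d] nonzero; a circle in the annulus then avoids the roots of the common
    denominator. *)
Lemma regular_direction : exists (d : V) (r : R), [/\ 0 < r, forall j, d 0 j != 0 &
  forall z, rnorm z = r -> reg (z *: d)].
Proof.
pose K := [set z : C | 1 / 2 <= rnorm z <= 1].
have h0 : 0 < 1 / 2 :> R by rewrite divr_gt0.
have cK : compact K.
  apply: (subclosed_compact _ (@compact_disc R 1)); last by move=> z /= /andP[].
  rewrite -[X in closed X]setCK; apply: open_closedC; apply/openP => z /= zK.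
  have [H|H] := ltP (rnorm z) (1 / 2).
    exists (1 / 2 - rnorm z) => [|y yz]; first by rewrite subr_gt0.
    by move=> /andP[yr _]; have := rnorm_dist y z; rewrite ler_norml => /andP[_ ?]; lra.
  exists (rnorm z - 1) => [|y yz].
    by rewrite subr_gt0 ltNge; apply/negP => z1; apply: zK; rewrite /K /= H z1.
  by move=> /andP[_ yr]; have := rnorm_dist y z; rewrite ler_norml => /andP[? _]; lra.
have Kn : K !=set0 by exists 1; rewrite /K /= rnorm1 lexx andbT; lra.
have K0 z : K z -> 0 + 1 * z != 0.
  by move=> /andP[zr _]; rewrite add0r mul1r -rnorm_gt0; lra.
have KU z : K z -> U (0 *: const_mx 1 + z *: (1 *: const_mx 1 + 0)).
  move=> /K0; rewrite add0r mul1r => zn0 j k /eqP.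
  by rewrite scale0r add0r addr0 scale1r !mxE mulr1 (negPf zn0).
have [p [d [l [ii [rr [d0 pd lcov ldom lD]]]]]] := perturb_line cover dom_open contD regular cK Kn K0 KU (ltr01 : 0 < 1 :> R).
have E c : 0 *: p + c *: (1 *: p + 0) = 0 + c *: p by rewrite scale0r addr0 scale1r.
have pp : rnorm (p - p) < d by rewrite subrr rnorm0.
have [q [F [mq _ _ qreg]]] := slice_clear_poles dom_open holN holD contD compat cK lcov
  (fun c cl z zc => eq_ind _ (dom (ii c)) (ldom p pp c cl z zc) _ (E z))
  (fun c cl => eq_ind _ (fun x => D (ii c) x != 0) (lD p pp c cl) _ (E c)).
have [r rK rq] := avoid_roots (monic_neq0 mq).
exists p, r; split.
- by case/andP: rK => rK _; lra.
- move=> j; apply/negP => /eqP pj.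
  have := le_lt_trans (rnorm_coord (p - const_mx 1) j) (pd p pp).
  by rewrite !mxE pj sub0r rnormN rnorm1 ltxx.
- move=> z zr; have Kz : K z by rewrite /K /= zr.
  by have := rq z zr; rewrite qreg // add0r.
Qed.

Lemma polar_lines (d : V) (r e : R) : 0 < r -> 0 < e -> (forall j, d 0 j != 0) ->
  exists (w : V) (s : R), [/\ 0 < s, forall v, rnorm (v - w) < s -> rnorm v < e,
    exists2 y, rnorm (y - w) < s & reg y &
    forall v, rnorm (v - w) < s -> exists (q : {poly C}) (F : C -> C), [/\ q \is monic,
      forall z, rnorm z <= r -> derivable F z 1,
      forall z, rnorm z <= r -> reg (v + z *: d) -> F z = q.[z] * frac (v + z *: d) &
      forall z, rnorm z <= r -> (q.[z] != 0 <-> reg (v + z *: d))]].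
Proof.
(* The j-th coordinate of [w1 + z *: d] is (x j + z) d_j. It vanishes only at z = - x j, and these
   parameters are distinct, so the whole line stays in [U]. *)
move=> r0 e0 dn0; pose w0 : V := \row_j (j%:R * d 0 j).
have [x x0 xe] := small_of_pos (rnorm_ge0 w0) e0.
pose w1 := x%:C *: w0.
have w1e : rnorm w1 < e by rewrite /w1 rnormZ rnorm_real gtr0_norm // mulrC.
pose K := [set z : C | rnorm z <= r].
have Kn : K !=set0 by exists 0; rewrite /K /= rnorm0 ltW.
have K0 z : K z -> 1 + 0 * z != 0 by rewrite mul0r addr0 oner_neq0.
have KU z : K z -> U (1 *: w1 + z *: (0 *: w1 + d)).
  move=> _ j k; rewrite /w1 !mxE !mul1r !mul0r !add0r => /eqP Ej /eqP Ek.
  have xn0 : x%:C != 0 :> C by rewrite gt_eqF // ltcR.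
  have H (i : 'I_m) : x%:C * (i%:R * d 0 i) + z * d 0 i == 0 -> x%:C * i%:R = - z.
    by rewrite mulrA -mulrDl mulf_eq0 (negPf (dn0 i)) orbF addr_eq0 => /eqP.
  have := etrans (H j Ej) (esym (H k Ek)) => /(mulfI xn0)/eqP.
  by rewrite eqr_nat => /eqP/val_inj.
have eta0 : 0 < e - rnorm w1 by rewrite subr_gt0.
have [p [s [l [ii [rr [s0 pd lcov ldom lD]]]]]] := perturb_line cover dom_open contD regular (@compact_disc R r) Kn K0 KU eta0.
have E v c : 1 *: v + c *: (0 *: v + d) = v + c *: d by rewrite scale0r add0r scale1r.
have pp : rnorm (p - p) < s by rewrite subrr rnorm0.
exists p, s; split => //.
- by move=> v /pd; have := rnormD (v - w1) w1; rewrite subrK; lra.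
- have [c cl c0] := lcov 0 (eq_ind_r (fun x => x <= r) (ltW r0) (rnorm0 C)).
  have := ldom p pp c cl 0 c0; rewrite E scale0r addr0 => cp.
  by have [y [ys cy Dy]] := regular cp s0; exists y => //; exists (ii c).
- move=> v vp.
  have [q [F [mq hF Fq qreg]]] := slice_clear_poles dom_open holN holD contD compat (@compact_disc R r) lcov
   (fun c cl z zc => eq_ind _ (dom (ii c)) (ldom v vp c cl z zc) _ (E v z))
   (fun c cl => eq_ind _ (fun x => D (ii c) x != 0) (lD v vp c cl) _ (E v c)).
  by exists q, F.
Qed.

Section Moments.
Variables (d : V) (r e A : R).
Hypothesis r0 : 0 < r.
Hypothesis e0 : 0 < e.
Hypothesis tube : forall w z, rnorm w < e -> rnorm z = r ->
  reg (w + z *: d) /\ rnorm (frac (w + z *: d)) <= A.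

(** In terms of contour integrals this is the one of z^(k-1) times the function, divided by 2 i pi.
    Index 0 therefore carries an additional pole at 0, and the recurrences with right-hand side 0
    start at index 1. *)
Definition moment (k : nat) (w : V) : C := cmean (fun z => z ^+ k * frac (w + z *: d)) r.

Lemma continuous_fiber k (w : V) (z : C) : rnorm w < e -> rnorm z = r ->
  {for z, continuous (fun z : C => z ^+ k * frac (w + z *: d))}.
Proof.
move=> we zr; apply: (@continuousM _ _ (fun z : C => z ^+ k) (fun z => frac (w + z *: d))).
  by apply: derivable1_continuous; exact: derivable_exprn.
apply: (@continuous_comp _ _ _ (fun z : C => w + z *: d) frac).
  by apply: (@continuous_line R V C id w d z); exact: cvg_id.
by apply: (frac_continuous dom_open contN contD compat); have [] := tube we zr.
Qed.

Lemma moment_bhol k : bhol (rball 0 e) (moment k).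
Proof.
have bnd w z : rnorm w < e -> rnorm z = r -> rnorm (z ^+ k * frac (w + z *: d)) <= r ^+ k * A.
  move=> we zr; rewrite rnormM rnormX zr ler_wpM2l ?exprn_ge0 ?(ltW r0) //.
  by have [] := tube we zr.
split; last first.
  rewrite /rball /=; exists (2 * (r ^+ k * A)) => w; rewrite subr0 => we; apply: cmean_le (ltW r0) _ _.
    by move=> z; exact: continuous_fiber.
  by move=> t _; apply: bnd => //; rewrite rnorm_circle // ltW.
pose F (w : V) (t : R) := (r%:C * expi t) ^+ k * frac (w + (r%:C * expi t) *: d).
apply: (@hol_onM R V _ (fun=> ((2 * pi)^-1)%:C) (fun w => cint (F w) 0 (2 * pi))).
  exact: hol_on_cst.
move=> w; rewrite /rball /= subr0 => we v.
have s0 : 0 < e - rnorm w by rewrite subr_gt0.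
have [s s1 se] := small_of_pos (rnorm_ge0 v) s0.
have wz (z : C) : rnorm z <= s -> rnorm (w + z *: v) < e.
  move=> zs; rewrite (le_lt_trans (rnormD _ _)) // rnormZ.
  have : rnorm z * rnorm v <= rnorm v * s by rewrite mulrC ler_wpM2l ?rnorm_ge0.
  lra.
have pi2 : 0 <= 2 * pi :> R by rewrite mulr_ge0 // pi_ge0.
have rt t : rnorm (r%:C * expi t) = r by rewrite rnorm_circle // ltW.
apply: (@cint_derivable R V F w v 0 (2 * pi) s (r ^+ k * A) pi2 s1) => z t /wz we'.
- apply: (@derivableM _ _ (fun=> (r%:C * expi t) ^+ k)
    (fun z : C => frac (w + z *: v + (r%:C * expi t) *: d))); first exact: derivable_cst.
  rewrite (_ : (fun z : C => _) = (fun z : C => frac (w + (r%:C * expi t) *: d + z *: v))).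
    apply/derivable_lineE; apply: (frac_derivable dom_open holN holD contD compat).
    by rewrite addrAC; have [] := tube we' (rt t).
  by apply/funext => y; rewrite addrAC.
- exact: bnd.
- have ct : {for t, continuous (fun t => r%:C * expi t)}.
    apply: (@continuousM _ _ (fun=> r%:C) (@expi R)); first exact: cst_continuous.
    exact: continuous_expi.
  apply: (@continuous_comp _ _ _ (fun t => r%:C * expi t)
    (fun y : C => y ^+ k * frac (w + z *: v + y *: d)) t ct).
  exact: (@continuous_fiber k (w + z *: v) (r%:C * expi t) we' (rt t)).
Qed.

(** The sum is the circle mean of [z ^+ k * F z], which is holomorphic on the disc, hence its value
    at 0. The factor [0 ^+ k] is 1 for [k = 0]. *)
Lemma moment_recurrence (q : {poly C}) (F : C -> C) w k : rnorm w < e ->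
  (forall z, rnorm z <= r -> derivable F z 1) ->
  (forall z, rnorm z <= r -> reg (w + z *: d) -> F z = q.[z] * frac (w + z *: d)) ->
  \sum_(i < size q) q`_i * moment (k + i) w = 0 ^+ k * F 0.
Proof.
move=> we hF Fq.
have hk : hol_on_disc (fun z => z ^+ k * F z) r.
  move=> z zr; apply: (@derivableM _ _ (fun z : C => z ^+ k) F); last exact: hF.
  exact: derivable_exprn.
rewrite -(@mean_value R (fun z => z ^+ k * F z) r r r0 (hol_continuous_on_disc hk)); last first.
  by move=> z /andP[_ zr] _; exact: hk.
rewrite -(@cmean_lin R _ (fun i : 'I_(size q) => q`_i)
   (fun i z => z ^+ (k + i) * frac (w + z *: d)) r (ltW r0)); last first.
  by move=> i z; exact: continuous_fiber.
apply: eq_cmean (ltW r0) _ => z zr.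
rewrite Fq ?zr //; last by have [] := tube we zr.
rewrite horner_coef mulr_suml mulr_sumr; apply: eq_bigr => i _; rewrite exprD; ring.
Qed.

Variables (w : V) (s : R).
Hypothesis s0 : 0 < s.
Hypothesis ws : forall v, rnorm (v - w) < s -> rnorm v < e / 2.
Hypothesis regw : exists2 y, rnorm (y - w) < s & reg y.
Hypothesis lines : forall v, rnorm (v - w) < s -> exists (q : {poly C}) (F : C -> C),
  [/\ q \is monic, forall z, rnorm z <= r -> derivable F z 1,
      forall z, rnorm z <= r -> reg (v + z *: d) -> F z = q.[z] * frac (v + z *: d) &
      forall z, rnorm z <= r -> (q.[z] != 0 <-> reg (v + z *: d))].

Let e2 : e / 2 < e.
Proof. by rewrite ltr_pdivrMr // ltr_pMr // ltr1n. Qed.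

(** Otherwise each size has a minor that is not identically zero, and at one point [z] near [w] all
    of these are nonzero. Yet the line through that [z] has its own denominator [q], so minors of
    size [size q] vanish there. *)
Lemma moment_minors : exists n, forall kk jj : 'I_n -> nat, forall z, rball 0 e z ->
  \det (\matrix_(a, b) moment (kk a + jj b).+1 z) = 0.
Proof.
apply: contrapT => H.
have H1 : forall n, exists x : ('I_n -> nat) * ('I_n -> nat), exists2 z, rball 0 e z &
    \det (\matrix_(a, b) moment (x.1 a + x.2 b).+1 z) != 0.
  move=> n; apply: contrapT => Hn; apply: H; exists n => kk jj z ze.
  by apply/eqP; apply/negPn/negP => Hd; apply: Hn; exists (kk, jj), z.
pose x n := projT1 (cid (H1 n)); have xP n := projT2 (cid (H1 n)).
pose g n (z : V) := \det (\matrix_(a, b) moment ((x n).1 a + (x n).2 b).+1 z).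
have hg n : bhol (rball 0 e) (g n).
  by apply: bhol_det => i j; rewrite (_ : (fun z => _) = moment ((x n).1 i + (x n).2 j).+1);
    [exact: moment_bhol|apply/funext => z; rewrite mxE].
have [z zs gz] := common_nonzero e0 s0 e2 hg xP ws.
have [q [F [mq hF Fq _]]] := lines zs.
have ze : rnorm z < e := lt_trans (ws zs) e2.
have /eqP := gz (size q); apply; apply: (@hankel_det_eq0 C q (fun k => moment k.+1 z) (size q) (x (size q)).1 (x (size q)).2 mq _ (leqnn _)).
move=> k; have := moment_recurrence k.+1 ze hF Fq.
by rewrite expr0n /= mul0r => E; exact: E.
Qed.

(* Let [L] be the functional on polynomials with moments [moment k v], and [c] the
   polynomial with coefficients [c j v]. The hypothesis is [L (z ^+ k.+1 * c) = 0],
   and [L (z ^+ k * q) = 0 ^+ k * F 0]; computing [L (q * c)] in two ways gives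
   [frac v * c 0 v = L c]. If [c 0] vanishes identically, so does [L c], and [c]
   can be divided by [z]. *)
Lemma moment_quotient n (c : nat -> V -> C) :
  (forall j, bhol (rball 0 e) (c j)) ->
  (exists j, (j < n)%N /\ exists2 z, rball 0 e z & c j z != 0) ->
  (forall k z, rball 0 e z -> \sum_(j < n) c j z * moment (k + j).+1 z = 0) ->
  exists P Q, [/\ bhol (rball 0 e) P, bhol (rball 0 e) Q, exists2 z, rball 0 e z & Q z != 0 &
    forall v, rnorm (v - w) < s -> reg v -> P v = frac v * Q v].
Proof.
elim: n c => [|n IH] c hc [j [jn cj]] rel; first by [].
pose P z := \sum_(j < n.+1) c j z * moment j z.
have hP : bhol (rball 0 e) P.
  by apply: bhol_sum => i; apply: bholM; [exact: hc|exact: moment_bhol].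
have PE v : rnorm (v - w) < s -> reg v -> P v = frac v * c 0%N v.
  move=> vs rv; have [q [F [mq hF Fq qreg]]] := lines vs.
  have ve : rnorm v < e := lt_trans (ws vs) e2.
  have vb : rball 0 e v by rewrite /rball /= subr0.
  have r00 : rnorm (0 : C) <= r by rewrite rnorm0 ltW.
  have rv0 : reg (v + 0 *: d) by rewrite scale0r addr0.
  have q0 : q.[0] != 0 by apply/qreg.
  have F0 : F 0 = q.[0] * frac v by rewrite Fq // scale0r addr0.
  have S1 : \sum_(j < n.+1) \sum_(i < size q) c j v * (q`_i * moment (j + i) v) = c 0%N v * F 0.
    rewrite big_ord_recl /= [X in _ + X]big1 => [|j0 _].
      by rewrite addr0 -mulr_sumr (moment_recurrence 0 ve hF Fq) expr0 mul1r.
    by rewrite -mulr_sumr (moment_recurrence _ ve hF Fq) expr0n /= mul0r mulr0.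
  have S2 : \sum_(j < n.+1) \sum_(i < size q) c j v * (q`_i * moment (j + i) v) = q.[0] * P v.
    rewrite exchange_big /= horner_coef0.
    have : (0 < size q)%N by rewrite size_poly_gt0 monic_neq0.
    case: (size q) => // k _; rewrite big_ord_recl /= [X in _ + X]big1 => [|i _].
      by rewrite addr0 mulr_sumr; apply: eq_bigr => i _; rewrite addn0; ring.
    under eq_bigr => j0 _ do rewrite mulrCA /bump add1n addnS addnC.
    by rewrite -mulr_sumr rel // mulr0.
  by apply: (mulfI q0); rewrite -S2 S1 F0; ring.
have [Q0|nQ0] := pselect (forall z, rball 0 e z -> c 0%N z = 0); last first.
  exists P, (c 0%N); split => //; apply: contrapT => H; apply: nQ0 => z ze.
  by apply/eqP; apply/negPn/negP => cz; apply: H; exists z.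
have P0 : forall z, rball 0 e z -> P z = 0.
  have [y ys ry] := regw; have [t t0 tP] := reg_open dom_open contD compat ry.
  have sy : 0 < s - rnorm (y - w) by rewrite subr_gt0.
  have k0 : 0 < Num.min t (s - rnorm (y - w)) by rewrite lt_min t0 sy.
  have ye : rball 0 e y by rewrite /rball /= subr0 (lt_trans (ws ys) e2).
  apply: (identity_theorem k0 hP.1 ye) => z; rewrite /rball /= lt_min => /andP[zt zs].
  have zw : rnorm (z - w) < s by have := rnorm_triangle z y w; lra.
  rewrite (PE z zw (tP z zt)).
  have ze : rball 0 e z by rewrite /rball /= subr0 (lt_trans (ws zw) e2).
  by rewrite (Q0 z ze) mulr0.
apply: (IH (fun j => c j.+1)) => [j0||k z ze].
- exact: hc.
- case: j jn cj => [|j] jn [z ze cz]; first by rewrite Q0 // eqxx in cz.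
  by exists j; split => //; exists z.
(* After the shift of coefficients, the new relation for index 0 is the vanishing of [P]; the others
   are old relations. *)
- case: k => [|k].
    have := P0 z ze; rewrite /P big_ord_recl /= Q0 // mul0r add0r => {2}<-.
    by apply: eq_bigr.
  have := rel k z ze; rewrite big_ord_recl /= Q0 // mul0r add0r => {2}<-.
  by apply: eq_bigr => i _; rewrite /bump add1n addnS addSn.
Qed.

End Moments.

(** The quotient is compared with the function only on a small ball; the identity theorem later
    carries its consequences to a ball about the origin. *)
Lemma levi_extension : exists (P Q : V -> C) (e : R) (y : V) (t : R),
  [/\ 0 < e, 0 < t, bhol (rball 0 e) P /\ bhol (rball 0 e) Q,
      exists2 z, rball 0 e z & Q z != 0 &
      forall z, rball y t z -> [/\ rball 0 (e / 2) z, reg z & P z = frac z * Q z]].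
Proof.
have [d [r [r0 dn0 dreg]]] := regular_direction.
have [e [A [e0 tube]]] := circle_tube dreg
  (reg_open dom_open contD compat) (frac_continuous dom_open contN contD compat).
have e2 : 0 < e / 2 by rewrite divr_gt0.
have [w [s [s0 ws rw lines]]] := polar_lines r0 e2 dn0.
have [n minors] := moment_minors r0 e0 tube s0 ws lines.
have [|N0 [c [hc c0 rel]]] := @hankel_relation R V (rball 0 e) (fun k => moment d r k.+1) n _
  (fun k => moment_bhol r0 tube k.+1) minors.
  by exists 0; exact: rball_center.
have [P [Q [hP hQ Q0 PQ]]] := moment_quotient r0 e0 tube ws rw lines hc c0 rel.
have [y ys ry] := rw; have [t t0 tP] := reg_open dom_open contD compat ry.
exists P, Q, e, y, (Num.min t (s - rnorm (y - w))); split => //.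
  by rewrite lt_min t0 subr_gt0.
move=> z; rewrite /rball /= lt_min => /andP[zt zs].
have zw : rnorm (z - w) < s by have := rnorm_triangle z y w; lra.
have rz := tP _ zt; split => //; last exact: PQ.
by rewrite subr0; exact: ws zw.
Qed.

End Levi.

(** * Ghost vertices *)

Section Winding.
Variable R : realType.
Local Notation C := R[i].

Lemma polar_form (z : C) : 0 < complex.Re z ->
  exists2 r : R, 0 < r & z = r%:C * expi (atan (complex.Im z / complex.Re z)).
Proof.
move=> z0; set a := atan _; have ca : 0 < cos a.
  by apply: cos_gt0_pihalf; rewrite atan_gtNpi2 atan_ltpi2.
exists (complex.Re z / cos a); first exact: divr_gt0.
have ta : sin a / cos a = complex.Im z / complex.Re z by rewrite -[LHS]/(tan a) atanK.
apply/eqP; rewrite eq_complex /= !mul0r subr0 addr0; apply/andP; split; apply/eqP.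
  by rewrite divfK ?gt_eqF.
by rewrite mulrAC -mulrA ta mulrC divfK ?gt_eqF.
Qed.

Lemma near1_Re_div (x y : C) : rnorm (x - 1) < 1 / 4 -> rnorm (y - 1) < 1 / 4 ->
  0 < complex.Re (x / y).
Proof.
move=> x1 y1.
have rx := le_lt_trans (Re_le_rnorm (x - 1)) x1; have ry := le_lt_trans (Re_le_rnorm (y - 1)) y1.
have ix := le_lt_trans (Im_le_rnorm (x - 1)) x1; have iy := le_lt_trans (Im_le_rnorm (y - 1)) y1.
move: rx ry ix iy; case: x {x1} => a b; case: y {y1} => c d /=.
rewrite !ltr_norml => /andP[? ?] /andP[? ?] /andP[? ?] /andP[? ?].
rewrite (_ : _ - _ = (a * c + b * d) / (c ^+ 2 + d ^+ 2)); last by ring.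
by rewrite divr_gt0 //; nra.
Qed.

Let unit (t : R) := 0 <= t <= 1.

Lemma maxr_dist (c s t : R) : `|Num.max c t - Num.max c s| <= `|t - s|.
Proof.
have := ler_norm (t - s); have := ler_norm (s - t); rewrite distrC => h2 h3.
rewrite ler_norml; apply/andP.
by case: (leP c s) => ?; case: (leP c t) => ?; split; lra.
Qed.

(** Uniform continuity on the unit square, viewed inside the complex plane: nearby values, divided
    by the value at a common centre, are within 1/4 of 1, so their ratio has positive real part. *)
Lemma square_ratio (phi : R -> R -> C) :
  (forall s t, unit s -> unit t -> phi s t != 0) ->
  (forall s t, unit s -> unit t -> forall e : R, 0 < e -> exists2 d : R, 0 < d &
    forall s' t', unit s' -> unit t' -> `|s' - s| < d -> `|t' - t| < d ->
    rnorm (phi s' t' - phi s t) < e) ->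
  exists2 d : R, 0 < d & forall s t t', unit s -> unit t -> unit t' -> `|t' - t| < d ->
    0 < complex.Re (phi s t' / phi s t).
Proof.
move=> phi0 cphi; pose K := [set z : C | unit (complex.Re z) /\ unit (complex.Im z)].
have cK : compact K.
  apply: (subclosed_compact _ (@compact_disc R 2)).
    rewrite (_ : K = (@complex.Re R) @^-1` `[0, 1]%classic `&`
                     (@complex.Im R) @^-1` `[0, 1]%classic); last first.
      by apply/seteqP; split=> z /=; rewrite !in_itv.
    apply: closedI; apply: preimage_closed; try exact: interval_closed.
      by move=> x _; exact: continuous_Re.
    by move=> x _; exact: continuous_Im.
  move=> z [/andP[? ?] /andP[? ?]] /=; rewrite (le_trans (rnorm_le_ReIm z)) //.
  by rewrite !ger0_norm //; lra.
pose f (z : C) := phi (complex.Re z) (complex.Im z).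
have : forall z, exists e : R, K z -> 0 < e /\
    forall y, K y -> rnorm (y - z) < e -> rnorm (f y - f z) < rnorm (f z) / 4.
  move=> z; have [[zr zi]|nK] := pselect (K z); last by exists 0.
  have e0 : 0 < rnorm (f z) / 4 by rewrite divr_gt0 // rnorm_gt0 phi0.
  have [d d0 dP] := cphi _ _ zr zi _ e0; exists d => _; split => // y [yr yi] yz.
  apply: dP => //.
    by apply: le_lt_trans yz; have := Re_le_rnorm (y - z); rewrite raddfB.
  by apply: le_lt_trans yz; have := Im_le_rnorm (y - z); rewrite raddfB.
move=> /choice[e eP].
have e20 z : K z -> 0 < e z / 2 by move=> /eP[? _]; rewrite divr_gt0.
have [l [lK lcov]] := compact_cover_balls cK e20.
have l0 c : c \in l -> 0 < e c / 2 by move=> /lK/e20.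
have [d d0 dl] := seq_pos_min l0.
exists d => // s t t' us ut ut' td.
pose z : C := s +i* t; pose z' : C := s +i* t'.
have Kz : K z by []. have Kz' : K z' by [].
have zz' : rnorm (z' - z) < d.
  apply: le_lt_trans (rnorm_le_ReIm _) _.
  by rewrite /z /z' /= subrr normr0 add0r.
have [c cl zc] := lcov z Kz; have Kc := lK c cl; have [e0 H] := eP c Kc.
have fc0 : f c != 0 by case: Kc => ? ?; exact: phi0.
have fc : 0 < rnorm (f c) by rewrite rnorm_gt0.
have E (y : C) : rnorm (f y - f c) < rnorm (f c) / 4 -> rnorm (f y / f c - 1) < 1 / 4.
  move=> h; rewrite -(divff fc0) -mulrBl rnormM rnormV ltr_pdivrMr //.
  by move: h; rewrite mulrC div1r.
have -> : phi s t' / phi s t = (f z' / f c) / (f z / f c).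
  rewrite -[phi s t]/(f z) -[phi s t']/(f z'); field.
  by rewrite fc0 phi0.
apply: near1_Re_div; apply: E; apply: H => //.
  have := rnorm_triangle z' z c; have := dl c cl; lra.
by apply: lt_trans zc _; rewrite ltr_pdivrMr // ltr_pMr // ltr1n.
Qed.

Lemma continuous_sum_real (T : topologicalType) (n : nat) (u : nat -> T -> R) (x : T) :
  (forall k, (k < n)%N -> {for x, continuous (u k)}) ->
  {for x, continuous (fun y => \sum_(k < n) u k y)}.
Proof.
elim: n => [|n IH] cu.
  by rewrite (_ : (fun y => _) = fun=> 0); [exact: cst_continuous|apply/funext => y; rewrite big_ord0].
rewrite (_ : (fun y => _) = fun y => \sum_(k < n) u k y + u n y); last first.
  by apply/funext => y; rewrite big_ord_recr.
apply: (@continuousD _ _ _ (fun y => \sum_(k < n) u k y) (u n)).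
  by apply: IH => k kn; apply: cu; rewrite ltnS ltnW.
exact: cu.
Qed.

(* The winding number of [phi s] is continuous in [s], equal to 1 at [s = 0]
   and to 0 at [s = 1]. *)
Lemma circle_not_null_homotopic (phi : R -> R -> C) :
  (forall s t, unit s -> unit t -> phi s t != 0) ->
  (forall s t, unit s -> unit t -> forall e : R, 0 < e -> exists2 d : R, 0 < d &
    forall s' t', unit s' -> unit t' -> `|s' - s| < d -> `|t' - t| < d ->
    rnorm (phi s' t' - phi s t) < e) ->
  (forall t, unit t -> phi 0 t = expi (2 * pi * t)) ->
  (forall t, unit t -> phi 1 t = 1) ->
  (forall s, unit s -> phi s 0 = 1 /\ phi s 1 = 1) -> False.
Proof.
move=> phi0 cphi h0 h1 hs.
have [d d0 dP] := square_ratio phi0 cphi.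
(* More than 4 subdivisions bring the angle 2 pi / n below pi / 2, within the range of the
   arctangent. *)
pose n := (Num.bound (d^-1) + 5)%N; have n4 : 4 < n%:R :> R by rewrite ltr_nat leq_addl.
have n0 : 0 < n%:R :> R by rewrite ltr0n /n addnS.
have nd : n%:R^-1 < d.
  rewrite invf_plt ?posrE //; apply: (lt_le_trans (archi_boundP (ltW _))); first by rewrite invr_gt0.
  by rewrite ler_nat leq_addr.
(* Clamping [s] to the unit interval makes [W] continuous on the whole real line. *)
pose cl (s : R) := Num.max 0 (1 - Num.max 0 (1 - s)).
have ucl s : unit (cl s).
  by rewrite /unit /cl le_max lexx /= ge_max ler01 /= lerBlDr lerDl le_max lexx.
have clE s : unit s -> cl s = s.
  by move=> /andP[s0 s1]; rewrite /cl (@max_idPr _ _ 0 (1 - s) _) ?subr_ge0 // subKr (max_idPr s0).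
have cl_lip s s' : `|cl s' - cl s| <= `|s' - s|.
  apply: le_trans (maxr_dist _ _ _) _; rewrite opprB addrC addrA subrK distrC.
  by apply: le_trans (maxr_dist _ _ _) _; rewrite opprB addrC addrA subrK distrC.
pose q k s := phi (cl s) (k.+1%:R / n%:R) / phi (cl s) (k%:R / n%:R).
have uk k : (k <= n)%N -> unit (k%:R / n%:R).
  by move=> kn; rewrite /unit divr_ge0 //= ler_pdivrMr // mul1r ler_nat.
have qpos k s : (k < n)%N -> 0 < complex.Re (q k s).
  move=> kn; apply: dP; rewrite ?ucl ?uk // ?(ltnW kn) //.
  by rewrite -mulrBl -natr1 addrC addKr mul1r gtr0_norm ?invr_gt0.
(* The argument of the k-th ratio, between - pi / 2 and pi / 2; the sum [W] is 2 pi times the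
   winding number. *)
pose a k s := atan (complex.Im (q k s) / complex.Re (q k s)).
pose W s := \sum_(k < n) a k s.
have cW : continuous W.
  move=> s; apply: continuous_sum_real => k kn.
  have cp j : (j <= n)%N -> {for s, continuous (fun s => phi (cl s) (j%:R / n%:R))}.
    move=> jn; apply/cvg_rnormP => e e0.
    have [t t0 tP] := cphi _ _ (ucl s) (uk j jn) e e0.
    apply/nbhs_ballP; exists t => //= y; rewrite /ball /= => sy.
    refine (tP _ _ (ucl y) (uk j jn) _ _).
      by rewrite (le_lt_trans (cl_lip _ _)) // distrC.
    by rewrite subrr normr0.
  have cq : {for s, continuous (q k)}.
    apply: (@continuousM _ _ (fun s => phi (cl s) (k.+1%:R / n%:R))
      (fun s => (phi (cl s) (k%:R / n%:R))^-1)); first exact: cp.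
    apply: (@continuousV _ _ (fun s => phi (cl s) (k%:R / n%:R))); last exact: (cp _ (ltnW kn)).
    exact: phi0 (ucl s) (uk _ (ltnW kn)).
  apply: (@continuous_comp _ _ _ (fun s => complex.Im (q k s) / complex.Re (q k s)) (@atan R));
    last exact: continuous_atan.
  apply: (@continuousM _ _ (fun s => complex.Im (q k s)) (fun s => (complex.Re (q k s))^-1)).
    by apply: (@continuous_comp _ _ _ (q k) (@complex.Im R) s cq); exact: continuous_Im.
  apply: (@continuousV _ _ (fun s => complex.Re (q k s))); first by rewrite gt_eqF // qpos.
  by apply: (@continuous_comp _ _ _ (q k) (@complex.Re R) s cq); exact: continuous_Re.
have W0 : W 0 = 2 * pi.
  have u0 : unit 0 by rewrite /unit lexx ler01.
  have E k : (k < n)%N -> a k 0 = 2 * pi / n%:R.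
    move=> kn; rewrite /a /q (clE _ u0) !h0 ?uk // ?(ltnW kn) //.
    rewrite -natr1 (_ : 2 * pi * _ = 2 * pi / n%:R + 2 * pi * (k%:R / n%:R)); last by field; rewrite gt_eqF.
    rewrite expiD mulfK ?expi_neq0 //= -[_ / _]/(tan _) tanK // in_itv /=.
    have p0 := pi_gt0 R; apply/andP; split.
      by apply: lt_trans (_ : 0 < _); rewrite ?divr_gt0 ?mulr_gt0 // oppr_lt0 divr_gt0.
    rewrite ltr_pdivrMr // mulrAC ltr_pdivlMr //.
    by rewrite mulrC mulrA mulrC ltr_pM2l //; lra.
  rewrite /W (eq_bigr (fun=> 2 * pi / n%:R)) => [|k _]; last exact: E.
  by rewrite sumr_const card_ord -[LHS]mulr_natr divfK // gt_eqF.
have W1 : W 1 = 0.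
  have u1 : unit 1 by rewrite /unit lexx ler01.
  rewrite /W big1 // => k _; rewrite /a /q (clE _ u1) !h1 ?uk // ?(ltnW (ltn_ord k)) //.
  by rewrite divr1 /= mul0r atan0.
have expW s : exists2 r : R, 0 < r & 1 = r%:C * expi (W s).
  have [p0 p1] := hs _ (ucl s).
  have : forall j, (j <= n)%N -> exists2 r : R, 0 < r &
      phi (cl s) (j%:R / n%:R) = r%:C * expi (\sum_(k < j) a k s).
    elim=> [_|j IH jn].
      by exists 1 => //; rewrite mul0r p0 big_ord0 expi0 mulr1.
    have [r r0 rE] := IH (ltnW jn); have [r' r'0 r'E] := polar_form (qpos j s jn).
    exists (r * r'); first exact: mulr_gt0.
    rewrite -(divfK (phi0 _ _ (ucl s) (uk _ (ltnW jn))) (phi (cl s) (j.+1%:R / n%:R))).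
    rewrite -/(q j s) r'E rE big_ord_recr /= expiD rmorphM /= -/(a j s); ring.
  move=> /(_ n (leqnn n)); rewrite divff ?gt_eqF // p1 => -[r r0 E].
  by exists r.
(* An intermediate value [pi] contradicts [expW], which would make 1 a negative real number. *)
have [||c _ Wc] := @IVT R W 0 1 pi ler01.
- exact: continuous_subspaceT.
- by rewrite W0 W1; have := pi_gt0 R; rewrite ge_min le_max => p; apply/andP; split;
    apply/orP; [right|left]; lra.
have [r r0] := expW c; rewrite Wc /expi cospi sinpi => /(congr1 (@complex.Re R)) /=.
by rewrite mul0r subr0 mulrN1 => E; have := ltr01 : 0 < 1 :> R; rewrite E; lra.
Qed.

End Winding.

Section GhostVertices.
Variables (R : realType) (m : nat) (K : {set {set 'I_m}}).

Lemma singleton_of_simply_connected : finset.set0 \in K ->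
  simply_connected R (set_type (UK R K)) -> forall i, [set i]%SET \in K.
Proof.
move=> K0 [_ _ nullh] i; apply: contraT => niK.
have UKi (z : 'rV[R[i]]_m) : UK R K z -> z 0 i != 0.
  move=> zU; apply/negP => /eqP zi; apply: zU; exists [set i]%SET => //= j.
  by rewrite inE => /eqP ->.
have inUK (z : 'rV[R[i]]_m) : (forall j, z 0 j != 0) -> UK R K z.
  move=> zn0 [J /= nJ zJ]; have [J0|[j jJ]] := set_0Vmem J; first by rewrite J0 K0 in nJ.
  by have := zn0 j; rewrite zJ // eqxx.
pose v (t : R) : 'rV[R[i]]_m := \row_j if j == i then expi (2 * pi * t) else 1.
have vU t : UK R K (v t).
  by apply: inUK => j; rewrite mxE; case: ifP => _; rewrite ?expi_neq0 ?oner_neq0.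
pose g (t : R) : set_type (UK R K) := exist _ (v t) (mem_set (vU t)).
have gi t : (\val (g t)) 0 i = expi (2 * pi * t) by rewrite /= mxE eqxx.
have cg : continuous g.
  apply: (@continuous_comp_initial _ _ _ set_val g) => t; apply/cvg_rnormP => e e0.
  have c2 : {for t, continuous (fun t : R => expi (2 * pi * t))}.
    apply: (@continuous_comp _ _ _ (fun t : R => 2 * pi * t) (@expi R)); last exact: continuous_expi.
    exact: mulrl_continuous.
  have e2 : 0 < e / 2 by rewrite divr_gt0.
  move/cvg_rnormP: c2 => /(_ _ e2); apply: filterS => y yt.
  apply: (@le_lt_trans _ _ (e / 2)); last by rewrite ltr_pdivrMr // ltr_pMr // ltr1n.
  apply: rnorm_rV_le (ltW e2) _ => j; rewrite !mxE.
  by case: ifP => _; [exact: ltW|rewrite subrr rnorm0 ltW].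
have g01 : g 0 = g 1.
  apply: val_inj => /=; rewrite /v; congr (\row_j _); apply/funext => j.
  by rewrite mulr0 mulr1 expi0 expi2pi.
have [F cF [F0 F1 Fs]] := nullh g (continuous_subspaceT cg) g01.
have ui (t : R) : 0 <= t <= 1 -> `[0, 1]%classic t by move=> ?; rewrite /= in_itv.
case: (@circle_not_null_homotopic R (fun s t => (\val (F (s, t))) 0 i)) => //.
- by move=> s t _ _; apply: UKi; exact: set_valP.
- move=> s t /ui us /ui ut e e0.
  pose S := [set y : set_type (UK R K) | rnorm ((\val y) 0 i - (\val (F (s, t))) 0 i) < e].
  have nS : nbhs (F (s, t)) S.
    have cv : {for F (s, t), continuous (fun y : set_type (UK R K) => (\val y) 0 i)}.
      apply: (@continuous_comp _ _ _ (fun y : set_type (UK R K) => \val y)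
        (fun z : 'rV[R[i]]_m => z 0 i)); first exact: initial_continuous.
      exact: coord_continuous.
    move/cvg_rnormP: cv => /(_ e e0); exact: filterS.
  have A0 : (`[0, 1]%classic `*` `[0, 1]%classic) (s, t) by [].
  have /nbhs_ballP[d /= d0 dP] := (subspace_continuousP _ _).1 cF (s, t) A0 S nS.
  exists d => // s' t' /ui us' /ui ut' ss tt; apply: dP; last by [].
  by split; rewrite /ball /= distrC.
- by move=> t /ui/F0 ->.
- by move=> t /ui/F1 ->; rewrite gi mulr0 expi0.
- by move=> s /ui/Fs[-> ->]; rewrite !gi mulr0 expi0.
Qed.

End GhostVertices.

(** * Meromorphic functions on the quotient *)

Section Constancy.
Variables (R : realType) (V : normedModType R[i]) (I : Type).
Local Notation C := R[i].
Variables (dom : I -> set V) (N D : I -> V -> C).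
Hypothesis dom_open : forall i z, dom i z ->
  exists2 e : R, 0 < e & forall y, rnorm (y - z) < e -> dom i y.
Hypothesis holN : forall i, hol_on (dom i) (N i).
Hypothesis holD : forall i, hol_on (dom i) (D i).
Hypothesis regular : forall i z (e : R), dom i z -> 0 < e ->
  exists y, [/\ rnorm (y - z) < e, dom i y & D i y != 0].
Hypothesis compat : forall i j z, dom i z -> dom j z -> N i z * D j z = N j z * D i z.
Variable c : C.

Definition constant_near (p : V) := exists2 e : R, 0 < e &
  forall i w, rnorm (w - p) < e -> dom i w -> N i w = c * D i w.

Lemma hol_on_defect i : hol_on (dom i) (fun z => N i z - c * D i z).
Proof. by apply: hol_onB => //; apply: hol_onM => //; exact: hol_on_cst. Qed.

(** By compatibility [D i] times the defect of chart [j] is 0 near [w], and [D i] can be cancelled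
    because it is not identically zero there. *)
Lemma chart_constant i j p (e : R) w : (forall z, rnorm (z - p) < e -> dom i z /\ N i z = c * D i z) ->
  rnorm (w - p) < e -> dom j w -> N j w = c * D j w.
Proof.
move=> H wp jw; have [s s0 sj] := dom_open jw.
pose k := Num.min s (e - rnorm (w - p)); have k0 : 0 < k by rewrite lt_min s0 subr_gt0.
have kE z : rball w k z -> dom j z /\ rnorm (z - p) < e.
  rewrite /rball /= lt_min => /andP[zs ze]; split; first exact: sj.
  by have := rnorm_triangle z w p; lra.
have hj : hol_on (rball w k) (fun z => N j z - c * D j z).
  by refine (hol_onS _ (@hol_on_defect j)) => z /kE[].
have hi : hol_on (rball w k) (D i).
  by refine (hol_onS _ (@holD i)) => z /kE[_ /H[]].
apply/eqP; rewrite -subr_eq0; apply/eqP.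
apply: (hol_mul_eq0 hj hi) (rball_center w k0) => [z /kE[jz /H[iz Nz]]|].
  by rewrite mulrBl (compat jz iz) Nz; ring.
have [y [yk iy Dy]] := regular (H w wp).1 k0; by exists y.
Qed.

(** The radius depends on [p] only, not on [a]; this is what makes the set of good points closed as
    well as open. *)
Lemma constant_near_spread p : (exists i, dom i p) -> exists2 e : R, 0 < e &
  forall a b, rnorm (a - p) < e -> rnorm (b - p) < e -> constant_near a -> constant_near b.
Proof.
move=> [i ip]; have [e e0 eP] := dom_open ip.
exists e => // a b ap bp [s s0 sP].
have hi : hol_on (rball p e) (fun z => N i z - c * D i z).
  by refine (hol_onS _ (@hol_on_defect i)) => z /eP.
have k0 : 0 < Num.min s (e - rnorm (a - p)) by rewrite lt_min s0 subr_gt0.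
have Z : forall z, rball p e z -> N i z - c * D i z = 0.
  apply: (identity_theorem k0 hi ap) => z; rewrite /rball /= lt_min => /andP[zs ze].
  rewrite (sP i z zs) ?subrr //; apply: eP.
  by have := rnorm_triangle z a p; lra.
exists (e - rnorm (b - p)) => [|j w wb jw]; first by rewrite subr_gt0.
apply: (@chart_constant i j p e) jw => [z zp|].
  by split; [exact: eP|apply/eqP; rewrite -subr_eq0; apply/eqP; exact: Z].
by have := rnorm_triangle w b p; lra.
Qed.

End Constancy.

Section TorusAction.
Variables (R : realType) (m : nat).
Local Notation C := R[i].
Local Notation V := 'rV[C]_m.

Lemma tact_near (e : R) : 0 < e -> exists2 d : R, 0 < d &
  forall v z : V, rnorm v < d -> rnorm (tact (texp v) z - z) <= e * rnorm z.
Proof.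
move=> e0; have c0 : {for (0 : C), continuous (@cexp R)}.
  by apply: derivable1_continuous; exact: derivable_cexp.
have [d d0 dP] := (continuous_rnormP (@cexp R) 0).1 c0 e e0.
have [x x0 xd] := small_of_pos (rnorm_ge0 (0 +i* (pi *+ 2) : C)) d0.
exists x => // v z vx; apply: rnorm_rV_le => [|j].
  by rewrite mulr_ge0 ?rnorm_ge0 // ltW.
have -> : (tact (texp v) z - z) 0 j = (cexp ((0 +i* (pi *+ 2)) * v 0 j) - 1) * z 0 j.
  by rewrite !mxE; ring.
rewrite rnormM ler_pM ?rnorm_ge0 // ?rnorm_coord // ltW // -(@cexp0 R); apply: dP.
rewrite subr0 rnormM; apply: le_lt_trans xd; rewrite ler_wpM2l ?rnorm_ge0 // ltW //.
exact: le_lt_trans (rnorm_coord v j) vx.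
Qed.

Lemma tactDZ (t z w : V) (a : C) : tact t (z + a *: w) = tact t z + a *: tact t w.
Proof. by apply/rowP => j; rewrite !mxE; ring. Qed.

Lemma hol_on_tact (A B : set V) (g : V -> C) (t : V) : hol_on B g ->
  (forall z, A z -> B (tact t z)) -> hol_on A (fun z => g (tact t z)).
Proof.
move=> hg AB z Az w; apply/derivable1P.
have -> : (fun a : C => g (tact t (a *: w + z))) = (fun a : C => g (tact t z + a *: tact t w)).
  by apply/funext => a; rewrite addrC tactDZ.
apply/derivable_lineE; rewrite scale0r addr0; exact: hg (AB z Az) _.
Qed.

End TorusAction.

(** * Local constancy of an invariant fraction *)

Section Rigidity.
Variables (R : realType) (m : nat) (I : Type).
Local Notation C := R[i].
Local Notation V := 'rV[C]_m.
Variables (h : {vspace V}) (dom : I -> set V) (N D : I -> V -> C).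
Hypothesis hirr : no_rational_annihilator h.
Hypothesis cover : forall z : V, (forall j k, z 0 j = 0 -> z 0 k = 0 -> j = k) ->
  exists i, dom i z.
Hypothesis dom_open : forall i z, dom i z ->
  exists2 e : R, 0 < e & forall y, rnorm (y - z) < e -> dom i y.
Hypothesis holN : forall i, hol_on (dom i) (N i).
Hypothesis holD : forall i, hol_on (dom i) (D i).
Hypothesis contN : forall i z, dom i z -> {for z, continuous (N i)}.
Hypothesis contD : forall i z, dom i z -> {for z, continuous (D i)}.
Hypothesis regular : forall i z (e : R), dom i z -> 0 < e ->
  exists y, [/\ rnorm (y - z) < e, dom i y & D i y != 0].
Hypothesis compat : forall i j z, dom i z -> dom j z -> N i z * D j z = N j z * D i z.
Hypothesis invariant : forall i v z, v \in h -> dom i z ->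
  [/\ dom i (tact (texp v) z), N i (tact (texp v) z) = N i z & D i (tact (texp v) z) = D i z].

Lemma frac_invariant v z : v \in h -> reg dom D z ->
  frac dom N D (tact (texp v) z) = frac dom N D z.
Proof.
move=> vh rz; case: (rz) => i [iz Dz]; have [it Nt Dt] := invariant vh iz.
have rt : reg dom D (tact (texp v) z) by exists i; split=> //; rewrite Dt.
by apply: (mulIf Dz); rewrite (fracE compat rz iz) -{1}Dt (fracE compat rt it).
Qed.

Lemma invariant_fraction_constant : exists c i y, dom i y /\ constant_near dom N D c y.
Proof.
have [P [Q [e [y [t [e0 t0 [[hP [A PA]] [hQ [B QB]]] [z0 z0e Qz0] PQ]]]]]] :=
  levi_extension cover dom_open holN holD contN contD regular compat.
have e2 : 0 < e / 2 by rewrite divr_gt0.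
have e2e : e / 2 < e by rewrite ltr_pdivrMr // ltr_pMr // ltr1n.
have sub (z : V) : rball 0 (e / 2) z -> rball 0 e z.
  by rewrite /rball /= => ze; exact: lt_trans ze e2e.
have [z1 [z1e _ Qz1]] := hol_dense_nonzero hQ z0e Qz0 (rball_center 0 e0) e2.
have [d1 d10 d1P] := @tact_near R m 1 ltr01.
(* With this ratio the action displaces points of the ball of radius [e] by at most [t / 2]; the
   bound with ratio 1 above keeps the image of the half ball inside the full ball. *)
have te : 0 < t / 2 / e by rewrite !divr_gt0.
have [d2 d20 d2P] := @tact_near R m _ te.
have d0 : 0 < Num.min d1 d2 by rewrite lt_min d10.
have y0 : rball 0 (e / 2) y by have [] := PQ y (rball_center y t0).
have tsub (v z : V) : rnorm v < Num.min d1 d2 -> rball 0 (e / 2) z -> rball 0 e (tact (texp v) z).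
  rewrite lt_min => /andP[vd _]; rewrite /rball /= !subr0 => ze.
  have := d1P v z vd; have := rnormD (tact (texp v) z - z) z; rewrite subrK mul1r.
  by lra.
have PQt v : v \in h -> rnorm v < Num.min d1 d2 -> forall z, rball 0 (e / 2) z ->
    P (tact (texp v) z) * Q z = P z * Q (tact (texp v) z).
  move=> vh vd.
  have hG : hol_on (rball 0 (e / 2))
      (fun z => P (tact (texp v) z) * Q z - P z * Q (tact (texp v) z)).
    have ht (z : V) : rball 0 (e / 2) z -> rball 0 e (tact (texp v) z) by exact: tsub.
    apply: hol_onB; apply: hol_onM.
    - exact: hol_on_tact hP ht.
    - exact: hol_onS sub hQ.
    - exact: hol_onS sub hP.
    - exact: hol_on_tact hQ ht.
  move=> z ze; apply/eqP; rewrite -subr_eq0; apply/eqP; move: z ze.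
  have t2 : 0 < t / 2 by rewrite divr_gt0.
  apply: (identity_theorem t2 hG y0) => z zy.
  have zt : rball y t z.
    by apply: lt_trans zy _; rewrite ltr_pdivrMr // ltr_pMr // ltr1n.
  have [ze rz Pz] := PQ z zt.
  have [_ rt Pt] : [/\ rball 0 (e / 2) (tact (texp v) z), reg dom D (tact (texp v) z) &
      P (tact (texp v) z) = frac dom N D (tact (texp v) z) * Q (tact (texp v) z)].
    apply: PQ; rewrite /rball /= (le_lt_trans (rnorm_triangle _ z _)) //.
    rewrite (splitr t) ler_ltD //; have := vd; rewrite lt_min => /andP[_ v2].
    apply: le_trans (d2P v z v2) _; rewrite -[leRHS](divfK (lt0r_neq0 e0)) ler_wpM2l ?(ltW te) //.
    by apply: ltW; have := sub _ ze; rewrite /rball /= subr0.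
  by rewrite Pt Pz (frac_invariant vh rz); ring.
have [c cP] := invariant_quotient_constant hirr e2 d0 (hol_onS sub hP) (hol_onS sub hQ)
  (fun z ze => PA z (sub z ze)) (fun z ze => QB z (sub z ze))
  (ex_intro2 _ _ z1 z1e Qz1) PQt.
have [_ [i [iy Dy]] _] := PQ y (rball_center y t0).
have [s s0 si] := dom_open iy.
have k0 : 0 < Num.min s t by rewrite lt_min s0.
exists c, i, y; split => //; exists (Num.min s t) => // j w wy jw.
have inb z : rball y (Num.min s t) z -> dom i z /\ rball y t z.
  by rewrite /rball /= lt_min => /andP[zs zt]; split => //; exact: si.
have hi : hol_on (rball y (Num.min s t)) (fun z => N i z - c * D i z).
  by refine (hol_onS _ (hol_on_defect holN holD (c:=c) (i:=i))) => z /inb[].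
have hq : hol_on (rball y (Num.min s t)) Q.
  by refine (hol_onS _ hQ) => z /inb[_ /PQ[/sub]].
(* Multiplying the defect of chart [i] by [Q] turns it into a multiple of [P - c Q], which is 0;
   then [Q] is cancelled. *)
have Z : forall z, rball y (Num.min s t) z -> N i z - c * D i z = 0.
  apply: (hol_mul_eq0 hi hq) => [z /inb[iz zt]|].
    have [ze rz Pz] := PQ z zt.
    have H : frac dom N D z * Q z = c * Q z by rewrite -Pz cP.
    by rewrite mulrBl -(fracE compat rz iz) mulrAC H; ring.
  by have [z [zy _ Qz]] := hol_dense_nonzero hQ z0e Qz0 (sub _ y0) k0; exists z.
apply: (chart_constant dom_open holN holD regular compat) wy jw => z zy.
have [iz _] := inb z zy; split; first exact: iz.
by apply/eqP; rewrite -subr_eq0; apply/eqP; exact: Z.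
Qed.

End Rigidity.

Local Open Scope quotient_scope.

(** * Lifting from the quotient to U(K) *)

Section Descent.
Variables (R : realType) (m : nat) (K : {set {set 'I_m}}) (h : {vspace 'rV[R[i]]_m}).
Local Notation C := R[i].
Local Notation V := 'rV[C]_m.
Local Notation X := (UKmodH K h).
Local Notation S := (set_type (UK R K)).
Implicit Types (x p : X) (y : S) (z v : V).

Lemma UK_ball z : UK R K z -> exists2 e : R, 0 < e & forall w, rnorm (w - z) < e -> UK R K w.
Proof.
move=> zU.
have [|e e0 eP] := @seq_pos_min R _ [seq j <- enum 'I_m | z 0 j != 0] (fun j => rnorm (z 0 j)).
  by move=> j; rewrite mem_filter rnorm_gt0 => /andP[].
exists e => // w wz [J /= nJ wJ]; apply: zU; exists J => // j jJ.
apply/eqP; apply/negPn/negP => zj.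
have := eP j; rewrite mem_filter zj mem_enum => /(_ isT).
have := le_lt_trans (rnorm_coord (w - z) j) wz.
by rewrite !mxE wJ // sub0r rnormN ltNge => /negP.
Qed.

Lemma UK_tact v z : UK R K z -> UK R K (tact (texp v) z).
Proof.
move=> zU [J /= nJ zJ]; apply: zU; exists J => // j /zJ.
by rewrite !mxE => /eqP; rewrite mulf_eq0 (negPf (cexp_neq0 _)) => /eqP.
Qed.

Definition UK_act v y : S := exist _ (tact (texp v) (\val y)) (mem_set (@UK_tact v _ (set_valP y))).

Lemma pi_act v y : v \in h -> \pi_X (UK_act v y) = \pi_X y.
Proof.
move=> vh; apply/esym/eqmodP/asboolP.
by exists (texp v) => //; exists v.
Qed.

Lemma pi_eq y y' : \pi_X y = \pi_X y' -> exists2 v, v \in h & \val y' = tact (texp v) (\val y).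
Proof.
by move=> /eqmodP/asboolP[_ [v vh <-] E]; exists v.
Qed.

Definition lift_dom (U : set X) : set V := [set z | exists2 y, \val y = z & U (\pi_X y)].

Definition lift_fun (g : X -> C) : V -> C := valL_ 0 (fun y : S => g (\pi_X y)).

Lemma lift_funE g y : lift_fun g (\val y) = g (\pi_X y).
Proof. exact: (congr1 (fun k => k y) (@valLK _ _ (0 : C) (UK R K) (fun y : S => g (\pi_X y)))). Qed.

Lemma open_UK_ball (U : set S) y : open U -> U y ->
  exists2 e : R, 0 < e & forall w, rnorm (w - \val y) < e -> exists2 y', \val y' = w & U y'.
Proof.
move=> [W oW WU] Uy; have [d d0 dP] := UK_ball (set_valP y).
have Wy : W (\val y) by move: Uy; rewrite -WU.
have [e e0 eP] := (openP W).1 oW _ Wy.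
exists (Num.min d e) => [|w]; first by rewrite lt_min d0.
rewrite lt_min => /andP[/dP wU /eP Ww].
by exists (exist _ w (mem_set wU)) => //; rewrite -WU.
Qed.

Lemma lift_dom_open (U : set X) z : open U -> lift_dom U z ->
  exists2 e : R, 0 < e & forall w, rnorm (w - z) < e -> lift_dom U w.
Proof. by move=> oU [y <- Uy]; exact: (open_UK_ball oU Uy). Qed.

Lemma rnorm_tact (t z : V) : rnorm (tact t z) <= rnorm t * rnorm z.
Proof.
apply: rnorm_rV_le => [|j]; first by rewrite mulr_ge0 ?rnorm_ge0.
by rewrite mxE rnormM ler_pM ?rnorm_ge0 ?rnorm_coord.
Qed.

(** The preimage of this set in U(K) is the union of the translates under H of a piece of the ball,
    which is open. It supplies the open sets of the quotient on which regularity of denominators is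
    tested. *)
Lemma saturation_open (U : set X) (z : V) (e : R) : open U ->
  open [set p : X | exists y : S, [/\ \pi_X y = p, rnorm (\val y - z) < e & U p]].
Proof.
move=> oU; set A := (X in open X).
pose W : set V := [set w | exists v, [/\ v \in h, rnorm (tact (texp v) w - z) < e & lift_dom U w]].
suff : open ((\pi_X : S -> X) @^-1` A) by [].
exists W.
  apply/openP => w [v [vh wz Uw]]; have [d d0 dP] := lift_dom_open oU Uw.
  have r0 : 0 < e - rnorm (tact (texp v) w - z) by rewrite subr_gt0.
  have [x x0 xe] := small_of_pos (rnorm_ge0 (texp v)) r0.
  exists (Num.min d x) => [|u]; first by rewrite lt_min d0.
  rewrite lt_min => /andP[/dP Uu ux]; exists v; split => //.
  have E : tact (texp v) u - tact (texp v) w = tact (texp v) (u - w).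
    by apply/rowP => j; rewrite !mxE mulrBr.
  have := rnorm_triangle (tact (texp v) u) (tact (texp v) w) z; rewrite E.
  have := rnorm_tact (texp v) (u - w).
  have : rnorm (texp v) * rnorm (u - w) <= rnorm (texp v) * x.
    by rewrite ler_wpM2l ?rnorm_ge0 // ltW.
  lra.
apply/seteqP; split=> y /=.
  move=> [v [vh yz [y0 /val_inj -> Uy]]]; exists (UK_act v y); split => //.
  exact: pi_act.
move=> [y' [yE yz Uy]]; have [v vh E] := pi_eq (esym yE).
by exists v; split => //; [rewrite -E|exists y].
Qed.

Lemma lift_hol (U : set X) g : quotient_hol K h U g -> hol_on (lift_dom U) (lift_fun g).
Proof. by move=> hg _ [y <- Uy] w; apply: diff_derivable; exact: hg. Qed.

Lemma lift_continuous (U : set X) g z : quotient_hol K h U g -> lift_dom U z ->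
  {for z, continuous (lift_fun g)}.
Proof. by move=> hg [y <- Uy]; exact: differentiable_continuous (hg y Uy). Qed.

Hypothesis hK : simplicial_complex K.
Hypothesis hsc : simply_connected R (set_type (UK R K)).
Hypothesis hirr : no_rational_annihilator h.

Lemma UK_one_zero z : (forall j k, z 0 j = 0 -> z 0 k = 0 -> j = k) -> UK R K z.
Proof.
move=> zP [J /= nJ zJ]; have [J0|[j jJ]] := set_0Vmem J; first by rewrite J0 hK.1 in nJ.
suff E : J = [set j]%SET.
  by have := singleton_of_simply_connected hK.1 hsc j; rewrite -E (negPf nJ).
apply/setP => k; rewrite inE; apply/idP/eqP => [kJ|-> //].
by apply: zP; exact: zJ.
Qed.

Section Lift.
Variable f : meromorphic (quotient_hol K h).
Let dom x := lift_dom (mero_dom f x).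
Let N x := lift_fun (mero_num f x).
Let D x := lift_fun (mero_den f x).

Lemma mero_cover z : (forall j k, z 0 j = 0 -> z 0 k = 0 -> j = k) -> exists x, dom x z.
Proof.
move=> /UK_one_zero zU; pose y : S := exist _ z (mem_set zU).
by exists (\pi_X y), y => //; exact: mero_dom_mem.
Qed.

(** Regularity is stated for open subsets of the quotient, so it is applied to the image of a small
    ball about [z]; the point found there has a representative in that ball. *)
Lemma mero_regular x z (e : R) : dom x z -> 0 < e ->
  exists w, [/\ rnorm (w - z) < e, dom x w & D x w != 0].
Proof.
move=> [y yz xy] e0.
have [||_ [y' [<- y'z xy']] Dy'] :=
    @mero_den_regular _ _ _ f x _ (saturation_open z e (mero_dom_open f x)).
- by exists (\pi_X y), y; split => //; rewrite yz subrr rnorm0.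
- by move=> p [y' []].
- by exists (\val y'); split => //; [exists y'|rewrite /D lift_funE].
Qed.

Lemma lift_compat x x' z : dom x z -> dom x' z -> N x z * D x' z = N x' z * D x z.
Proof.
move=> [y <- xy] [y' /val_inj E x'y]; rewrite E in x'y.
by rewrite /N /D !lift_funE; exact: mero_compat.
Qed.

Lemma mero_invariant x v z : v \in h -> dom x z ->
  [/\ dom x (tact (texp v) z), N x (tact (texp v) z) = N x z & D x (tact (texp v) z) = D x z].
Proof.
move=> vh [y <- xy]; rewrite -[tact _ _]/(\val (UK_act v y)) /N /D !lift_funE !pi_act //.
by split => //; exists (UK_act v y) => //; rewrite pi_act.
Qed.

Lemma meromorphic_constant : constant_meromorphic f.
Proof.
have domO x (z : V) : dom x z ->
    exists2 e : R, 0 < e & forall w : V, rnorm (w - z) < e -> dom x w.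
  exact: lift_dom_open (mero_dom_open f x).
have holN x : hol_on (dom x) (N x) := lift_hol (mero_num_hol f x).
have holD x : hol_on (dom x) (D x) := lift_hol (mero_den_hol f x).
have [c [x0 [z0 [x0z0 cz0]]]] := invariant_fraction_constant hirr mero_cover domO holN holD
  (fun x z => @lift_continuous _ _ z (mero_num_hol f x))
  (fun x z => @lift_continuous _ _ z (mero_den_hol f x)) mero_regular lift_compat mero_invariant.
exists c; suff H : forall y : S, constant_near dom N D c (\val y).
  move=> x p xp; have [e e0 eP] := H (repr p).
  have := eP x (\val (repr p)); rewrite subrr rnorm0 /N /D !lift_funE reprK; apply => //.
  by exists (repr p) => //; rewrite reprK.
(* The property [spread] is symmetric in its two points, so both [A] and its complement are open,
   and a path starting in [A] stays in it. *)
pose A : set S := [set y | constant_near dom N D c (\val y)].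
have spread y : exists2 U : set V, open_nbhs (\val y) U &
    forall y1 y2 : S, U (\val y1) -> U (\val y2) -> A y1 -> A y2.
  have [|e e0 eP] := constant_near_spread domO holN holD mero_regular lift_compat c (p := \val y).
    by exists (\pi_X y), y => //; exact: mero_dom_mem.
  exists (rball (\val y) e) => [|y1 y2]; last exact: eP.
  split; last exact: rball_center.
  apply/openP => w we; exists (e - rnorm (w - \val y)) => [|u uw]; first by rewrite subr_gt0.
  by have := rnorm_triangle u w (\val y); rewrite /rball /=; lra.
have oA : open A.
  rewrite openE => y Ay; have [U [oU Uy] UA] := spread y.
  exists (set_val @^-1` U); split => //; first by exists U.
  by move=> y2 Uy2; exact: UA Uy Uy2 Ay.
have oCA : open (~` A).
  rewrite openE => y nAy; have [U [oU Uy] UA] := spread y.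
  exists (set_val @^-1` U); split => //; first by exists U.
  by move=> y2 Uy2 Ay2; apply: nAy; exact: UA Uy2 Uy Ay2.
move=> y; have [y0 y0z0 _] := x0z0; have Ay0 : A y0 by rewrite /A /= y0z0.
have [_ pc _] := hsc; have [g cg [g0 g1]] := pc y0 y.
have cT := connected_continuous_connected (@segment_connected R 0 1) cg.
suff AT : g @` `[0, 1]%classic `&` A = g @` `[0, 1]%classic.
  have : (g @` `[0, 1]%classic `&` A) y by rewrite AT -g1; exists 1 => //=; rewrite in_itv /= ler01 lexx.
  by case.
apply: cT.
- by exists y0; split => //; rewrite -g0; exists 0 => //=; rewrite in_itv /= ler01 lexx.
- by exists A.
- by exists A => //; rewrite -[A]setCK; exact: open_closedC.
Qed.

End Lift.

End Descent.

Theorem corollary5p11 (R : realType) (m : nat) (K : {set {set 'I_m}})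
    (h : {vspace 'rV[R[i]]_m})
    (hK : simplicial_complex K)
    (ha : condition_a h K)
    (hb : condition_b h K)
    (hsc : simply_connected R (set_type (UK R K)))
    (hirr : no_rational_annihilator h) :
  forall f : meromorphic (quotient_hol K h), constant_meromorphic f.
Proof. exact: meromorphic_constant hK hsc hirr. Qed.
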